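(* For every positive even integer $d$, each of the following holds: \begin{itemize} \item[(a)] Every spherical $2$-design curve in $S^d$ has length at least \[ \frac{\pi}{\sqrt3}\cdot d+\frac{5\pi}{2\sqrt3}+1.44\cdot d^{-1}. \] \item[(b)] Write $d=2k$. There exists a spherical $2$-design curve in $S^d$ with length at most \[ \frac{\pi}{\sqrt3}\cdot d+\frac{5\pi}{2\sqrt3}+5.86\cdot d^{-1}, \] and it may be taken of the form $\gamma\colon[0,2\pi)\to S^{2k}$, \[ \gamma(\theta)=\big(x(\theta)\cos\theta,\ x(\theta)\sin\theta,\ x(\theta)\cos2\theta,\ x(\theta)\sin2\theta,\ \ldots,\ x(\theta)\cos k\theta,\ x(\theta)\sin k\theta,\ z(\theta)\big), \] where $z(\theta)=a_k\sin((k+1)\theta)$, $x(\theta)=\sqrt{(1-z(\theta)^2)/k}$, and $a_k\in(0,1)$ is such that \[ \int_0^{2\pi}\bigg(x(\theta)^2-\frac{2}{2k+1}\bigg)\sqrt{\sum_{\ell=1}^k\big(x'(\theta)^2+\ell^2x(\theta)^2\big)+z'(\theta)^2}\,d\theta=0, \] with $a_1^2\in(0.820,0.821)$ if $k=1$ and $a_k^2\in\big(\frac1k-\frac{1}{2k^3},\frac1k+\frac{1}{4k^3}\big)$ if $k\ge2$. \end{itemize}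
   Context: $S^d$ is the unit sphere in $\mathbb{R}^{d+1}$, $\sigma$ is the uniform (rotation-invariant) probability measure on $S^d$, and $\Pi_d^t$ is the vector space of restrictions to $S^d$ of real polynomials on $\mathbb{R}^{d+1}$ of degree at most $t$. Let $\gamma\colon[0,2\pi)\to S^d$ be a Lipschitz parameterization of a closed rectifiable curve (closed: $\gamma(\theta)\to\gamma(0)$ as $\theta\to 2\pi^-$), with arclength (length) $L(\gamma):=\int_0^{2\pi}\|\gamma'(\theta)\|\,d\theta$ (positive, so that the following formula makes sense). The curve $\gamma$ is a spherical $t$-design curve (or $t$-design curve) in $S^d$ if for all $f\in\Pi_d^t$, \[ \int_{S^d}f(x)\,d\sigma(x)=\frac{1}{L(\gamma)}\int_0^{2\pi}f(\gamma(\theta))\,\|\gamma'(\theta)\|\,d\theta. \] *)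

(* Defs.v *)
From HB Require Import structures.
From mathcomp Require Import all_boot all_order all_algebra.
From mathcomp Require Import all_classical all_reals all_analysis.
(* The notations of mpoly clash with those of mathcomp-analysis. *)
From mathcomp Require Import -(notations) mpoly.

Set Implicit Arguments.
Unset Strict Implicit.
Unset Printing Implicit Defensive.

Import Order.TTheory GRing.Theory Num.Theory.
Import numFieldNormedType.Exports.

Local Open Scope classical_set_scope.
Local Open Scope ring_scope.

(* The library norm `|v| on row vectors is the sup norm. It induces the same
   topology, Borel sets and derivatives, but lengths need the Euclidean norm. *)
Definition enorm (R : realType) (n : nat) (v : 'rV[R]_n) : R :=
  Num.sqrt (\sum_(i < n) v 0 i ^+ 2).

Definition sphere (R : realType) (d : nat) : set 'rV[R]_d.+1 :=
  [set v | enorm v = 1].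
Arguments sphere : clear implicits.

Definition borel_rV (R : realType) (n : nat) :=
  g_sigma_algebraType (@open 'rV[R]_n).

Definition is_rotation (R : realType) (n : nat) (M : 'M[R]_n) : Prop :=
  M *m M^T = 1%:M /\ \det M = 1.

(* sigma is a Borel probability measure on the ambient space R^(d+1); it is the
   uniform measure of S^d when it is carried by S^d and invariant under
   SO(d+1). *)
Definition uniform_on_sphere (R : realType) (d : nat)
    (sigma : probability (borel_rV R d.+1) R) : Prop :=
  sigma (sphere R d) = 1%E /\
  forall M : 'M[R]_d.+1, is_rotation M ->
  forall A : set (borel_rV R d.+1), measurable A ->
    sigma ((fun v : 'rV[R]_d.+1 => v *m M) @^-1` A) = sigma A.

(* Functions on S^d are represented by functions on R^(d+1), of which only the
   values on S^d are constrained (and used). In multinomials, msize p is the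
   total degree of p plus one, and 0 when p = 0. *)
Definition poly_space (R : realType) (d t : nat) : set ('rV[R]_d.+1 -> R) :=
  [set f | exists2 p : mpoly d.+1 R, (msize p <= t.+1)%N &
           forall v, sphere R d v -> f v = meval (fun i => v 0 i) p].

Definition speed (R : realType) (d : nat) (gamma : R -> 'rV[R]_d.+1)
    (theta : R) : R :=
  enorm (derive1 gamma theta).

Definition curve_length (R : realType) (d : nat)
    (gamma : R -> 'rV[R]_d.+1) : R :=
  \int[lebesgue_measure]_(theta in `[0, 2 * pi[) speed gamma theta.

(* A curve [0, 2 pi) -> S^d is represented by a function on R of which only the
   values on [0, 2 pi) matter: the values elsewhere can affect the derivative
   only at 0, hence no integral. Likewise, a Lipschitz gamma is differentiable
   almost everywhere, so the default value of derive1 gamma at the remaining points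
   is irrelevant. *)
Definition closed_lipschitz_curve (R : realType) (d : nat)
    (gamma : R -> 'rV[R]_d.+1) : Prop :=
  [/\ forall theta, 0 <= theta < 2 * pi -> sphere R d (gamma theta),
      exists K : R, forall s t, 0 <= s < 2 * pi -> 0 <= t < 2 * pi ->
        enorm (gamma s - gamma t) <= K * `|s - t|
    & gamma theta @[theta --> (2 * pi)^'-] --> gamma 0].

Definition design_curve (R : realType) (d : nat)
    (sigma : probability (borel_rV R d.+1) R) (t : nat)
    (gamma : R -> 'rV[R]_d.+1) : Prop :=
  [/\ closed_lipschitz_curve gamma,
      0 < curve_length gamma
    & forall f, poly_space t f ->
        \int[sigma]_(v in sphere R d) f v =
        (curve_length gamma)^-1 *
        \int[lebesgue_measure]_(theta in `[0, 2 * pi[)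
           (f (gamma theta) * speed gamma theta)].

Definition zfun (R : realType) (k : nat) (a theta : R) : R :=
  a * sin (k.+1%:R * theta).

Definition xfun (R : realType) (k : nat) (a theta : R) : R :=
  Num.sqrt ((1 - zfun k a theta ^+ 2) / k%:R).

(* For d = 2k the 0-based coordinates 2l-2 and 2l-1 (1 <= l <= k) are
   x cos(l theta) and x sin(l theta), and the last coordinate, d, is z. The
   dimension d is kept separate from k to avoid a cast. *)
Definition short_curve (R : realType) (d k : nat) (a theta : R)
    : 'rV[R]_d.+1 :=
  \row_(i < d.+1)
    if i == d :> nat then zfun k a theta
    else if odd i then xfun k a theta * sin ((i./2.+1)%:R * theta)
    else xfun k a theta * cos ((i./2.+1)%:R * theta).

Definition balance_integral (R : realType) (k : nat) (a : R) : R :=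
  \int[lebesgue_measure]_(theta in `[0, 2 * pi[)
    ((xfun k a theta ^+ 2 - 2 / (2 * k + 1)%:R) *
     Num.sqrt (\sum_(1 <= l < k.+1)
                 (derive1 (xfun k a) theta ^+ 2
                  + l%:R ^+ 2 * xfun k a theta ^+ 2)
               + derive1 (zfun k a) theta ^+ 2)).

(* Main.v *)
(** Lower bound: parametrize the curve by arclength. Each coordinate has mean zero
    and the quadratic moments are those of the uniform measure, so the power carried
    by the pair of m-th Fourier coefficients, summed over the coordinates, is at most
    2 / (d + 1), while all powers add up to 1 (the curve lies on the sphere) and the
    sum weighted by (2 pi m / L) ^ 2 is 1 (unit speed). The weights are smallest when
    the first d / 2 frequencies are saturated, which bounds L from below. This is
    carried out on N equally spaced points, with N going to infinity, so that only the
    discrete Parseval identity is needed.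

    Short curve: with A = a ^ 2, its squared speed is an explicit rational function of
    s = sin ((k + 1) theta) ^ 2. As the speed has period pi / (k + 1), all quadratic
    moments other than those of the squared coordinates vanish by orthogonality, and
    the latter are right exactly when the balance integral vanishes. A root A is found
    by the intermediate value theorem: at the two ends of an interval the sign of the
    balance integral, the mean of (s - s0) w for the speed w, follows by comparing w
    with an explicit multiple of a simple function that agrees with w at s0. The length
    is bounded by the Cauchy-Schwarz inequality. *)
Require Import Defs.
From HB Require Import structures.
From mathcomp Require Import all_boot all_order all_algebra.
From mathcomp Require Import all_classical all_reals all_analysis.
From mathcomp Require Import -(notations) mpoly.
From mathcomp Require Import measurable_realfun ring lra zify.

Set Implicit Arguments.
Unset Strict Implicit.
Unset Printing Implicit Defensive.

Import Order.TTheory GRing.Theory Num.Theory.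
Import numFieldNormedType.Exports.

Local Open Scope classical_set_scope.
Local Open Scope ring_scope.

(** * Real functions and integrals *)

(** Equality in the lower bound would ask each of the frequencies 1, ..., d / 2 to carry its full
    share 2 / (d + 1), and frequency d / 2 + 1 the remaining 1 / (d + 1). The short curve imitates
    this: each pair of coordinates turns at one of the frequencies 1, ..., k and z takes frequency k
    + 1. Since z oscillates, x has to vary to stay on the sphere, and a single scalar condition, the
    balance, restores the moments. A Lipschitz curve may stand still on an interval, so its
    arclength function need not be invertible: nothing is literally reparametrized, and functions on
    [0, 2 pi] are compared with arclength in the original parameter. The speed of the short curve is
    a square root, whose averages have no convenient closed form. Polynomials in s and simple poles
    1 / (p - s) do have one, which dictates the comparison functions. Their polynomial sign
    conditions are certified in Bernstein bases, with powers of k - 2 as a second nonnegative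
    variable. *)

Section RintegralSum.
Variables (d : measure_display) (T : measurableType d) (R : realType).
Variables (mu : {measure set T -> \bar R}) (D : set T).
Hypothesis mD : measurable D.

Lemma RintegrableZ (c : R) (f : T -> R) : mu.-integrable D (EFin \o f) ->
  mu.-integrable D (EFin \o (fun x => c * f x)).
Proof. exact: (integrableZl mD). Qed.

Lemma RintegrableD (f g : T -> R) : mu.-integrable D (EFin \o f) ->
  mu.-integrable D (EFin \o g) -> mu.-integrable D (EFin \o (fun x => f x + g x)).
Proof. exact: (integrableD mD). Qed.

Lemma RintegrableB (f g : T -> R) : mu.-integrable D (EFin \o f) ->
  mu.-integrable D (EFin \o g) -> mu.-integrable D (EFin \o (fun x => f x - g x)).
Proof. exact: (integrableB mD). Qed.

Lemma Rintegrable_sum (I : Type) (r : seq I) (P : pred I) (f : I -> T -> R) :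
  (forall i, P i -> mu.-integrable D (EFin \o f i)) ->
  mu.-integrable D (EFin \o (fun x => \sum_(i <- r | P i) f i x)).
Proof.
move=> fi; elim: r => [|i r IH].
  have -> : (fun x => \sum_(i <- [::] | P i) f i x) = cst 0.
    by apply/funext => x; rewrite big_nil.
  exact: integrable0.
have -> : (fun x => \sum_(j <- i :: r | P j) f j x) =
    (fun x => if P i then f i x + \sum_(j <- r | P j) f j x else \sum_(j <- r | P j) f j x).
  by apply/funext => x; rewrite big_cons.
case Pi : (P i) => //; apply: (integrableD mD (fi i Pi) IH).
Qed.

Lemma Rintegral_sum (I : Type) (r : seq I) (P : pred I) (f : I -> T -> R) :
  (forall i, P i -> mu.-integrable D (EFin \o f i)) ->
  \int[mu]_(x in D) (\sum_(i <- r | P i) f i x) =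
  \sum_(i <- r | P i) \int[mu]_(x in D) f i x.
Proof.
move=> fi; elim: r => [|i r IH].
  rewrite big_nil; transitivity (\int[mu]_(x in D) (0 : R)).
    by apply: eq_Rintegral => x _; rewrite big_nil.
  by rewrite /Rintegral integral0.
rewrite big_cons; transitivity (\int[mu]_(x in D)
    (if P i then f i x + \sum_(j <- r | P j) f j x else \sum_(j <- r | P j) f j x)).
  by apply: eq_Rintegral => x _; rewrite big_cons.
case Pi : (P i) => //; rewrite RintegralD ?IH//; first exact: fi.
exact: Rintegrable_sum.
Qed.

End RintegralSum.

Section RealDerivatives.
Variables (R : realType) (x : R).
Implicit Types (f g : R -> R) (a b c : R).

Lemma der_cst c : is_derive x 1 (fun _ => c) (0 : R).
Proof. exact: is_derive_cst. Qed.

Lemma der_id : is_derive x 1 (fun y : R => y) (1 : R).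
Proof. exact: is_derive_id. Qed.

Lemma derD f g a b : is_derive x 1 f a -> is_derive x 1 g b ->
  is_derive x 1 (fun y => f y + g y) (a + b).
Proof. by move=> df dg; exact: is_deriveD. Qed.

Lemma derB f g a b : is_derive x 1 f a -> is_derive x 1 g b ->
  is_derive x 1 (fun y => f y - g y) (a - b).
Proof. by move=> df dg; exact: is_deriveB. Qed.

Lemma derM f g a b : is_derive x 1 f a -> is_derive x 1 g b ->
  is_derive x 1 (fun y => f y * g y) (a * g x + f x * b).
Proof.
by move=> df dg; rewrite addrC [a * _]mulrC; exact: is_deriveM.
Qed.

Lemma derZ c f a : is_derive x 1 f a -> is_derive x 1 (fun y => c * f y) (c * a).
Proof. by move=> df; have := is_deriveZ c df. Qed.

Lemma der_sin f a : is_derive x 1 f a ->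
  is_derive x 1 (fun y => sin (f y)) (a * cos (f x)).
Proof. by move=> df; rewrite mulrC; exact: is_derive1_comp. Qed.

Lemma der_cos f a : is_derive x 1 f a ->
  is_derive x 1 (fun y => cos (f y)) (- (a * sin (f x))).
Proof. by move=> df; rewrite mulrC -mulNr; exact: is_derive1_comp. Qed.

Lemma der_sqrt f a : 0 < f x -> is_derive x 1 f a ->
  is_derive x 1 (fun y => Num.sqrt (f y)) (a / (2 * Num.sqrt (f x))).
Proof. by move=> fx df; rewrite mulrC; apply: is_derive1_comp; exact: is_derive1_sqrt. Qed.

Lemma der_val f a : is_derive x 1 f a -> derive1 f x = a.
Proof. by move=> df; rewrite derive1E derive_val. Qed.

Lemma der_ext f g a b : f =1 g -> a = b -> is_derive x 1 f a -> is_derive x 1 g b.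
Proof. by move=> /funext-> ->. Qed.

Lemma der_cont f a : is_derive x 1 f a -> {for x, continuous f}.
Proof. by move=> df; apply/differentiable_continuous/derivable1_diffP. Qed.

End RealDerivatives.

Section EuclideanNorm.
Variables (R : realType) (n : nat).
Implicit Types (u v : 'rV[R]_n).

Lemma cauchy_schwarz_sum (I : finType) (u v : I -> R) :
  (\sum_i u i * v i) ^+ 2 <= (\sum_i u i ^+ 2) * (\sum_i v i ^+ 2).
Proof.
have h : 0 <= \sum_i \sum_j (u i * v j - u j * v i) ^+ 2.
  by apply: sumr_ge0 => i _; apply: sumr_ge0 => j _; exact: sqr_ge0.
have e : \sum_i \sum_j (u i * v j - u j * v i) ^+ 2 =
    2 * ((\sum_i u i ^+ 2) * (\sum_i v i ^+ 2) - (\sum_i u i * v i) ^+ 2).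
  transitivity (\sum_i \sum_j u i ^+ 2 * v j ^+ 2 + \sum_i \sum_j u j ^+ 2 * v i ^+ 2
     - 2 * \sum_i \sum_j (u i * v i) * (u j * v j)).
    rewrite -big_split mulr_sumr -sumrB/=; apply: eq_bigr => i _.
    rewrite -big_split mulr_sumr -sumrB/=; apply: eq_bigr => j _; ring.
  rewrite [X in _ + X - _]exchange_big/= -!big_distrlr/= expr2; ring.
by move: h; rewrite e pmulr_rge0// subr_ge0.
Qed.

Lemma enorm_ge0 v : 0 <= enorm v.
Proof. exact: sqrtr_ge0. Qed.

Lemma sqr_enorm v : enorm v ^+ 2 = \sum_(i < n) v 0 i ^+ 2.
Proof. by rewrite sqr_sqrtr// sumr_ge0// => i _; exact: sqr_ge0. Qed.

Lemma coord_le_enorm v i : `|v 0 i| <= enorm v.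
Proof.
rewrite -(@ler_pXn2r _ 2)// ?nnegrE ?enorm_ge0// sqr_enorm real_normK ?num_real//.
by rewrite (bigD1 i)//= lerDl sumr_ge0// => j _; exact: sqr_ge0.
Qed.

Lemma enorm_le_sum v : enorm v <= \sum_(i < n) `|v 0 i|.
Proof.
have h0 : 0 <= \sum_(i < n) `|v 0 i| by apply: sumr_ge0.
rewrite -(@ler_pXn2r _ 2)// ?nnegrE ?enorm_ge0// sqr_enorm expr2 mulr_suml.
apply: ler_sum => i _; rewrite -real_normK ?num_real// expr2 ler_wpM2l//.
by rewrite (bigD1 i)//= lerDl sumr_ge0.
Qed.

Lemma dot_le_enorm u v : \sum_(i < n) u 0 i * v 0 i <= enorm u * enorm v.
Proof.
have := cauchy_schwarz_sum (u 0) (v 0); rewrite -!sqr_enorm -exprMn => h.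
rewrite (le_trans (ler_norm _))//.
by rewrite -(@ler_pXn2r _ 2)// ?nnegrE ?mulr_ge0 ?enorm_ge0// real_normK ?num_real.
Qed.
End EuclideanNorm.

(** * Taylor bounds for sine and cosine, and numerical bounds for pi *)

Section TrigBounds.
Variable R : realType.
Implicit Types x y : R.

Lemma le_of_derive (f g f' g' : R -> R) :
  (forall x, is_derive x 1 f (f' x)) -> (forall x, is_derive x 1 g (g' x)) ->
  f 0 = g 0 -> (forall x, 0 <= x -> f' x <= g' x) -> forall x, 0 <= x -> f x <= g x.
Proof.
move=> df dg f0 h x x0.
pose k y := g y - f y.
have dh y : is_derive y 1 k (g' y - f' y) by exact: derB.
have : k 0 <= k x.
  apply: (@ger0_derive1_ndecr R k 0 x) => //.
  - by move=> y; rewrite in_itv/= => hy; rewrite (der_val (dh y)) subr_ge0 h//; lra.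
  - by apply: derivable_within_continuous => y _; case: (dh y).
by rewrite /k f0 subrr subr_ge0.
Qed.

Lemma der_pow x n : is_derive x 1 (fun y : R => y ^+ n) (n%:R * x ^+ n.-1).
Proof.
elim: n => [|n IH]; first by rewrite mul0r; exact: der_cst.
apply: der_ext (derM (der_id x) IH) => [y|]; first by rewrite exprS.
by case: n {IH} => [|n]; rewrite ?expr0 /= -?natr1 ?exprS; ring.
Qed.

(** This bound and the next five follow from one another by integrating from 0, in the alternating
    pattern of the Taylor polynomials. *)
Lemma sin_le_id x : 0 <= x -> sin x <= x.
Proof.
by apply: (le_of_derive (@is_derive_sin R) (@der_id R) (sin0 R)) => y _; exact: cos_le1.
Qed.

Lemma cos_ge_2 x : 0 <= x -> 1 - x ^+ 2 / 2 <= cos x.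
Proof.
have d y : is_derive y 1 (fun x => 1 - x ^+ 2 / 2) (- y).
  by apply: der_ext (derB (der_cst y 1) (derZ 2^-1 (der_pow y 2))) => [z|] /=; field.
apply: (le_of_derive d (@is_derive_cos R)); first by rewrite cos0; field.
by move=> y y0; rewrite lerN2 sin_le_id.
Qed.

Lemma sin_ge_3 x : 0 <= x -> x - x ^+ 3 / 6 <= sin x.
Proof.
have d y : is_derive y 1 (fun x => x - x ^+ 3 / 6) (1 - y ^+ 2 / 2).
  by apply: der_ext (derB (der_id y) (derZ 6^-1 (der_pow y 3))) => [z|] /=; field.
apply: (le_of_derive d (@is_derive_sin R)); first by rewrite sin0; field.
exact: cos_ge_2.
Qed.

Lemma cos_le_4 x : 0 <= x -> cos x <= 1 - x ^+ 2 / 2 + x ^+ 4 / 24.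
Proof.
have d y : is_derive y 1 (fun x => 1 - x ^+ 2 / 2 + x ^+ 4 / 24) (- y + y ^+ 3 / 6).
  by apply: der_ext (derD (derB (der_cst y 1) (derZ 2^-1 (der_pow y 2)))
    (derZ 24^-1 (der_pow y 4))) => [z|] /=; field.
apply: (le_of_derive (@is_derive_cos R) d); first by rewrite cos0; field.
by move=> y y0; have := sin_ge_3 y0; lra.
Qed.

Lemma sin_le_5 x : 0 <= x -> sin x <= x - x ^+ 3 / 6 + x ^+ 5 / 120.
Proof.
have d y : is_derive y 1 (fun x => x - x ^+ 3 / 6 + x ^+ 5 / 120) (1 - y ^+ 2 / 2 + y ^+ 4 / 24).
  by apply: der_ext (derD (derB (der_id y) (derZ 6^-1 (der_pow y 3)))
    (derZ 120^-1 (der_pow y 5))) => [z|] /=; field.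
apply: (le_of_derive (@is_derive_sin R) d); first by rewrite sin0; field.
exact: cos_le_4.
Qed.

Lemma cos_ge_6 x : 0 <= x -> 1 - x ^+ 2 / 2 + x ^+ 4 / 24 - x ^+ 6 / 720 <= cos x.
Proof.
have d y : is_derive y 1 (fun x => 1 - x ^+ 2 / 2 + x ^+ 4 / 24 - x ^+ 6 / 720)
    (- y + y ^+ 3 / 6 - y ^+ 5 / 120).
  by apply: der_ext (derB (derD (derB (der_cst y 1) (derZ 2^-1 (der_pow y 2)))
    (derZ 24^-1 (der_pow y 4))) (derZ 720^-1 (der_pow y 6))) => [z|] /=; field.
apply: (le_of_derive d (@is_derive_cos R)); first by rewrite cos0; field.
by move=> y y0; have := sin_le_5 y0; lra.
Qed.

(** Otherwise pi / 2 would lie in [1, 1563 / 1000], where the Taylor minorant of degree 6 is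
    positive although cos (pi / 2) = 0. The precision is dictated by the constant 1.44 of the lower
    bound. *)
Lemma pi_gt_lower : 1563 / 500 < pi :> R.
Proof.
rewrite ltNge; apply/negP => h; have h2 := pi_ge2 R.
set p := pi / 2 : R; have p1 : 1 <= p <= 1563 / 1000 by rewrite /p; lra.
have := cos_ge_6 (x := p) ltac:(lra); rewrite cos_pihalf.
have -> : p ^+ 4 = (p ^+ 2) ^+ 2 by ring.
have -> : p ^+ 6 = (p ^+ 2) ^+ 3 by ring.
have : 0 <= p ^+ 2 <= 2443 / 1000 by nra.
set q := p ^+ 2; move=> hq h3; have : 0 <= q ^+ 2 * (30 - q) by nra.
have : q * q <= 2443 / 1000 * q by nra.
nra.
Qed.

(** If pi were at least 3.2, cos (1.6) would be nonnegative, while its Taylor majorant of degree 4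
    is negative. *)
Lemma pi_lt_upper : pi < 32 / 10 :> R.
Proof.
rewrite ltNge; apply/negP => h.
have : 0 < cos (16 / 10 : R) \/ pi = 32 / 10 :> R.
  have [e|ne] := eqVneq (pi : R) (32 / 10); [by right|left].
  apply: cos_gt0_pihalf; have : 32 / 10 < pi :> R by rewrite lt_neqAle eq_sym ne.
  lra.
have := cos_le_4 (x := 16 / 10 : R) ltac:(lra) => hc.
case=> [|e]; first by move: hc; lra.
have := cos_pihalf R; rewrite e => e2; have e3 : 32 / 10 / 2 = 16 / 10 :> R by field.
by move: hc; rewrite e3 in e2; rewrite e2; lra.
Qed.

Lemma two_sub_2cos_bounds x : 0 <= x ->
  x ^+ 2 - x ^+ 4 / 12 <= 2 - 2 * cos x <= x ^+ 2.
Proof. by move=> x0; have := cos_ge_2 x0; have := cos_le_4 x0; lra. Qed.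

(** The eigenvalues of the second difference on a cycle of N + 1 points, suitably scaled, tend to
    those of minus the second derivative on a circle of length 1. *)
Lemma cvg_dft_eigenvalue (m : nat) :
  (fun N : nat => N.+1%:R ^+ 2 * (2 - 2 * cos (m%:R * (2 * pi / N.+1%:R)))) @ \oo
    --> ((m%:R * (2 * pi)) ^+ 2 : R).
Proof.
set X : R := m%:R * (2 * pi); have X0 : 0 <= X by rewrite mulr_ge0// mulr_ge0// pi_ge0.
have inv0 : (fun N : nat => N.+1%:R^-1) @ \oo --> (0 : R) by exact: cvg_harmonic.
apply: (@squeeze_cvgr _ _ _ _ (fun N : nat => X ^+ 2 - X ^+ 4 / 12 * N.+1%:R^-1 * N.+1%:R^-1)
  (fun=> X ^+ 2)); last 2 first.
- rewrite -[X in _ --> X]subr0 -[X in _ --> _ - X](mulr0 (X ^+ 4 / 12 * 0)).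
  apply: cvgB; first exact: cvg_cst.
  by apply: cvgM => //; apply: cvgM => //; exact: cvg_cst.
- exact: cvg_cst.
near=> N; have N0 : (0 : R) < N.+1%:R by rewrite ltr0n.
have -> : m%:R * (2 * pi / N.+1%:R) = X / N.+1%:R by rewrite /X; field; exact: lt0r_neq0.
have := @two_sub_2cos_bounds (X / N.+1%:R) (divr_ge0 X0 (ltW N0)).
rewrite -(ler_pM2l (exprn_gt0 2 N0)) -(ler_pM2l (exprn_gt0 2 N0) (2 - _)).
have -> : N.+1%:R ^+ 2 * ((X / N.+1%:R) ^+ 2 - (X / N.+1%:R) ^+ 4 / 12) =
  X ^+ 2 - X ^+ 4 / 12 / N.+1%:R / N.+1%:R by field; exact: lt0r_neq0.
by have -> : N.+1%:R ^+ 2 * (X / N.+1%:R) ^+ 2 = X ^+ 2 by field; exact: lt0r_neq0.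
Unshelve. all: by end_near. Qed.
End TrigBounds.

(** * Discrete Fourier coefficients on N equally spaced points *)

Section DiscreteFourier.
Variables (R : realType) (N : nat).
Hypothesis N_gt0 : (0 < N)%N.
Implicit Types (f : nat -> R) (m i j : nat).

Let w m i : R := (m * i)%:R * (2 * pi / N%:R).

Definition dcos f m := \sum_(i < N) f i * cos (w m i).
Definition dsin f m := \sum_(i < N) f i * sin (w m i).
Definition dpow f m := dcos f m ^+ 2 + dsin f m ^+ 2.

Lemma cosD2piMn (x : R) n : cos (x + n%:R * (2 * pi)) = cos x.
Proof.
elim: n => [|n IH]; first by rewrite mul0r addr0.
rewrite -(natr1 n) mulrDl mul1r addrA [2 * pi](_ : _ = pi *+ 2) ?mulr2n; last by ring.
rewrite -mulr2n cosD2pi -IH; congr (cos (_ + _)); rewrite mulr2n; ring.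
Qed.

Lemma sinD2piMn (x : R) n : sin (x + n%:R * (2 * pi)) = sin x.
Proof.
elim: n => [|n IH]; first by rewrite mul0r addr0.
rewrite -(natr1 n) mulrDl mul1r addrA [2 * pi](_ : _ = pi *+ 2) ?mulr2n; last by ring.
rewrite -mulr2n sinD2pi -IH; congr (sin (_ + _)); rewrite mulr2n; ring.
Qed.

(* Multiplying the sum by 2 sin (x / 2) makes it telescope. *)
Lemma sum_cos_telescope (x : R) n :
  2 * sin (x / 2) * \sum_(m < n) cos (m%:R * x) =
  sin (n%:R * x - x / 2) + sin (x / 2).
Proof.
elim: n => [|n IH]; first by rewrite big_ord0 mul0r sub0r sinN mulr0 addNr.
rewrite big_ord_recr/= mulrDr IH -(natr1 n).
have -> : (n%:R + 1) * x - x / 2 = n%:R * x + x / 2 by field.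
by rewrite !sinD sinN cosN; ring.
Qed.

(** The real part of a vanishing sum of roots of unity; the factor sin (x / 2) can be cancelled
    since x / 2 = pi j / N lies strictly between 0 and pi. *)
Lemma sum_cos_roots (j : nat) : (0 < j < N)%N ->
  \sum_(m < N) cos (m%:R * (j%:R * (2 * pi / N%:R))) = 0 :> R.
Proof.
move=> /andP[j0 jN]; set x := j%:R * (2 * pi / N%:R).
have N0 : N%:R != 0 :> R by rewrite pnatr_eq0 -lt0n.
have sx : 0 < sin (x / 2).
  apply: sin_gt0_pi; have -> : x / 2 = pi * (j%:R / N%:R) by rewrite /x; field.
  rewrite mulr_gt0 ?pi_gt0 ?divr_gt0 ?ltr0n//=.
  by rewrite gtr_pMr ?pi_gt0// ltr_pdivrMr ?ltr0n// mul1r ltr_nat.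
have := sum_cos_telescope x N.
have -> : N%:R * x - x / 2 = - (x / 2) + j%:R * (2 * pi) by rewrite /x; field.
rewrite sinD2piMn sinN addNr => /eqP; rewrite mulf_eq0 => /orP[|/eqP//].
by rewrite mulf_eq0 pnatr_eq0/= (gt_eqF sx).
Qed.

Lemma sum_cos_diff i j : (i < N)%N -> (j < N)%N ->
  \sum_(m < N) cos (w m i - w m j) = (i == j)%:R * N%:R.
Proof.
wlog ij : i j / (i <= j)%N => [hw iN jN|iN jN].
  have [ij|/ltnW ji] := leqP i j; first exact: hw.
  rewrite eq_sym -(hw j i ji jN iN); apply: eq_bigr => m _.
  by rewrite -cosN opprB.
have [<-|nij] := eqVneq i j.
  by under eq_bigr do rewrite subrr cos0; rewrite sumr_const card_ord mul1r.
rewrite mul0r -[RHS](@sum_cos_roots (j - i)); last first.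
  by move: nij ij jN; lia.
apply: eq_bigr => m _; rewrite -cosN opprB; congr cos.
by rewrite /w natrB// !natrM; ring.
Qed.

(** Expanded as double sums over i and j, the powers involve only the cosine of a phase difference,
    and summing over m leaves the diagonal. *)
Lemma discrete_parseval f :
  \sum_(m < N) dpow f m = N%:R * \sum_(i < N) f i ^+ 2.
Proof.
have E m : dpow f m = \sum_(i < N) \sum_(j < N) f i * f j * cos (w m i - w m j).
  rewrite /dpow /dcos /dsin !expr2 !big_distrlr/= -big_split/=.
  apply: eq_bigr => i _; rewrite -big_split/=; apply: eq_bigr => j _.
  by rewrite cosB; ring.
under eq_bigr do rewrite E.
rewrite exchange_big/= mulr_sumr; apply: eq_bigr => i _.
rewrite exchange_big/= (bigD1 i)//= [X in _ + X]big1 ?addr0.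
  by rewrite -mulr_sumr sum_cos_diff// eqxx mul1r; ring.
move=> j ji; rewrite -mulr_sumr sum_cos_diff// eq_sym.
by rewrite -(inj_eq val_inj) in ji; rewrite (negbTE ji) mul0r mulr0.
Qed.

Definition dshift f i := f (i.+1 %% N)%N.

(* Shifting the sequence rotates the pair of coefficients by the angle w m 1. *)
Lemma dpow_diff f m :
  dpow (fun i => dshift f i - f i) m = (2 - 2 * cos (w m 1)) * dpow f m.
Proof.
have N0 : N%:R != 0 :> R by rewrite pnatr_eq0 -lt0n.
have wS i : w m i.+1 = w m i + w m 1 by rewrite /w !natrM -(natr1 i); ring.
(* Reindexing along the cyclic shift: the last index wraps to 0, which the periodicity of [g]
   absorbs. *)
have per (g : R -> R) (gper : forall x n, g (x + n%:R * (2 * pi)) = g x) :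
    \sum_(i < N) dshift f i * g (w m i.+1) = \sum_(i < N) f i * g (w m i).
  move: N_gt0 N0; rewrite /dshift /w; case: (N) => // n _ N0.
  rewrite big_ord_recr/= modnn big_ord_recl/= addrC; congr (_ + _).
    rewrite muln0 mul0r -(gper 0 m) add0r; congr (_ * g _).
    by rewrite natrM; field.
  by apply: eq_bigr => i _; rewrite modn_small// ltnS.
have hc : \sum_(i < N) dshift f i * cos (w m i) =
    cos (w m 1) * dcos f m + sin (w m 1) * dsin f m.
  rewrite /dcos /dsin -(per _ cosD2piMn) -(per _ sinD2piMn) !mulr_sumr -big_split/=.
  apply: eq_bigr => i _; rewrite (wS i) sinD cosD.
  have := cos2Dsin2 (w m 1) => h; rewrite -[LHS]mulr1 -h; ring.
have hs : \sum_(i < N) dshift f i * sin (w m i) =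
    cos (w m 1) * dsin f m - sin (w m 1) * dcos f m.
  rewrite /dcos /dsin -(per _ cosD2piMn) -(per _ sinD2piMn) !mulr_sumr -sumrB.
  apply: eq_bigr => i _; rewrite (wS i) sinD cosD.
  have := cos2Dsin2 (w m 1) => h; rewrite -[LHS]mulr1 -h; ring.
have -> : dpow (fun i => dshift f i - f i) m =
   (cos (w m 1) * dcos f m + sin (w m 1) * dsin f m - dcos f m) ^+ 2 +
   (cos (w m 1) * dsin f m - sin (w m 1) * dcos f m - dsin f m) ^+ 2.
  rewrite /dpow -{1}hc -{1}hs /dcos /dsin -!sumrB.
  by congr (_ ^+ 2 + _ ^+ 2); apply: eq_bigr => i _; rewrite mulrBl.
rewrite /dpow; have := cos2Dsin2 (w m 1); set c := cos _; set s := sin _ => h.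
have h2 : s ^+ 2 = 1 - c ^+ 2 by rewrite -h; ring.
transitivity ((c ^+ 2 + s ^+ 2 + 1 - 2 * c) * (dcos f m ^+ 2 + dsin f m ^+ 2)); first ring.
by rewrite h; ring.
Qed.

End DiscreteFourier.

Section QuadraticPolynomials.
Variables (R : realType) (d : nat).

Lemma poly_space_coord (i : 'I_d.+1) :
  poly_space (R := R) (d := d) 2 (fun v => v 0 i).
Proof.
exists (mpolyX R (mnm1 i)); first by rewrite msizeX mdeg1.
by move=> v _; rewrite mevalXU.
Qed.

Lemma poly_space_coord2 (i j : 'I_d.+1) :
  poly_space (R := R) (d := d) 2 (fun v => v 0 i * v 0 j).
Proof.
exists (mpolyX R (mnm_add (mnm1 i) (mnm1 j))); first by rewrite msizeX mdegD !mdeg1.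
by move=> v _; rewrite mpolyXD mevalM !mevalXU.
Qed.

Lemma quadratic_monomial n (m : multinom n) : (mdeg m <= 2)%N ->
  [\/ forall v : 'I_n -> R, \prod_i v i ^+ m i = 1,
      exists i, forall v : 'I_n -> R, \prod_i v i ^+ m i = v i
    | exists i j, forall v : 'I_n -> R, \prod_i v i ^+ m i = v i * v j].
Proof.
move=> m2; have [/eqP|m0] := eqVneq (mdeg m) 0%N.
  rewrite mdeg_eq0 => /eqP ->; apply: Or31 => v.
  by apply: big1 => i _; rewrite mnm0E expr0.
have [/eqP/mdeg1P[i /eqP ->]|m1] := eqVneq (mdeg m) 1%N.
  by apply: Or32; exists i => v; rewrite -mevalX mevalXU.
have [i mi] : exists i, m i != 0%N.
  apply: contrapT => h; move: m0; rewrite mdeg_eq0 => /eqP; apply.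
  by apply/mnmP => i; rewrite mnm0E; apply: contrapT => /eqP hi; apply: h; exists i.
(* Take out one variable that occurs in the monomial; what remains has degree 1. *)
have em : m = mnm_add (mnm_sub m (mnm1 i)) (mnm1 i).
  apply/mnmP => j; rewrite mnmDE mnmBE mnm1E.
  by case: eqP => [<-|_]; rewrite ?addn0 ?subn0 ?subnK ?lt0n.
have : mdeg (mnm_sub m (mnm1 i)) == 1%N.
  have : mdeg m = (mdeg (mnm_sub m (mnm1 i)) + 1)%N by rewrite {1}em mdegD mdeg1.
  by move: m0 m1 m2; lia.
move=> /mdeg1P[j /eqP ej]; apply: Or33; exists j, i => v.
by rewrite -mevalX em ej mpolyXD mevalM !mevalXU.
Qed.
End QuadraticPolynomials.

Section NullSets.
Import HBNNSimple.

(** Neither integrand is assumed measurable, so that the lemma applies to the raw speed of a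
    Lipschitz curve. The proof goes back to the suprema over simple functions: multiplying a simple
    function by the indicator of the complement of [N] keeps its integral and makes it comparable
    with the other integrand. *)
Lemma integral_eq_off_null d (T : measurableType d) (R : realType)
    (mu : {measure set T -> \bar R}) (D N : set T) (f g : T -> \bar R) :
  measurable N -> mu N = 0%E -> (forall x, D x -> ~ N x -> f x = g x) ->
  (\int[mu]_(x in D) f x = \int[mu]_(x in D) g x)%E.
Proof.
move=> mN N0.
have half (u v : T -> \bar R) : (forall x, 0 <= v x)%E ->
    (forall x, ~ N x -> u x = v x) ->
    (ereal_sup [set sintegral mu h |
       h in [set h : {nnsfun T >-> R} | forall x, (h x)%:E <= u x]]
     <= ereal_sup [set sintegral mu h |
       h in [set h : {nnsfun T >-> R} | forall x, (h x)%:E <= v x]])%E.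
  move=> v0 uv; apply: ge_ereal_sup => _ [h hu <-].
  apply: ereal_sup_ubound; exists (proj_nnsfun h (measurableC mN)).
    move=> x; rewrite /proj_nnsfun/= mindicE.
    have [xN|xN] := boolP (x \in _); last by rewrite mulr0.
    by rewrite mulr1 -uv//; move: xN; rewrite inE.
  rewrite -!integralT_nnsfun; apply: ge0_ae_eq_integral => //.
  - exact/measurable_EFinP.
  - exact/measurable_EFinP.
  - by move=> x _; rewrite lee_fin.
  - by move=> x _; rewrite lee_fin.
  exists N; split => // x /=; apply: contra_notP => xN _.
  by rewrite mindicE mem_set// mulr1.
have eqv (u v : T -> \bar R) : (forall x, 0 <= u x)%E -> (forall x, 0 <= v x)%E ->
    (forall x, ~ N x -> u x = v x) ->
    (ereal_sup [set sintegral mu h |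
       h in [set h : {nnsfun T >-> R} | forall x, (h x)%:E <= u x]]
     = ereal_sup [set sintegral mu h |
       h in [set h : {nnsfun T >-> R} | forall x, (h x)%:E <= v x]])%E.
  move=> u0 v0 uv; apply/eqP; rewrite eq_le !half// => x /uv //.
move=> fg; rewrite /integral; congr (_ - _)%E; apply: eqv => // x Nx;
  rewrite ?funeposE ?funenegE !patchE; case: ifPn => //; rewrite inE => Dx;
  by rewrite fg.
Qed.
End NullSets.

(** * Lipschitz curves and arclength *)

Section LipschitzPrimitive.
Variables (R : realType) (c : R) (F : R -> R).
Hypothesis c_gt0 : 0 < c.
Hypothesis F_lip : forall x y, `|F x - F y| <= c * `|x - y|.
Local Notation leb := (@lebesgue_measure R).

(** Both [G] and [H] are nondecreasing because [F] is c-Lipschitz, and they add up to the identity.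
    Hence the Stieltjes measure of [G] is at most Lebesgue measure and has a density. *)
Let G x := (F x + c * x) / (2 * c).
Let H x := x - G x.

Let F_bounds x y : x <= y -> (F y - F x <= c * (y - x)) && (F x - F y <= c * (y - x)).
Proof.
move=> xy; have := F_lip y x; rewrite (ger0_norm (x := y - x)) ?subr_ge0//.
by rewrite ler_norml => /andP[? ?]; apply/andP; split => //; lra.
Qed.

Let G_nd : {homo G : x y / x <= y}.
Proof.
move=> x y xy; have /andP[_ h] := F_bounds xy.
by rewrite /G ler_pM2r ?invr_gt0 ?mulr_gt0//; lra.
Qed.

Let H_nd : {homo H : x y / x <= y}.
Proof.
move=> x y xy; have /andP[h _] := F_bounds xy.
have : (F y + c * y) - (F x + c * x) <= (2 * c) * (y - x) by lra.
rewrite -ler_pdivrMl ?mulr_gt0// => h2.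
by rewrite /H /G; have := h2; rewrite mulrBr ![(2 * c)^-1 * _]mulrC; lra.
Qed.

Let F_cont : continuous F.
Proof.
move=> x; apply/cvgrPdist_le => e e0.
near=> y; rewrite (le_trans (F_lip _ _))// mulrC -ler_pdivlMr//.
near: y; apply: cvgr_dist_le; [exact: cvg_id|exact: divr_gt0].
Unshelve. all: by end_near. Qed.

Let G_cont : continuous G.
Proof.
move=> x; apply: cvgMl; apply: cvgD; first exact: F_cont.
by apply: cvgM; [exact: cvg_cst|exact: cvg_id].
Qed.

Let H_cont : continuous H.
Proof. by move=> x; apply: cvgB; [exact: cvg_id|exact: G_cont]. Qed.

HB.instance Definition _ := isCumulative.Build R _ R G G_nd
  (right_continuousW G_cont).
HB.instance Definition _ := isCumulative.Build R _ R H H_nd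
  (right_continuousW H_cont).

Let muG := lebesgue_stieltjes_measure G.
Let muH := lebesgue_stieltjes_measure H.

Let stieltjes_oc (f : cumulative R R) (a b : R) : a <= b ->
  lebesgue_stieltjes_measure f `]a, b]%classic = (f b - f a)%:E.
Proof.
move=> ab; rewrite /lebesgue_stieltjes_measure/= /measure_extension.
rewrite measurable_mu_extE/=; last exact: is_ocitv.
by rewrite wlength_itv_bnd.
Qed.

Let muGH A : measurable A -> leb A = (muG A + muH A)%E.
Proof.
move=> mA; rewrite -(measure_addE muG muH).
apply: (@lebesgue_measure_unique _ (measure_add muG muH)) => // X.
move=> /ocitvP[->|[x x12 ->]]; first by rewrite !measure0.
change (leb `]x.1, x.2] = measure_add muG muH `]x.1, x.2]).
have -> : measure_add muG muH `]x.1, x.2] =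
    ((G x.2 - G x.1)%:E + (H x.2 - H x.1)%:E)%E.
  rewrite measure_addE; congr (_ + _)%E; apply: stieltjes_oc; exact: ltW.
have -> : leb `]x.1, x.2] = (x.2 - x.1)%:E by apply: stieltjes_oc; exact: ltW.
by rewrite -EFinD /H/=; congr EFin; ring.
Qed.

Let muG_le A : measurable A -> (muG A <= leb A)%E.
Proof. by move=> mA; rewrite muGH// leeDl. Qed.

(** Rademacher's theorem in one dimension: Radon-Nikodym gives a density [h] of [G], so 2 c h - c is
    a density of [F], and Lebesgue differentiation identifies it with the derivative almost
    everywhere. *)
Lemma lipschitz_primitive (a b : R) : a < b ->
  exists g : R -> R, [/\ leb.-integrable `[a, b] (EFin \o g),
    (forall x y, a <= x -> x <= y -> y <= b ->
       F y - F x = \int[leb]_(t in `[x, y]) g t)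
  & exists N, [/\ measurable N, leb N = 0%E &
      forall x, a < x < b -> ~ N x -> derivable F x 1 /\ derive1 F x = g x]].
Proof.
move=> ab.
have mab : measurable (`[a, b]%classic : set (measurableTypeR R)) by exact: measurable_itv.
have fin : (muG `[a, b] < +oo)%E.
  by rewrite (le_lt_trans (muG_le mab))// lebesgue_measure_itv/= lte_fin ab ltey.
(* Restricting to [a, b] makes the measure finite, as Radon-Nikodym requires. *)
pose nu : {finite_measure set (measurableTypeR R) -> \bar R} := mfrestr mab fin.
have numu : nu `<< leb.
  apply/null_content_dominatesP => A mA A0.
  apply/eqP; rewrite -measure_le0 -A0 /nu/= /mfrestr /mrestr.
  apply: le_trans (muG_le _) _; first exact: measurableI.
  by apply: le_measure; rewrite ?inE//; exact: measurableI.
have [f [f0 ff fi fE]] := radon_nikodym_sigma_finite numu.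
pose h := fine \o f.
have hi : leb.-integrable setT (EFin \o h).
  by rewrite (_ : EFin \o h = f)//; apply/funext => x /=; rewrite fineK.
have hE x y : a <= x -> x <= y -> y <= b -> \int[leb]_(t in `[x, y]) h t = G y - G x.
  move=> ax xy yb.
  have <- : \int[leb]_(t in `]x, y]) h t = \int[leb]_(t in `[x, y]) h t.
    apply: Rintegral_itv_obnd_cbnd.
    by apply: integrableS hi.
  rewrite /Rintegral; under eq_integral do rewrite /h/= fineK//.
  rewrite -fE// /nu/= /mfrestr /mrestr setIidl ?stieltjes_oc//.
  by move=> t/=; rewrite !in_itv/=; lra.
pose g x := 2 * c * h x - c.
have ifin (A : set R) : measurable A -> A `<=` `[a, b] ->
    leb.-integrable A (EFin \o h) /\ leb.-integrable A (EFin \o cst c).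
  move=> mA Aab; split; first by apply: integrableS hi.
  apply: (integrableS mab mA Aab).
  apply: continuous_compact_integrable; first exact: segment_compact.
  by apply: continuous_subspaceT => ?; exact: cvg_cst.
have gint (A : set R) : measurable A -> A `<=` `[a, b] ->
    leb.-integrable A (EFin \o g).
  move=> mA Aab; have [i1 i2] := ifin _ mA Aab.
  rewrite (_ : EFin \o g = (fun x => (2 * c)%:E * (EFin \o h) x - (EFin \o cst c) x)%E)//.
  apply: integrableB => //; exact: integrableZl.
exists g; split; first exact: gint.
  move=> x y ax xy yb.
  have sub : `[x, y] `<=` `[a, b].
    by move=> t/=; rewrite !in_itv/=; lra.
  have [i1 i2] := ifin _ (measurable_itv _) sub.
  rewrite /g RintegralB//; last first.
    rewrite (_ : EFin \o _ = (fun x => (2 * c)%:E * (EFin \o h) x)%E)//.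
    exact: integrableZl.
  rewrite RintegralZl// hE//.
  have -> : \int[leb]_(x in `[x, y]) c = c * (y - x).
    transitivity (c * fine (leb `[x, y])); first exact: Rintegral_cst.
    rewrite lebesgue_measure_itv/= lte_fin.
    case: ltP => //= yx; have -> : x = y by lra.
    by rewrite subrr.
  by rewrite /G; field; exact: lt0r_neq0.
have lh : locally_integrable setT h by apply: open_integrable_locally => //; exact: openT.
have hi' y : leb.-integrable [set` Interval (BLeft a) (BRight y)] (EFin \o h).
  exact: integrableS hi.
have [N [mN N0 NP]] := FTC1 hi' lh.
exists N; split => // x /andP[ax xb] Nx.
have [dh dhE] : derivable (fun x => \int[leb]_(t in `[a, x]) h t) x 1 /\
    derive1 (fun x => \int[leb]_(t in `[a, x]) h t) x = h x.
  have := @subsetC _ _ _ NP x; rewrite setCK => /(_ Nx)/=.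
  by apply; rewrite lte_fin.
(* [P] agrees with [F] on ]a, b[, and its derivative at x is read off the integral. *)
pose P y := 2 * c * \int[leb]_(t in `[a, y]) h t + (F a + c * a) - c * y.
have dP : is_derive x 1 P (g x).
  have d1 : is_derive x 1 (fun x => \int[leb]_(t in `[a, x]) h t) (h x).
    by split; [exact: dh|rewrite -derive1E; exact: dhE].
  rewrite /P /g; apply: derB.
    rewrite -[2 * c * h x]addr0; apply: (derD (derZ (2 * c) d1)); exact: der_cst.
  by have := derZ c (der_id x); rewrite mulr1.
have nFP : {near x, F =1 P}.
  have xab : x \in `]a, b[ by rewrite in_itv/= ax xb.
  near=> y; have : y \in `]a, b[ by near: y; exact: near_in_itvoo.
  rewrite in_itv/= => /andP[ay yb]; rewrite /P hE ?lexx ?(ltW ay) ?(ltW yb)//.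
  by rewrite /G; field; exact: lt0r_neq0.
have dF : is_derive x 1 F (g x).
  apply: (@near_eq_is_derive _ _ _ P F x 1 (g x) _ dP).
  by apply: filterS nFP => z ->.
by split; [exact: ex_derive|exact: der_val].
Unshelve. all: by end_near.
Qed.
End LipschitzPrimitive.

Section Curve.
Variables (R : realType) (d : nat) (gamma : R -> 'rV[R]_d.+1).
Hypothesis gammaC : closed_lipschitz_curve gamma.
Local Notation leb := (@lebesgue_measure R).
Local Notation T := (2 * pi : R).

Definition clip (x : R) : R := Num.max 0 (Num.min x T).

(** The curve on the whole line, frozen outside [0, 2 pi] and with the closing value [gamma 0] at 2
    pi. It is globally Lipschitz, as [lipschitz_primitive] asks, and has the derivative of [gamma]
    inside ]0, 2 pi[. *)
Definition closed_up (x : R) : 'rV[R]_d.+1 :=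
  if clip x < T then gamma (clip x) else gamma 0.

Lemma twopi_gt0 : 0 < T.
Proof. by rewrite mulr_gt0// pi_gt0. Qed.

Lemma clipP x : [\/ x <= 0 /\ clip x = 0, 0 <= x <= T /\ clip x = x
  | T <= x /\ clip x = T].
Proof.
have T0 := twopi_gt0; rewrite /clip.
have [xT|Tx] := leP x T; last by apply: Or33; split; [exact: ltW|rewrite max_r// ltW].
have [x0|x0] := leP 0 x; first by apply: Or32; split; rewrite ?x0 ?xT.
by apply: Or31; split; first exact: ltW.
Qed.

Lemma clip_bounds x : 0 <= clip x <= T.
Proof. by have := twopi_gt0; case: (clipP x) => -[] ? -> ?; lra. Qed.

Lemma clip_lip x y : `|clip x - clip y| <= `|x - y|.
Proof.
wlog xy : x y / x <= y => [hw|].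
  by have [/hw//|/ltW/hw] := leP x y; rewrite distrC [leRHS]distrC.
rewrite distrC [leRHS]distrC [leRHS]ger0_norm ?subr_ge0// ger0_norm; have := twopi_gt0;
  by case: (clipP x) => -[] ? ->; case: (clipP y) => -[] ? -> ?; lra.
Qed.

Lemma clip_id x : 0 <= x <= T -> clip x = x.
Proof. by move=> h; have := twopi_gt0; case: (clipP x) => -[] ? -> ?; lra. Qed.

Lemma closed_upE x : 0 <= x < T -> closed_up x = gamma x.
Proof.
by move=> /andP[x0 xT]; rewrite /closed_up clip_id ?xT// x0 ltW.
Qed.

Lemma closed_up_sphere x : sphere R d (closed_up x).
Proof.
case: gammaC => gS _ _; have := clip_bounds x; have := twopi_gt0.
by rewrite /closed_up; case: (ltP (clip x)) => h h1 h2; apply: gS; lra.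
Qed.

Lemma closed_up_lip : exists2 K, 0 < K &
  forall i x y, `|closed_up x 0 i - closed_up y 0 i| <= K * `|x - y|.
Proof.
case: gammaC => gS [K0 lipK0] g2pi; have T0 := twopi_gt0.
pose K := `|K0| + 1; have K_gt0 : 0 < K by rewrite /K; have := normr_ge0 K0; lra.
have lip i s t : 0 <= s < T -> 0 <= t < T -> `|gamma s 0 i - gamma t 0 i| <= K * `|s - t|.
  move=> hs ht; have := lipK0 s t hs ht.
  have := coord_le_enorm (gamma s - gamma t) i; rewrite !mxE => h1 h2.
  rewrite (le_trans h1)// (le_trans h2)// ler_wpM2r//.
  by rewrite /K; have := ler_norm K0; lra.
(* The Lipschitz bound passes to the end point 2 pi by letting t tend to it from the left, where
   [gamma] tends to [gamma 0]. *)
have lipT i s : 0 <= s < T -> `|gamma s 0 i - gamma 0 0 i| <= K * (T - s).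
  move=> hs; apply/ler_addgt0Pl => e e0.
  have gi : gamma theta 0 i @[theta --> T^'-] --> gamma 0 0 i.
    exact: (continuous_cvg _ (@coord_continuous R 1 d.+1 0 i (gamma 0)) g2pi).
  near T^'- => t.
  have ts : s < t by near: t; apply: nbhs_left_gt; lra.
  have tT : t < T by near: t; exact: nbhs_left_lt.
  have h1 := lip i s t hs ltac:(lra).
  have h2 : `|gamma 0 0 i - gamma t 0 i| <= e.
    by near: t; move/cvgrPdist_le : gi; exact.
  rewrite distrC (ltr0_norm (x := s - t)) in h1; last lra.
  have := ler_distD (gamma t 0 i) (gamma s 0 i) (gamma 0 0 i).
  rewrite [X in _ <= X + _]distrC [X in _ <= _ + X]distrC => /le_trans; apply.
  rewrite addrC; apply: lerD => //; rewrite (le_trans h1)//.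
  by rewrite ler_pM2l//; lra.
exists K => // i x y.
apply: (@le_trans _ _ (K * `|clip x - clip y|)); last by rewrite ler_pM2l// clip_lip.
have bx := clip_bounds x; have bY := clip_bounds y.
rewrite /closed_up; case: (ltP (clip x)) => hx; case: (ltP (clip y)) => hy.
- by apply: lip; lra.
- have -> : clip y = T by lra.
  by rewrite (ltr0_norm (x := _ - T)) ?opprB; [apply: lipT; lra|lra].
- have -> : clip x = T by lra.
  by rewrite distrC (gtr0_norm (x := T - _)); [apply: lipT; lra|lra].
- by rewrite subrr normr0 mulr_ge0// ltW.
Unshelve. all: by end_near. Qed.

End Curve.

Section CurveSpeed.
Variables (R : realType) (d : nat) (gamma : R -> 'rV[R]_d.+1).
Hypothesis gammaC : closed_lipschitz_curve gamma.
Local Notation leb := (@lebesgue_measure R).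
Local Notation T := (2 * pi : R).
Local Notation cu := (closed_up gamma).

(** A measurable substitute [v] for the speed: the norm of the vector of densities of the
    coordinates. It differs from the speed only on a null set. *)
Lemma curve_speed_repr : exists v : R -> R, [/\ forall x, 0 <= v x,
  leb.-integrable `[0, T] (EFin \o v),
  forall x y, 0 <= x -> x <= y -> y <= T ->
    enorm (cu y - cu x) <= \int[leb]_(t in `[x, y]) v t
  & exists N, [/\ measurable N, leb N = 0%E &
      forall x, 0 < x < T -> ~ N x -> speed gamma x = v x]].
Proof.
have [K K_gt0 cuL] := closed_up_lip gammaC; have T0 := twopi_gt0 R.
have h i := lipschitz_primitive K_gt0 (cuL i) T0.
have [g /all_and3[gi gI]] := choice h.
move=> /choice[N] /all_and3[mN N0 Ng].
pose v x := enorm (\row_i g i x).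
have vE x : v x ^+ 2 = \sum_(i < d.+1) g i x ^+ 2.
  by rewrite sqr_enorm; apply: eq_bigr => i _; rewrite mxE.
have mg i : measurable_fun `[0, T] (g i).
  by have /integrableP[/measurable_EFinP] := gi i.
have mv : measurable_fun `[0, T] v.
  rewrite /v /enorm; apply: measurableT_comp; first exact: continuous_measurable_fun (@sqrt_continuous R).
  apply: measurable_sum => i.
  rewrite (_ : (fun x => _) = (fun x => g i x ^+ 2)); first exact: measurable_funX.
  by apply/funext => x; rewrite mxE.
have vi : leb.-integrable `[0, T] (EFin \o v).
  have gS : leb.-integrable `[0, T] (EFin \o (fun x => \sum_(i < d.+1) `|g i x|)).
    by apply: Rintegrable_sum => // i _; exact: integrable_norm.
  apply: (le_integrable _ _ _ gS) => //; first exact/measurable_EFinP.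
  move=> x _ /=; rewrite lee_fin ger0_norm ?enorm_ge0//.
  rewrite [leRHS]ger0_norm ?sumr_ge0//.
  rewrite (le_trans (enorm_le_sum _))//.
  by apply: ler_sum => i _; rewrite mxE.
exists v; split => //.
- by move=> x; exact: enorm_ge0.
- move=> x y x0 xy yT; set u := cu y - cu x.
  have sub : `[x, y] `<=` `[0, T] by move=> t/=; rewrite !in_itv/=; lra.
  have gxy i : leb.-integrable `[x, y] (EFin \o g i) by exact: integrableS (gi i).
  have vxy : leb.-integrable `[x, y] (EFin \o v) by exact: integrableS vi.
  have [->|u0] := eqVneq (enorm u) 0.
    by apply: Rintegral_ge0 => t _; exact: enorm_ge0.
  have up : 0 < enorm u by rewrite lt_neqAle eq_sym u0 enorm_ge0.
  (* Pairing the chord [u] with the densities gives its squared norm, and Cauchy-Schwarz bounds the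
     integrand by [enorm u * v t]. *)
  rewrite -(ler_pM2l up) -expr2 sqr_enorm -RintegralZl//.
  have -> : \sum_(i < d.+1) u 0 i ^+ 2 =
      \int[leb]_(t in `[x, y]) (\sum_(i < d.+1) u 0 i * g i t).
    rewrite Rintegral_sum//; last first.
      by move=> i _; exact: RintegrableZ.
    apply: eq_bigr => i _; rewrite RintegralZl// -gI// expr2.
    by congr (_ * _); rewrite /u !mxE.
  apply: le_Rintegral => //.
  - apply: Rintegrable_sum => // i _; exact: RintegrableZ.
  - exact: RintegrableZ.
  move=> t _; apply: le_trans (dot_le_enorm _ _).
  by apply: ler_sum => i _; rewrite mxE.
(* A single null set containing the exceptional sets of all coordinates. *)
have [M [mM M0 NM]] : exists M, [/\ measurable M, leb M = 0%E &
    forall i x, i \in enum 'I_d.+1 -> N i x -> M x].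
  elim: (enum 'I_d.+1) => [|i s [M [mM M0 NM]]]; first by exists set0; split.
  exists (N i `|` M); split; first exact: measurableU.
    apply/eqP; rewrite -measure_le0.
    by rewrite (le_trans (measureU2 _ (mN i) mM))// [X in (X + _)%E]N0 [X in (_ + X)%E]M0 adde0.
  move=> j x; rewrite inE => /predU1P[->|js]; first by left.
  by move=> /(NM _ _ js); right.
exists M; split => //.
move=> x /andP[x0 xT] Nx.
have nx : {near x, closed_up gamma =1 gamma}.
  have x0T : x \in `]0, T[ by rewrite in_itv/= x0 xT.
  near=> y; have : y \in `]0, T[ by near: y; exact: near_in_itvoo.
  rewrite in_itv/= => /andP[y0 yT]; apply: closed_upE; lra.
have dcu i : derivable (fun y => closed_up gamma y 0 i) x 1 /\
    derive1 (fun y => closed_up gamma y 0 i) x = g i x.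
  by apply: (Ng i); [rewrite x0 xT|move=> Nix; apply: Nx; apply: (NM i) => //; rewrite mem_enum].
have dmx : derivable (closed_up gamma) x 1.
  by apply/derivable_mxP => i j; rewrite ord1; exact: (dcu j).1.
rewrite /speed /v; congr enorm.
rewrite derive1E -(near_eq_derive _ nx) derive_mx//.
by apply/rowP => i; rewrite !mxE -derive1E (dcu i).2.
Unshelve. all: by end_near.
Qed.
End CurveSpeed.

Section Chasles.
Variable R : realType.
Local Notation leb := (@lebesgue_measure R).

Lemma Rintegral_itv_split (f : R -> R) (x y z : R) : x <= y -> y <= z ->
  leb.-integrable `[x, z] (EFin \o f) ->
  \int[leb]_(t in `[x, z]) f t =
  \int[leb]_(t in `[x, y]) f t + \int[leb]_(t in `[y, z]) f t.
Proof.
move=> xy yz fi; apply/eqP; rewrite addrC -subr_eq; apply/eqP.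
rewrite Rintegral_itvB ?bnd_simp//.
apply: Rintegral_itv_obnd_cbnd; apply: integrableS fi => //.
by move=> t /=; rewrite !in_itv/=; lra.
Qed.

Lemma Rintegral_itv_sum (f : R -> R) (th : nat -> R) (N : nat) :
  (forall i, (i < N)%N -> th i <= th i.+1) ->
  leb.-integrable `[th 0, th N] (EFin \o f) ->
  \int[leb]_(t in `[th 0, th N]) f t =
  \sum_(i < N) \int[leb]_(t in `[th i, th i.+1]) f t.
Proof.
elim: N => [_ _|N IH mth fi]; first by rewrite big_ord0 set_itv1 Rintegral_set1.
have m0 n : (n <= N)%N -> th 0 <= th n.
  elim: n => // n IHn nN; rewrite (le_trans (IHn (ltnW nN)))// mth//.
  exact: leqW.
rewrite big_ord_recr/= -IH; last 2 first.
- by move=> i iN; apply: mth; exact: leqW.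
- apply: integrableS fi => //; move=> t /=; rewrite !in_itv/=.
  by have := mth N (ltnSn N); lra.
by apply: Rintegral_itv_split; [exact: m0|exact: mth|].
Qed.
End Chasles.

(** * Arclength, and functions that are Lipschitz with respect to it *)

Section Arclength.
Variables (R : realType) (T : R) (v : R -> R).
Local Notation leb := (@lebesgue_measure R).
Hypothesis T_gt0 : 0 < T.
Hypothesis v_ge0 : forall x, 0 <= v x.
Hypothesis vi : leb.-integrable `[0, T] (EFin \o v).

Definition arclen (x : R) : R := \int[leb]_(t in `[0, x]) v t.
Local Notation s := arclen.
Local Notation L := (arclen T).

Let vsub x y : 0 <= x -> y <= T -> leb.-integrable `[x, y] (EFin \o v).
Proof.
by move=> x0 yT; apply: integrableS vi => // t/=; rewrite !in_itv/=; lra.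
Qed.

Lemma arclenB x y : 0 <= x -> x <= y -> y <= T ->
  \int[leb]_(t in `[x, y]) v t = s y - s x.
Proof.
move=> x0 xy yT; rewrite /s (@Rintegral_itv_split _ v 0 x y)//; last exact: vsub.
by rewrite addrC addKr.
Qed.

Lemma arclen_nd x y : 0 <= x -> x <= y -> y <= T -> s x <= s y.
Proof.
by move=> x0 xy yT; rewrite -subr_ge0 -arclenB//; exact: Rintegral_ge0.
Qed.

Lemma arclen0 : s 0 = 0.
Proof. by rewrite /s set_itv1 Rintegral_set1. Qed.

Lemma arclen_continuous : {within `[0, T], continuous s}.
Proof. exact: (parameterized_integral_continuous (ltW T_gt0) vi). Qed.

Hypothesis L_gt0 : 0 < L.

(** The intermediate value theorem yields a parameter for each multiple of L / N. As [arclen] may be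
    constant on intervals, the points are chosen rather than read off an inverse. *)
Lemma arclen_subdivision (N : nat) : (0 < N)%N -> exists th : nat -> R,
  [/\ th 0 = 0, th N = T, forall i, (i <= N)%N -> 0 <= th i <= T,
      forall i, (i < N)%N -> th i <= th i.+1
    & forall i, (i <= N)%N -> s (th i) = i%:R * (L / N%:R)].
Proof.
move=> N0; have N0' : N%:R != 0 :> R by rewrite pnatr_eq0 -lt0n.
have h i : exists t, (i <= N)%N -> [/\ 0 <= t <= T, s t = i%:R * (L / N%:R),
    i = 0%N -> t = 0 & i = N -> t = T].
  have [iN|] := leqP i N; last by exists 0.
  have [->|i0] := eqVneq i 0%N.
    by exists 0 => _; rewrite lexx ltW// arclen0 mul0r; split=> // E; rewrite -E in N0.
  have [->|iN'] := eqVneq i N.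
    exists T => _; rewrite lexx ltW//; split=> //; first by field.
    by move=> E; rewrite E in N0.
  have := @segment_continuous_le_surjective R 0 T s (ltW T_gt0) _ arclen_continuous.
  rewrite arclen0 => /(_ (ltW L_gt0) (i%:R * (L / N%:R))).
  case=> [|t]; rewrite /= in_itv/=.
    apply/andP; split; first by apply: mulr_ge0 => //; apply: divr_ge0 => //; exact: ltW.
    by rewrite mulrCA ger_pMr// ler_pdivrMr ?ltr0n// mul1r ler_nat.
  by move=> ht st; exists t => _; split => // E; rewrite E eqxx in i0 iN'.
have [th hth] := choice h; exists th; split.
- by have [] := hth 0%N (leq0n _); auto.
- by have [] := hth N (leqnn _); auto.
- by move=> i iN; have [] := hth i iN.
(* The points are chosen independently, but a decrease would contradict the increasing values i L /
   N of [arclen]. *)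
- move=> i iN; have [bi si _ _] := hth i (ltnW iN); have [bj sj _ _] := hth i.+1 iN.
  rewrite leNgt; apply/negP => hlt.
  have := arclen_nd (x := th i.+1) (y := th i) _ (ltW hlt) _.
  rewrite si sj -natr1 mulrDl mul1r gerDl.
  have : 0 < L / N%:R by rewrite divr_gt0// ltr0n.
  by move=> + h2; have := h2 ltac:(lra) ltac:(lra); lra.
- by move=> i iN; have [] := hth i iN.
Qed.

(** The Lipschitz condition in the arclength variable, stated in the original parameter. *)
Definition arclip (C : R) (Phi : R -> R) := forall x y, 0 <= x -> x <= y -> y <= T ->
  `|Phi y - Phi x| <= C * (s y - s x).

Lemma arclip_continuous C Phi : arclip C Phi -> {within `[0, T], continuous Phi}.
Proof.
move=> h; have sc := arclen_continuous.
have C0 : 0 <= C.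
  have := h 0 T (lexx _) (ltW T_gt0) (lexx _); rewrite arclen0 subr0.
  by move=> /(le_trans (normr_ge0 _)); rewrite pmulr_lge0.
apply/subspace_continuousP => x xT; apply/cvgrPdist_le => e e0.
have : \forall y \near within `[0, T] (nbhs x), `|s x - s y| <= e / (C + 1).
  move/subspace_continuousP : sc => /(_ x xT)/cvgrPdist_le; apply.
  by apply: divr_gt0 => //; lra.
rewrite !near_withinE => H; apply: filterS H => y hy yT; have := hy yT.
rewrite ler_pdivlMr; last lra.
move=> h2; have : `|Phi x - Phi y| <= C * `|s x - s y|.
  move: xT yT; rewrite /= !in_itv/= => xT yT.
  have [xy|/ltW yx] := leP x y.
    rewrite distrC [X in C * X]distrC [X in C * X]ger0_norm ?subr_ge0.
      by apply: h; lra.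
    by apply: arclen_nd; lra.
  rewrite [X in C * X]ger0_norm ?subr_ge0; first by apply: h; lra.
  by apply: arclen_nd; lra.
by have := normr_ge0 (s x - s y); nra.
Qed.

Lemma arclip_bounded C Phi : arclip C Phi ->
  forall x, 0 <= x <= T -> `|Phi x| <= `|Phi 0| + C * L.
Proof.
move=> h x xT; have C0 : 0 <= C.
  have := h 0 T (lexx _) (ltW T_gt0) (lexx _); rewrite arclen0 subr0.
  by move=> /(le_trans (normr_ge0 _)); rewrite pmulr_lge0.
have h1 : `|Phi x - Phi 0| <= C * (s x - s 0) by apply: h; lra.
have h2 : s x <= L by apply: arclen_nd; lra.
have : Phi x = Phi 0 + (Phi x - Phi 0) by ring.
move=> {1}->; rewrite (le_trans (ler_normD _ _))// lerD2l (le_trans h1)//.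
by rewrite arclen0 subr0 ler_wpM2l.
Qed.

Lemma arclip_integrable C Phi : arclip C Phi ->
  leb.-integrable `[0, T] (EFin \o (fun x => Phi x * v x)).
Proof.
move=> h; have cPhi := arclip_continuous h.
have mPhi : measurable_fun `[0, T] Phi.
  by apply: subspace_continuous_measurable_fun.
have vb : leb.-integrable `[0, T] (EFin \o (fun x => (`|Phi 0| + C * L) * v x)).
  exact: RintegrableZ.
apply: (le_integrable _ _ _ vb) => //.
  apply/measurable_EFinP; apply: measurable_funM => //.
  by have /integrableP[/measurable_EFinP] := vi.
move=> x; rewrite /= in_itv/= => xT; rewrite lee_fin !normrM ler_wpM2r//.
by rewrite (le_trans (arclip_bounded h xT))// ler_norm.
Qed.

Lemma arclip_comp C K Phi (f : R -> R) : 0 <= K -> (forall x y, `|f x - f y| <= K * `|x - y|) ->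
  arclip C Phi -> arclip (K * C) (f \o Phi).
Proof.
move=> K0 fK h x y x0 xy yT; rewrite (le_trans (fK _ _))// -mulrA ler_wpM2l//.
exact: h.
Qed.

Lemma arclipM C D Phi Psi : (forall x, 0 <= x <= T -> `|Phi x| <= 1) ->
  (forall x, 0 <= x <= T -> `|Psi x| <= 1) ->
  arclip C Phi -> arclip D Psi -> arclip (C + D) (fun x => Phi x * Psi x).
Proof.
move=> b1 b2 h1 h2 x y x0 xy yT.
have -> : Phi y * Psi y - Phi x * Psi x =
  (Phi y - Phi x) * Psi y + Phi x * (Psi y - Psi x) by ring.
rewrite (le_trans (ler_normD _ _))// !normrM mulrDl; apply: lerD.
  by rewrite -[leRHS]mulr1 ler_pM//; [exact: h1|apply: b2; lra].
by rewrite -[leRHS]mul1r ler_pM//; [apply: b1; lra|exact: h2].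
Qed.

(** Each subarc has length L / N and [Phi] varies by at most C L / N on it; the N errors C (L / N) ^
    2 add up to the bound. *)
Lemma arclip_riemann (N : nat) (th : nat -> R) C Phi : (0 < N)%N ->
  th 0 = 0 -> th N = T -> (forall i, (i <= N)%N -> 0 <= th i <= T) ->
  (forall i, (i < N)%N -> th i <= th i.+1) ->
  (forall i, (i <= N)%N -> s (th i) = i%:R * (L / N%:R)) ->
  arclip C Phi ->
  `|\int[leb]_(t in `[0, T]) (Phi t * v t) - L / N%:R * \sum_(i < N) Phi (th i)|
    <= C * L ^+ 2 / N%:R.
Proof.
move=> N0 th0 thN bth mth sth h; have N0' : N%:R != 0 :> R by rewrite pnatr_eq0 -lt0n.
have Phi_i := arclip_integrable h.
rewrite -{1}th0 -{1}thN (Rintegral_itv_sum mth); last by rewrite th0 thN.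
rewrite mulr_sumr -sumrB (le_trans (ler_norm_sum _ _ _))//.
have -> : C * L ^+ 2 / N%:R = \sum_(i < N) C * (L / N%:R) ^+ 2.
  by rewrite sumr_const card_ord -mulr_natl; field.
apply: ler_sum => i _.
have bi := bth i (ltnW (ltn_ord i)); have bi1 := bth i.+1 (ltn_ord i).
have mi := mth i (ltn_ord i).
have ds : s (th i.+1) - s (th i) = L / N%:R.
  by rewrite !sth//; [rewrite -natr1; ring|exact: ltnW].
have vI := vsub (x := th i) (y := th i.+1) ltac:(lra) ltac:(lra).
have PvI : leb.-integrable `[th i, th i.+1] (EFin \o (fun t => Phi t * v t)).
  by apply: integrableS Phi_i => // t/=; rewrite !in_itv/=; lra.
have -> : L / N%:R * Phi (th i) = \int[leb]_(t in `[th i, th i.+1]) (Phi (th i) * v t).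
  by rewrite RintegralZl// arclenB ?ds; [rewrite mulrC|lra|lra|lra].
rewrite -RintegralB//; last exact: RintegrableZ.
have dI : leb.-integrable `[th i, th i.+1] (EFin \o (fun t => Phi t * v t - Phi (th i) * v t)).
  by apply: RintegrableB => //; exact: RintegrableZ.
rewrite (le_trans (le_normr_Rintegral _ dI))//.
have -> : C * (L / N%:R) ^+ 2 = \int[leb]_(t in `[th i, th i.+1]) (C * (L / N%:R) * v t).
  rewrite RintegralZl// arclenB ?ds; [ring|lra|lra|lra].
have C0 : 0 <= C.
  have := h 0 T (lexx _) (ltW T_gt0) (lexx _); rewrite arclen0 subr0.
  by move=> /(le_trans (normr_ge0 _)); rewrite pmulr_lge0.
apply: le_Rintegral => //; first exact: integrable_norm.
  exact: RintegrableZ.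
move=> t; rewrite /= in_itv/= => ht.
rewrite -mulrBl normrM (ger0_norm (v_ge0 t)) ler_wpM2r//.
rewrite (le_trans (h (th i) t _ _ _))//; try lra.
rewrite ler_wpM2l// -ds lerD2r; apply: arclen_nd; lra.
Qed.

End Arclength.

(** * The lower bound *)

(** Meant for a function of the frequency that can be negative only for m <= k and the mirror images
    N - m. Dropping the middle terms leaves every low frequency twice, except 0. *)
Lemma sum_mirror_ge (R : realType) (G : nat -> R) (k N : nat) : (k.*2 < N)%N ->
  (forall m, (k < m < N - k)%N -> 0 <= G m) ->
  (forall m, (0 < m <= k)%N -> G (N - m)%N = G m) ->
  \sum_(m < k.+1) G m + \sum_(m < k) G m.+1 <= \sum_(m < N) G m.
Proof.
move=> kN G0 GN; rewrite -!(big_mkord predT G) -(big_mkord predT (fun m => G m.+1)).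
rewrite (@big_cat_nat _ _ _ k.+1 0 N)//=; last lia.
rewrite (@big_cat_nat _ _ _ (N - k) k.+1 N)//=; [|lia|lia].
rewrite lerD2l.
have -> : \sum_(0 <= m < k) G m.+1 = \sum_(N - k <= m < N) G m.
  rewrite -{1}[(N - k)%N]add0n big_addn.
  have -> : (N - (N - k) = k)%N by lia.
  rewrite [RHS]big_nat_rev/= !big_nat; apply: eq_bigr => m /andP[_ mk].
  have -> : (0 + k - m.+1 + (N - k) = N - m.+1)%N by lia.
  by rewrite GN//; lia.
rewrite lerDr big_nat; apply: sumr_ge0 => m /andP[h1 h2]; apply: G0; lia.
Qed.

(** * Spectral bound for the length of a closed curve with prescribed moments *)

Section SpectralBound.
Variables (R : realType) (T : R) (v : R -> R) (n : nat) (c : 'I_n -> R -> R).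
Local Notation leb := (@lebesgue_measure R).
Hypothesis T_gt0 : 0 < T.
Hypothesis v_ge0 : forall x, 0 <= v x.
Hypothesis vi : leb.-integrable `[0, T] (EFin \o v).
Local Notation s := (arclen v).
Local Notation L := (arclen v T).
Hypothesis L_gt0 : 0 < L.
Hypothesis n_gt0 : (0 < n)%N.
Hypothesis c_lip : forall x y, 0 <= x -> x <= y -> y <= T ->
  \sum_a (c a y - c a x) ^+ 2 <= (s y - s x) ^+ 2.
Hypothesis c_unit : forall x, 0 <= x <= T -> \sum_a c a x ^+ 2 = 1.
Hypothesis c_closed : forall a, c a T = c a 0.
Hypothesis c_mean : forall a, \int[leb]_(t in `[0, T]) (c a t * v t) = 0.
Hypothesis c_cov : forall a b, \int[leb]_(t in `[0, T]) (c a t * c b t * v t) =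
  (a == b)%:R * (L / n%:R).

Let c_le1 a x : 0 <= x <= T -> `|c a x| <= 1.
Proof.
move=> xT; rewrite -(@ler_pXn2r _ 2)// ?nnegrE// expr1n real_normK ?num_real//.
by rewrite -(c_unit xT) (bigD1 a)//= lerDl sumr_ge0// => b _; exact: sqr_ge0.
Qed.

Let c_arclip a : arclip T v 1 (c a).
Proof.
move=> x y x0 xy yT; rewrite mul1r.
have sxy : 0 <= s y - s x by rewrite subr_ge0; exact: (arclen_nd v_ge0 vi).
rewrite -(@ler_pXn2r _ 2)// ?nnegrE// real_normK ?num_real//.
apply: le_trans (c_lip x0 xy yT).
by rewrite (bigD1 a)//= lerDl sumr_ge0// => b _; exact: sqr_ge0.
Qed.

Let ph m x := m%:R * (2 * pi / L) * s x.

Let lip_of_der (f f' : R -> R) : (forall x : R, is_derive x 1 f (f' x)) ->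
  (forall x, `|f' x| <= 1) -> forall x y, `|f x - f y| <= 1 * `|x - y|.
Proof.
move=> df f1 x y; wlog xy : x y / y <= x => [hw|].
  by have [/hw//|/ltW/hw] := leP y x; rewrite distrC [X in _ * X]distrC.
have cf : {within `[y, x], continuous f}.
  by apply: derivable_within_continuous => z _; case: (df z).
have [z _ ->] := MVT_segment xy (fun z _ => df z) cf.
by rewrite normrM ler_wpM2r.
Qed.

Let ph_arclip m : arclip T v (m%:R * (2 * pi / L)) (ph m).
Proof.
have K0 : 0 <= m%:R * (2 * pi / L).
  by rewrite mulr_ge0// divr_ge0 ?mulr_ge0 ?pi_ge0// ltW.
move=> x y x0 xy yT; rewrite /ph -mulrBr normrM (ger0_norm K0) ger0_norm//.
by rewrite subr_ge0; exact: (arclen_nd v_ge0 vi).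
Qed.

Let cosp_arclip m : arclip T v (1 * (m%:R * (2 * pi / L))) (cos \o ph m).
Proof.
apply: arclip_comp => //; apply: (lip_of_der (@is_derive_cos R)) => x.
by rewrite normrN ler_norml sin_geN1 sin_le1.
Qed.

Let sinp_arclip m : arclip T v (1 * (m%:R * (2 * pi / L))) (sin \o ph m).
Proof.
apply: arclip_comp => //; apply: (lip_of_der (@is_derive_sin R)) => x.
by rewrite ler_norml cos_geN1 cos_le1.
Qed.

Let Cc m a := \int[leb]_(t in `[0, T]) (c a t * cos (ph m t) * v t).
Let Cs m a := \int[leb]_(t in `[0, T]) (c a t * sin (ph m t) * v t).
Let q m := \sum_a (Cc m a ^+ 2 + Cs m a ^+ 2).

Let ccos_arclip m a : arclip T v (1 + 1 * (m%:R * (2 * pi / L)))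
  (fun x => c a x * cos (ph m x)).
Proof.
apply: (arclipM _ _ (c_arclip a) (cosp_arclip m)); first exact: c_le1.
by move=> x _; rewrite ler_norml /= cos_geN1 cos_le1.
Qed.

Let csin_arclip m a : arclip T v (1 + 1 * (m%:R * (2 * pi / L)))
  (fun x => c a x * sin (ph m x)).
Proof.
apply: (arclipM _ _ (c_arclip a) (sinp_arclip m)); first exact: c_le1.
by move=> x _; rewrite ler_norml /= sin_geN1 sin_le1.
Qed.

Let cc_arclip a b : arclip T v (1 + 1) (fun x => c a x * c b x).
Proof. by apply: (arclipM _ _ (c_arclip a) (c_arclip b)); exact: c_le1. Qed.

(* Cauchy-Schwarz against the unit test function f, in the form
   0 <= int (t <w, c> - f)^2 with w the vector of coefficients of f. *)
Let bessel (f : R -> R) K : arclip T v K f -> (forall x, `|f x| <= 1) ->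
  \sum_a (\int[leb]_(t in `[0, T]) (c a t * f t * v t)) ^+ 2
   <= L / n%:R * \int[leb]_(t in `[0, T]) (f t * f t * v t).
Proof.
move=> fl f1; pose w a := \int[leb]_(t in `[0, T]) (c a t * f t * v t).
pose D := \sum_a w a ^+ 2; rewrite -[leLHS]/D.
have icf a : leb.-integrable `[0, T] (EFin \o (fun t => c a t * f t * v t)).
  have := (arclipM (@c_le1 a) (fun x _ => f1 x) (c_arclip a) fl).
  exact: (arclip_integrable T_gt0 v_ge0 vi L_gt0).
have icc a b : leb.-integrable `[0, T] (EFin \o (fun t => c a t * c b t * v t)).
  exact: (arclip_integrable T_gt0 v_ge0 vi L_gt0 (cc_arclip a b)).
have iff : leb.-integrable `[0, T] (EFin \o (fun t => f t * f t * v t)).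
  by apply: (arclip_integrable T_gt0 v_ge0 vi L_gt0 (arclipM (fun x _ => f1 x) (fun x _ => f1 x) fl fl)).
set F := \int[leb]_(t in _) _.
(* [t0] inverts the covariance [L / n] of the coordinates, so that the [t0 * w a] are the
   coefficients of the orthogonal projection of [f] on their span. *)
pose t0 := n%:R / L.
have n0 : (0 : R) < n%:R by rewrite ltr0n.
have t0_gt0 : 0 < t0 by rewrite divr_gt0.
have : 0 <= \int[leb]_(t in `[0, T]) ((t0 * (\sum_a w a * c a t) - f t) ^+ 2 * v t).
  by apply: Rintegral_ge0 => t _; rewrite mulr_ge0// sqr_ge0.
have -> : \int[leb]_(t in `[0, T]) ((t0 * (\sum_a w a * c a t) - f t) ^+ 2 * v t) =
  \int[leb]_(t in `[0, T]) (t0 ^+ 2 * (\sum_a \sum_b w a * w b * (c a t * c b t * v t))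
    - 2 * t0 * (\sum_a w a * (c a t * f t * v t)) + f t * f t * v t).
  apply: eq_Rintegral => t _.
  have -> : \sum_a \sum_b w a * w b * (c a t * c b t * v t) =
     (\sum_a w a * c a t) * (\sum_a w a * c a t) * v t.
    rewrite big_distrlr/= mulr_suml; apply: eq_bigr => a _.
    by rewrite mulr_suml; apply: eq_bigr => b _; ring.
  have -> : \sum_a w a * (c a t * f t * v t) = (\sum_a w a * c a t) * f t * v t.
    by rewrite !mulr_suml; apply: eq_bigr => a _; ring.
  ring.
have i1 : leb.-integrable `[0, T]
    (EFin \o (fun t => \sum_a \sum_b w a * w b * (c a t * c b t * v t))).
  apply: Rintegrable_sum => // a _; apply: Rintegrable_sum => // b _.
  exact: RintegrableZ.
have i2 : leb.-integrable `[0, T] (EFin \o (fun t => \sum_a w a * (c a t * f t * v t))).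
  by apply: Rintegrable_sum => // a _; exact: RintegrableZ.
rewrite RintegralD//; last first.
  by apply: RintegrableB => //; exact: RintegrableZ.
rewrite RintegralB//; [|exact: RintegrableZ|exact: RintegrableZ].
rewrite !RintegralZl// !Rintegral_sum//; last 2 first.
- by move=> a _; exact: RintegrableZ.
- by move=> a _; apply: Rintegrable_sum => // b _; exact: RintegrableZ.
have -> : \sum_a \int[leb]_(x in `[0, T]) (\sum_b w a * w b * (c a x * c b x * v x)) =
    D * (L / n%:R).
  rewrite /D mulr_suml; apply: eq_bigr => a _.
  rewrite Rintegral_sum//; last by move=> b _; exact: RintegrableZ.
  rewrite (bigD1 a)//= big1 ?addr0; last first.
    move=> b ba; rewrite RintegralZl// c_cov eq_sym (negbTE ba) mul0r mulr0//.
  by rewrite RintegralZl// c_cov eqxx mul1r; ring.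
have -> : \sum_a \int[leb]_(x in `[0, T]) (w a * (c a x * f x * v x)) = D.
  by apply: eq_bigr => a _; rewrite RintegralZl// -/(w a) expr2.
rewrite -/F.
have -> : t0 ^+ 2 * (D * (L / n%:R)) - 2 * t0 * D + F = F - t0 * D.
  by rewrite /t0; field; rewrite !lt0r_neq0.
rewrite subr_ge0 => h.
have -> : D = L / n%:R * (t0 * D) by rewrite /t0; field; rewrite !lt0r_neq0.
by rewrite ler_pM2l// divr_gt0.
Qed.

(** Since cos ^ 2 + sin ^ 2 = 1, the two Bessel bounds add up to L / n times the length. *)
Let q_le m : q m <= L ^+ 2 / n%:R.
Proof.
rewrite /q big_split/=.
have c1 x : `|(cos \o ph m) x| <= 1 by rewrite ler_norml /= cos_geN1 cos_le1.
have s1 x : `|(sin \o ph m) x| <= 1 by rewrite ler_norml /= sin_geN1 sin_le1.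
apply: (le_trans (lerD (bessel (cosp_arclip m) c1) (bessel (sinp_arclip m) s1))).
rewrite -mulrDr -RintegralD//; last 2 first.
- by apply: (arclip_integrable T_gt0 v_ge0 vi L_gt0 (arclipM (fun x _ => c1 x) (fun x _ => c1 x) (cosp_arclip m) (cosp_arclip m))).
- by apply: (arclip_integrable T_gt0 v_ge0 vi L_gt0 (arclipM (fun x _ => s1 x) (fun x _ => s1 x) (sinp_arclip m) (sinp_arclip m))).
have -> : \int[leb]_(x in `[0, T])
   ((cos \o ph m) x * (cos \o ph m) x * v x + (sin \o ph m) x * (sin \o ph m) x * v x) = L.
  apply: eq_Rintegral => t _ /=; rewrite -mulrDl -!expr2 cos2Dsin2 mul1r//.
by rewrite le_eqVlt; apply/orP; left; apply/eqP; field; rewrite pnatr_eq0 -lt0n.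
Qed.

Let q0 : q 0 = 0.
Proof.
rewrite /q big1// => a _.
have -> : Cc 0 a = 0.
  rewrite -[RHS](c_mean a); apply: eq_Rintegral => t _.
  by rewrite /ph !mul0r cos0 mulr1.
have -> : Cs 0 a = 0.
  transitivity (\int[leb]_(t in `[0, T]) (0 : R)); last by rewrite Rintegral_cst// mul0r.
  by apply: eq_Rintegral => t _; rewrite /ph !mul0r sin0 mulr0 mul0r.
by rewrite expr0n addr0.
Qed.

Let n0R : (0 : R) < n%:R. Proof. by rewrite ltr0n. Qed.

Definition subdivision (N : nat) (th : nat -> R) :=
  [/\ th 0%N = 0, th N = T, forall i, (i <= N)%N -> 0 <= th i <= T,
      forall i, (i < N)%N -> th i <= th i.+1
    & forall i, (i <= N)%N -> s (th i) = i%:R * (L / N%:R)].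

Let P N th m := \sum_a dpow N (fun i => c a (th i)) m.

(** By [arclip_riemann], L / N times a discrete coefficient is within C L ^ 2 / N of the
    corresponding integral. Squaring keeps a relative error of order 1 / N, with a constant that
    depends on m but not on N. *)
Let P_le m : exists2 K, 0 <= K & forall N th, (0 < N)%N -> subdivision N th ->
  P N th m <= N%:R ^+ 2 * (q m / L ^+ 2 + K / N%:R).
Proof.
pose C := 1 + 1 * (m%:R * (2 * pi / L)).
have C0 : 0 <= C by rewrite addr_ge0// mul1r mulr_ge0// divr_ge0 ?mulr_ge0 ?pi_ge0// ltW.
have CL0 : 0 <= C * L by rewrite mulr_ge0// ltW.
exists (n%:R * (2 * (C * L * (2 + C * L)))).
  by rewrite mulr_ge0// mulr_ge0// mulr_ge0//; lra.
move=> N th N0 [th0 thN bth mth sth].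
have N0R : (0 : R) < N%:R by rewrite ltr0n.
have N1R : (1 : R) <= N%:R by rewrite ler1n.
(* With x = X / N, y = Y / L and e = C L / N, the bounds |y| <= 1, |y - x| <= e and e <= C L give x
   ^ 2 <= y ^ 2 + e (2 + C L). *)
have key (X Y : R) : Y ^+ 2 <= L ^+ 2 -> `|Y - L / N%:R * X| <= C * L ^+ 2 / N%:R ->
    X ^+ 2 <= N%:R ^+ 2 * (Y ^+ 2 / L ^+ 2 + C * L * (2 + C * L) / N%:R).
  move=> Y1 h; pose x := X / N%:R; pose y := Y / L; pose e := C * L / N%:R.
  have e0 : 0 <= e by rewrite divr_ge0// ltW.
  have eC : e <= C * L by rewrite ler_pdivrMr// ler_peMr.
  have y1 : y ^+ 2 <= 1 by rewrite expr_div_n ler_pdivrMr ?exprn_gt0// mul1r.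
  have yx : `|y - x| <= e.
    have -> : y - x = (Y - L / N%:R * X) / L by rewrite /x /y; field; rewrite !lt0r_neq0.
    rewrite normrM normfV (gtr0_norm L_gt0) ler_pdivrMr// (le_trans h)//.
    by rewrite /e le_eqVlt; apply/orP; left; apply/eqP; field; rewrite !lt0r_neq0.
  have -> : X = N%:R * x by rewrite /x; field; rewrite !lt0r_neq0.
  rewrite exprMn ler_pM2l ?exprn_gt0// -expr_div_n -/y.
  have -> : C * L * (2 + C * L) / N%:R = e * (2 + C * L) by rewrite /e; field; rewrite !lt0r_neq0.
  move: yx; rewrite ler_norml => /andP[h1 h2].
  have y1' : -1 <= y <= 1 by nra.
  nra.
rewrite /P.
have -> : N%:R ^+ 2 * (q m / L ^+ 2 + n%:R * (2 * (C * L * (2 + C * L))) / N%:R) =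
  \sum_(a < n) (N%:R ^+ 2 * (Cc m a ^+ 2 / L ^+ 2 + C * L * (2 + C * L) / N%:R) +
            N%:R ^+ 2 * (Cs m a ^+ 2 / L ^+ 2 + C * L * (2 + C * L) / N%:R)).
  under eq_bigr do rewrite -mulrDr addrACA -mulrDl.
  rewrite -mulr_sumr big_split/= -mulr_suml -/(q m) sumr_const card_ord -mulr_natl.
  by congr (_ * (_ + _)); field; rewrite lt0r_neq0.
have L2 : L ^+ 2 / n%:R <= L ^+ 2.
  by rewrite ler_pdivrMr// ler_peMr ?sqr_ge0// ler1n.
have qL a : Cc m a ^+ 2 + Cs m a ^+ 2 <= L ^+ 2.
  apply: le_trans (le_trans (q_le m) L2).
  rewrite /q (bigD1 a)//= lerDl sumr_ge0// => b _.
  by rewrite addr_ge0// sqr_ge0.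
have phE i : (i <= N)%N -> ph m (th i) = (m * i)%:R * (2 * pi / N%:R).
  by move=> iN; rewrite /ph sth// natrM; field; rewrite !lt0r_neq0.
apply: ler_sum => a _; rewrite /dpow; apply: lerD; apply: key.
- by apply: le_trans (qL a); rewrite lerDl sqr_ge0.
- have := arclip_riemann T_gt0 v_ge0 vi L_gt0 N0 th0 thN bth mth sth (ccos_arclip m a).
  congr (`|_ - _ * _| <= _); rewrite /dcos; apply: eq_bigr => i _.
  by rewrite phE// ltnW.
- by apply: le_trans (qL a); rewrite lerDr sqr_ge0.
- have := arclip_riemann T_gt0 v_ge0 vi L_gt0 N0 th0 thN bth mth sth (csin_arclip m a).
  congr (`|_ - _ * _| <= _); rewrite /dsin; apply: eq_bigr => i _.
  by rewrite phE// ltnW.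
Qed.

(** The factor of [dpow_diff]: the eigenvalue at frequency m of the second difference on a cycle of
    N points. *)
Let lam N m : R := 2 - 2 * cos (m%:R * (2 * pi / N%:R)).

Let P_total N th : (0 < N)%N -> subdivision N th -> \sum_(m < N) P N th m = N%:R ^+ 2.
Proof.
move=> N0 [th0 thN bth mth sth]; rewrite exchange_big/=.
under eq_bigr do rewrite (discrete_parseval N0).
rewrite -mulr_sumr exchange_big/=; under eq_bigr => i _ do rewrite c_unit ?bth ?(ltnW (ltn_ord i))//.
by rewrite sumr_const card_ord expr2.
Qed.

(** Parseval for the differences of consecutive points: chords are no longer than their arcs, all of
    length L / N. *)
Let P_energy N th : (0 < N)%N -> subdivision N th ->
  \sum_(m < N) lam N m * P N th m <= L ^+ 2.
Proof.
move=> N0 [th0 thN bth mth sth]; have N0R : (0 : R) < N%:R by rewrite ltr0n.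
have -> : \sum_(m < N) lam N m * P N th m =
    N%:R * \sum_(i < N) \sum_a (c a (th i.+1) - c a (th i)) ^+ 2.
  under eq_bigr do rewrite mulr_sumr.
  rewrite exchange_big/= [X in _ * X]exchange_big/= mulr_sumr; apply: eq_bigr => a _.
  transitivity (\sum_(m < N) dpow N (fun i => dshift N (fun i => c a (th i)) i - c a (th i)) m).
    by apply: eq_bigr => m _; rewrite (dpow_diff N0) muln1.
  rewrite (discrete_parseval N0); congr (_ * _); apply: eq_bigr => i _.
  congr ((_ - _) ^+ 2); rewrite /dshift.
  have [iN|] := ltnP i.+1 N; first by rewrite modn_small.
  move=> Ni; have -> : i.+1 = N by apply/eqP; rewrite eqn_leq Ni ltn_ord.
  by rewrite modnn thN th0 c_closed.
have -> : L ^+ 2 = N%:R * \sum_(i < N) (L / N%:R) ^+ 2.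
  by rewrite sumr_const card_ord -mulr_natl; field; rewrite lt0r_neq0.
rewrite ler_pM2l//; apply: ler_sum => i _.
have bi := bth i (ltnW (ltn_ord i)); have bi1 := bth i.+1 (ltn_ord i).
have := c_lip (x := th i) (y := th i.+1) ltac:(lra) (mth i (ltn_ord i)) ltac:(lra).
congr (_ <= _ ^+ 2); rewrite !sth//; [rewrite -natr1; ring|exact: ltnW].
Qed.

Let P_ge0 N th m : 0 <= P N th m.
Proof. by apply: sumr_ge0 => a _; rewrite addr_ge0// sqr_ge0. Qed.

Let angle_mirror N m : (0 < N)%N -> (m <= N)%N ->
  (N - m)%:R * (2 * pi / N%:R) = - (m%:R * (2 * pi / N%:R)) + 1%:R * (2 * pi) :> R.
Proof.
by move=> N0 mN; rewrite natrB//; field; rewrite pnatr_eq0 -lt0n.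
Qed.

Let lam_mirror N m : (0 < N)%N -> (m <= N)%N -> lam N (N - m) = lam N m.
Proof. by move=> N0 mN; rewrite /lam angle_mirror// cosD2piMn cosN. Qed.

Let P_mirror N th m : (0 < N)%N -> (m <= N)%N -> P N th (N - m) = P N th m.
Proof.
move=> N0 mN; apply: eq_bigr => a _; rewrite /dpow.
have E i : ((N - m) * i)%:R * (2 * pi / N%:R) =
    - ((m * i)%:R * (2 * pi / N%:R)) + i%:R * (2 * pi) :> R.
  by rewrite natrM mulrAC angle_mirror// natrM; ring.
congr (_ + _).
  by congr (_ ^+ 2); apply: eq_bigr => i _; rewrite E cosD2piMn cosN.
rewrite -sqrrN; congr (_ ^+ 2); rewrite /dsin -sumrN; apply: eq_bigr => i _.
by rewrite E sinD2piMn sinN mulrN opprK.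
Qed.

Let lam_mono N i j : (0 < N)%N -> (i <= j)%N -> (j.*2 <= N)%N -> lam N i <= lam N j.
Proof.
move=> N0 ij jN; rewrite /lam lerD2l lerN2 ler_pM2l//.
have N0R : (0 : R) < N%:R by rewrite ltr0n.
have ang l : (l.*2 <= N)%N -> 0 <= l%:R * (2 * pi / N%:R) <= (pi : R).
  move=> lN; rewrite mulr_ge0 ?divr_ge0 ?mulr_ge0 ?pi_ge0//=.
  rewrite mulrA ler_pdivrMr// [pi * _]mulrC mulrA ler_pM2r ?pi_gt0//.
  by rewrite -natrM ler_nat muln2.
have [->//|ne] := eqVneq i j.
rewrite ltW// ltr_cos ?in_itv/= ?ang//; last lia.
rewrite ltr_pM2r ?ltr_nat ?ltn_neqAle ?ne//.
by rewrite divr_gt0// mulr_gt0// pi_gt0.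
Qed.

(** Subtract lam (k + 1) times the total power from the energy: only the frequencies up to k and
    their mirror images contribute negatively, and there [P_le] caps the power. Then N tends to
    infinity. *)
Lemma spectral_bound (k : nat) :
  (2 * pi) ^+ 2 * (k.+1%:R ^+ 2 - 2 / n%:R * \sum_(m < k) (k.+1%:R ^+ 2 - m.+1%:R ^+ 2))
    <= L ^+ 2.
Proof.
have [K K0 PK] : exists2 K : nat -> R, forall m, 0 <= K m &
    forall m N th, (0 < N)%N -> subdivision N th ->
    P N th m <= N%:R ^+ 2 * (q m / L ^+ 2 + K m / N%:R).
  have h m : exists K, 0 <= K /\ forall N th, (0 < N)%N -> subdivision N th ->
      P N th m <= N%:R ^+ 2 * (q m / L ^+ 2 + K / N%:R).
    by have [K K0 KP] := P_le m; exists K.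
  by have [K /all_and2[K0 KP]] := choice h; exists K.
pose mu m (N : nat) : R := N.+1%:R ^+ 2 * lam N.+1 m.
pose g m (N : nat) : R := (mu k.+1 N - mu m N) * (q m / L ^+ 2 + K m * N.+1%:R^-1).
(* The lower bound for L ^ 2 obtained from N + 1 points; the two sums count the frequencies m and
   their mirror images N + 1 - m. *)
pose A (N : nat) : R := mu k.+1 N - (\sum_(m < k.+1) g m N + \sum_(m < k) g m.+1 N).
have AL : \forall N \near \oo, A N <= L ^+ 2.
  (* For these N, k + 1 is at most half of N + 1, the range where [lam] is monotone. *)
  exists k.+1.*2 => // N /= kN.
  have N0 : (0 < N.+1)%N by [].
  have [th sub] := arclen_subdivision T_gt0 v_ge0 vi L_gt0 N0.
  apply: le_trans (P_energy N0 sub).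
  have -> : \sum_(m < N.+1) lam N.+1 m * P N.+1 th m =
     mu k.+1 N + \sum_(m < N.+1) (lam N.+1 m - lam N.+1 k.+1) * P N.+1 th m.
    under [in RHS]eq_bigr do rewrite mulrBl.
    rewrite sumrB -mulr_sumr (P_total N0 sub) /mu; ring.
  rewrite /A lerD2l.
  have hmir := @sum_mirror_ge R (fun m => (lam N.+1 m - lam N.+1 k.+1) * P N.+1 th m) k N.+1.
  apply: le_trans (hmir _ _ _).
  - have gP m : (m <= k)%N ->
        - g m N <= (lam N.+1 m - lam N.+1 k.+1) * P N.+1 th m.
      move=> mk; have := lam_mono N0 (leqW mk) (ltac:(lia) : (k.+1.*2 <= N.+1)%N).
      rewrite -subr_ge0 => hl; have hP := PK m N.+1 th N0 sub.
      have -> : g m N = (lam N.+1 k.+1 - lam N.+1 m) *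
          (N.+1%:R ^+ 2 * (q m / L ^+ 2 + K m / N.+1%:R)) by rewrite /g /mu; ring.
      by rewrite -[lam _ m - _]opprB mulNr lerN2 ler_wpM2l.
    rewrite opprD -!sumrN; apply: lerD; apply: ler_sum => m _; apply: gP.
      by rewrite -ltnS.
    exact: ltn_ord.
  - lia.
  - move=> m /andP[h1 h2]; apply: mulr_ge0 => //; rewrite subr_ge0.
    have [mN|mN] := leqP m.*2 N.+1; first exact: lam_mono.
    by rewrite -(lam_mirror N0 (m := m)); [apply: lam_mono => //; lia|lia].
  - by move=> m /andP[h1 h2]; rewrite lam_mirror ?P_mirror//; lia.
have inv0 : (fun N : nat => N.+1%:R^-1) @ \oo --> (0 : R) by exact: cvg_harmonic.
pose M m : R := (m%:R * (2 * pi)) ^+ 2.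
have cmu m : mu m @ \oo --> M m by exact: cvg_dft_eigenvalue.
have cg m : g m @ \oo --> (M k.+1 - M m) * (q m / L ^+ 2).
  rewrite (_ : (M k.+1 - M m) * _ = (M k.+1 - M m) * (q m / L ^+ 2 + K m * 0)); last first.
    by rewrite mulr0 addr0.
  apply: cvgM; first by apply: cvgB; exact: cmu.
  by apply: cvgD; [exact: cvg_cst|apply: cvgM => //; exact: cvg_cst].
have cA : A @ \oo --> M k.+1 - (\sum_(m < k.+1) (M k.+1 - M m) * (q m / L ^+ 2)
    + \sum_(m < k) (M k.+1 - M m.+1) * (q m.+1 / L ^+ 2)).
  apply: cvgB; first exact: cmu.
  apply: cvgD; apply: cvg_big => [|m _]; try exact: add_continuous; exact: cg.
have limL := ler_cvg_to cA (cvg_cst (L ^+ 2)) AL.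
apply: le_trans (limL _ _).
(* Frequency 0 carries no power because the coordinates have mean zero; each of the frequencies 1,
   ..., k then occurs twice. *)
rewrite big_ord_recl/= q0 mul0r mulr0 add0r.
have -> : \sum_(m < k) (M k.+1 - M m.+1) * (q m.+1 / L ^+ 2) =
    \sum_(m < k) (M k.+1 - M (bump 0 m)) * (q (bump 0 m) / L ^+ 2) by [].
have h : \sum_(m < k) (M k.+1 - M (bump 0 m)) * (q (bump 0 m) / L ^+ 2) <=
    \sum_(m < k) (M k.+1 - M m.+1) * n%:R^-1.
  apply: ler_sum => m _; rewrite /bump leq0n add1n; apply: ler_wpM2l.
    rewrite /M subr_ge0 ler_pXn2r ?nnegrE ?mulr_ge0 ?pi_ge0//.
    by rewrite ler_wpM2r ?mulr_ge0 ?pi_ge0// ler_nat ltnW// ltnS ltn_ord.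
  by rewrite ler_pdivrMr ?exprn_gt0// [_ * L ^+ 2]mulrC q_le.
apply: (@le_trans _ _ (M k.+1 - 2 * \sum_(m < k) (M k.+1 - M m.+1) * n%:R^-1)); last first.
  by rewrite lerD2l lerN2; have := h; lra.
rewrite -mulr_suml le_eqVlt; apply/orP; left; apply/eqP.
have -> : \sum_(m < k) (M k.+1 - M m.+1) =
    (2 * pi) ^+ 2 * \sum_(m < k) (k.+1%:R ^+ 2 - m.+1%:R ^+ 2).
  by rewrite mulr_sumr; apply: eq_bigr => m _; rewrite /M; ring.
rewrite /M; ring.
Unshelve. all: by end_near. Qed.

End SpectralBound.

(** * Moments of the uniform measure *)

Lemma continuous_mx (T U : topologicalType) m n (f : U -> 'M[T]_(m, n)) :
  (forall i j, continuous (fun x => f x i j)) -> continuous f.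
Proof.
move=> cf x A [P Pn PA]; have := fun i j => cf i j x (P i j) (Pn i j).
move=> h; have : \forall y \near x, forall ij : 'I_m * 'I_n, P ij.1 ij.2 (f y ij.1 ij.2).
  by apply: filter_forall => ij; exact: h.
by apply: filterS => y Py; apply: PA => i j; exact: (Py (i, j)).
Qed.

Section SphereMoments.
Variables (R : realType) (d : nat).
Variable sigma : probability (borel_rV R d.+1) R.
Hypothesis sigma_unif : uniform_on_sphere sigma.
Local Notation S := (sphere R d : set (borel_rV R d.+1)).

Lemma measurable_coord (i : 'I_d.+1) :
  measurable_fun [set: borel_rV R d.+1] (fun v : borel_rV R d.+1 => v 0 i).
Proof.
apply: (measurability (@RGenOInfty.G R)); first exact: RGenOInfty.measurableE.
move=> _ [_ [a ->] <-]; rewrite setTI; apply: sub_sigma_algebra.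
have /continuousP := @coord_continuous R 1 d.+1 0 i.
by apply; rewrite set_itvoy; exact: open_gt.
Qed.

Lemma measurable_mulmx (M : 'M[R]_d.+1) :
  measurable_fun [set: borel_rV R d.+1]
    (fun v : borel_rV R d.+1 => (v : 'rV[R]_d.+1) *m M : borel_rV R d.+1).
Proof.
have cM : continuous (fun v : 'rV[R]_d.+1 => v *m M).
  apply: continuous_mx => i j; under [X in continuous X]eq_fun do rewrite mxE.
  apply: continuous_big => [|l _ v]; first exact: add_continuous.
  have h := @coord_continuous R 1 d.+1 i l v; exact: (cvgM h (cvg_cst _)).
apply: (@measurability _ _ (borel_rV R d.+1) (borel_rV R d.+1) setT _ (@open 'rV[R]_d.+1)) => // _ [B oB <-].
rewrite setTI; apply: sub_sigma_algebra.
by move/continuousP : cM; exact.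
Qed.

Lemma sphereE (v : 'rV[R]_d.+1) : sphere R d v <-> \sum_(i < d.+1) v 0 i ^+ 2 = 1.
Proof.
rewrite /sphere /enorm/=; split=> [h|->]; last by rewrite sqrtr1.
by rewrite -(sqr_sqrtr (sumr_ge0 _ (fun i _ => sqr_ge0 (v 0 i)))) h expr1n.
Qed.

Lemma measurable_sphere : measurable S.
Proof.
have mq : measurable_fun [set: borel_rV R d.+1]
    (fun v : borel_rV R d.+1 => \sum_(i < d.+1) (v : 'rV[R]_d.+1) 0 i ^+ 2).
  by apply: measurable_sum => i; apply: measurable_funX; exact: measurable_coord.
have -> : S = [set: borel_rV R d.+1] `&`
    (fun v : borel_rV R d.+1 => \sum_(i < d.+1) (v : 'rV[R]_d.+1) 0 i ^+ 2) @^-1` [set 1].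
  rewrite setTI; apply/seteqP; split => v /=; first by move/sphereE.
  by move=> h; apply/sphereE.
by apply: mq => //; exact: measurable_set1.
Qed.

Lemma sphere_coord_le1 (v : 'rV[R]_d.+1) i : sphere R d v -> `|v 0 i| <= 1.
Proof.
move/sphereE; rewrite (bigD1 i)//= => h.
rewrite -(@ler_pXn2r _ 2)// ?nnegrE// expr1n real_normK ?num_real// -h lerDl.
by apply: sumr_ge0 => j _; exact: sqr_ge0.
Qed.

Lemma sphere_integrable (f : borel_rV R d.+1 -> R) (c : R) :
  measurable_fun [set: borel_rV R d.+1] f -> (forall v, S v -> `|f v| <= c) ->
  sigma.-integrable S (EFin \o f).
Proof.
move=> mf fc; apply: measurable_bounded_integrable.
- exact: measurable_sphere.
- by rewrite (le_lt_trans (probability_le1 _ measurable_sphere))// ltey.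
- exact: measurable_funTS.
- exists c; split; first exact: num_real.
  by move=> x cx v Sv /=; rewrite (le_trans (fc _ Sv))// ltW.
Qed.

Lemma rotation_sphere (M : 'M[R]_d.+1) (v : 'rV[R]_d.+1) : is_rotation M ->
  sphere R d (v *m M) <-> sphere R d v.
Proof.
move=> [MM _]; have norm (u : 'rV[R]_d.+1) : (u *m u^T) 0 0 = \sum_(i < d.+1) u 0 i ^+ 2.
  by rewrite mxE; apply: eq_bigr => i _; rewrite mxE expr2.
rewrite !sphereE -!norm trmx_mul -mulmxA (mulmxA M) MM mul1mx.
by [].
Qed.

Lemma sphere_integral_rotation (M : 'M[R]_d.+1) (f : borel_rV R d.+1 -> R) (c : R) :
  is_rotation M -> measurable_fun [set: borel_rV R d.+1] f ->
  (forall v, S v -> `|f v| <= c) ->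
  \int[sigma]_(v in S) f ((v : 'rV[R]_d.+1) *m M) = \int[sigma]_(v in S) f v.
Proof.
move=> rM mf fc; pose phi (v : borel_rV R d.+1) : borel_rV R d.+1 := (v : 'rV[R]_d.+1) *m M.
have mphi : measurable_fun [set: borel_rV R d.+1] phi by exact: measurable_mulmx.
have Sphi : phi @^-1` S = S.
  by apply/seteqP; split => v /= /(rotation_sphere v rM).
rewrite /Rintegral; congr fine.
have -> : (\int[sigma]_(v in S) (f v)%:E = \int[pushforward sigma phi]_(v in S) (f v)%:E)%E.
  apply: eq_measure_integral => A mA AS.
  by rewrite /pushforward; apply/esym; exact: sigma_unif.2.
rewrite (integral_pushforward mphi (f := EFin \o f)).
- by rewrite Sphi.
- exact/measurable_EFinP.
- rewrite Sphi; apply: (@sphere_integrable (f \o phi) c).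
    exact: measurableT_comp.
  move=> v Sv; apply: fc; exact/(rotation_sphere v rM).
- exact: measurable_sphere.
Qed.
End SphereMoments.

Section SphereMoments2.
Variables (R : realType) (d : nat).
Hypotheses (d_gt0 : (0 < d)%N) (d_even : ~~ odd d).
Variable sigma : probability (borel_rV R d.+1) R.
Hypothesis sigma_unif : uniform_on_sphere sigma.
Local Notation S := (sphere R d : set (borel_rV R d.+1)).

Lemma sphere_integral_cst (c : R) : \int[sigma]_(v in S) c = c.
Proof.
transitivity (c * fine (sigma S)); last by rewrite sigma_unif.1 mulr1.
by apply: Rintegral_cst; exact: measurable_sphere.
Qed.

(** Negating a single coordinate reverses the orientation; a second one is negated to stay in SO(d +
    1). *)
Definition flip2 (i l : 'I_d.+1) : 'M[R]_d.+1 :=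
  diag_mx (\row_j if (j == i) || (j == l) then -1 else 1).

Lemma flip2_rotation (i l : 'I_d.+1) : i != l -> is_rotation (flip2 i l).
Proof.
move=> il; split.
  rewrite /flip2 tr_diag_mx mulmx_diag -diag_const_mx; congr diag_mx.
  by apply/rowP => j; rewrite !mxE; case: ifP => _; rewrite ?mulrNN mulr1.
rewrite /flip2 det_diag (bigD1 i)//= (bigD1 l) 1?eq_sym//= !mxE !eqxx/= orbT.
rewrite big1 ?mulr1 ?mulrNN ?mulr1// => j /andP[ji jl].
by rewrite mxE (negbTE ji) (negbTE jl).
Qed.

Lemma mul_flip2 (i l : 'I_d.+1) (v : 'rV[R]_d.+1) j :
  (v *m flip2 i l) 0 j = if (j == i) || (j == l) then - v 0 j else v 0 j.
Proof. by rewrite /flip2 mul_mx_diag !mxE; case: ifP; rewrite ?mulrN1 ?mulr1. Qed.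

(** As d is even and positive there are at least three coordinates, so a sign change of i can be
    paired with one that leaves j alone. *)
Lemma other_index (i j : 'I_d.+1) : exists l : 'I_d.+1, (l != i) && (l != j).
Proof.
apply: contrapT => nex.
have h : pred2 i j =i predT.
  move=> l; rewrite !inE; apply/negPn/negP; rewrite negb_or => hl; apply: nex; exists l.
  exact: hl.
have := eq_card h; rewrite card2 => e; have := card_ord d.+1; rewrite -e.
by case: eqP => _ /=; move: d_gt0 d_even; case: (d) => [|[|]].
Qed.

Let mcoord i : measurable_fun [set: borel_rV R d.+1]
  (fun v : borel_rV R d.+1 => (v : 'rV[R]_d.+1) 0 i).
Proof. exact: measurable_coord. Qed.

Let mcoord2 i j : measurable_fun [set: borel_rV R d.+1]
  (fun v : borel_rV R d.+1 => (v : 'rV[R]_d.+1) 0 i * (v : 'rV[R]_d.+1) 0 j).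
Proof. by apply: measurable_funM; exact: mcoord. Qed.

Let bcoord2 i j (v : borel_rV R d.+1) :
  S v -> `|(v : 'rV[R]_d.+1) 0 i * (v : 'rV[R]_d.+1) 0 j| <= 1.
Proof. by move=> Sv; rewrite normrM mulr_ile1// sphere_coord_le1. Qed.

Let bcoord i (v : borel_rV R d.+1) : S v -> `|(v : 'rV[R]_d.+1) 0 i| <= 1.
Proof. exact: sphere_coord_le1. Qed.

Lemma sphere_integrable_coord i : sigma.-integrable S
  (EFin \o (fun v : borel_rV R d.+1 => (v : 'rV[R]_d.+1) 0 i)).
Proof. by apply: sphere_integrable (bcoord i). Qed.

Lemma sphere_integrable_coord2 i j : sigma.-integrable S
  (EFin \o (fun v : borel_rV R d.+1 => (v : 'rV[R]_d.+1) 0 i * (v : 'rV[R]_d.+1) 0 j)).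
Proof. by apply: sphere_integrable (@bcoord2 i j). Qed.

Lemma sphere_integral_coord (i : 'I_d.+1) :
  \int[sigma]_(v in S) (v : 'rV[R]_d.+1) 0 i = 0.
Proof.
have [l /andP[li _]] := other_index i i.
have rM : is_rotation (flip2 i l) by apply: flip2_rotation; rewrite eq_sym.
have := sphere_integral_rotation sigma_unif rM (mcoord i) (bcoord i).
have -> : \int[sigma]_(v in S) ((v : 'rV[R]_d.+1) *m flip2 i l) 0 i =
    - \int[sigma]_(v in S) (v : 'rV[R]_d.+1) 0 i.
  rewrite -mulN1r -RintegralZl; [|exact: measurable_sphere|exact: sphere_integrable_coord].
  by apply: eq_Rintegral => v _; rewrite mul_flip2 eqxx mulN1r.
lra.
Qed.

Lemma sphere_integral_coord_neq (i j : 'I_d.+1) : i != j ->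
  \int[sigma]_(v in S) ((v : 'rV[R]_d.+1) 0 i * (v : 'rV[R]_d.+1) 0 j) = 0.
Proof.
move=> ij; have [l /andP[li lj]] := other_index i j.
have rM : is_rotation (flip2 i l) by apply: flip2_rotation; rewrite eq_sym.
have := sphere_integral_rotation sigma_unif rM (mcoord2 i j) (@bcoord2 i j).
have -> : \int[sigma]_(v in S) (((v : 'rV[R]_d.+1) *m flip2 i l) 0 i *
     ((v : 'rV[R]_d.+1) *m flip2 i l) 0 j) =
    - \int[sigma]_(v in S) ((v : 'rV[R]_d.+1) 0 i * (v : 'rV[R]_d.+1) 0 j).
  rewrite -mulN1r -RintegralZl//; first last.
  - exact: sphere_integrable_coord2.
  - exact: measurable_sphere.
  apply: eq_Rintegral => v _; rewrite !mul_flip2 eqxx /= [j == i]eq_sym (negbTE ij) [j == l]eq_sym (negbTE lj)/=.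
  by rewrite mulN1r mulNr.
lra.
Qed.

Lemma sphere_integral_coord_sqr (i : 'I_d.+1) :
  \int[sigma]_(v in S) ((v : 'rV[R]_d.+1) 0 i * (v : 'rV[R]_d.+1) 0 i) = d.+1%:R^-1.
Proof.
pose I j := \int[sigma]_(v in S) ((v : 'rV[R]_d.+1) 0 j * (v : 'rV[R]_d.+1) 0 j).
have II j : I j = I i.
  have [->//|ij] := eqVneq i j.
  (* A transposition has determinant -1. Its negative is a rotation because d + 1 is odd, and
     squares do not see the sign. *)
  have rM : is_rotation (- tperm_mx i j : 'M[R]_d.+1).
    split.
      rewrite raddfN/= mulmxN mulNmx opprK tr_tperm_mx /tperm_mx -perm_mxM perm.tperm2.
      exact: perm_mx1.
    rewrite -scaleN1r detZ /tperm_mx det_perm perm.odd_tperm ij expr1.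
    by rewrite -signr_odd/= d_even expr1 mulrNN mulr1.
  have := sphere_integral_rotation sigma_unif rM (mcoord2 i i) (@bcoord2 i i).
  rewrite -/(I i) => <-; apply: eq_Rintegral => v _.
  by rewrite mulmxN -xcolE !mxE mulrNN perm.tpermL.
have : \sum_(j < d.+1) I j = 1.
  rewrite -[RHS](sphere_integral_cst 1).
  transitivity (\int[sigma]_(v in S) \sum_(j < d.+1) ((v : 'rV[R]_d.+1) 0 j * (v : 'rV[R]_d.+1) 0 j)).
    rewrite Rintegral_sum//; first exact: measurable_sphere.
    by move=> j _; exact: sphere_integrable_coord2.
  apply: eq_Rintegral => v; rewrite inE => /sphereE <-.
  by apply: eq_bigr => j _; rewrite expr2.
under eq_bigr do rewrite II.
rewrite sumr_const card_ord => h.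
by apply: (@mulfI _ d.+1%:R) => //; rewrite mulfV// mulr_natl.
Qed.
End SphereMoments2.

(** Here x = d / 2, p = pi and t = sqrt 3, and the right side is the spectral bound. Divided by (p /
    t) ^ 2, the claim becomes (2 x + 5 / 2 + u / x) ^ 2 <= 4 x ^ 2 + 10 x + 9 + 3 / (2 x + 1) with u
    = 0.72 t / p, which is tight at x = 1. *)
Lemma length_bound_square (R : realType) (x p t : R) :
  1 <= x -> 1563 / 500 < p -> 0 < t -> t ^+ 2 = 3 ->
  (p / t * (x * 2) + 5 * p / (2 * t) + 144 / 100 * (x * 2)^-1) ^+ 2 <=
  (2 * p) ^+ 2 * (x * (x + 1) / 3 + (x + 1) ^+ 2 / (2 * x + 1)).
Proof.
move=> k1 p1 s3 s3s; have n0 : 2 * x + 1 != 0 by apply: lt0r_neq0; lra.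
have t1 : t <= 97 / 56.
  rewrite leNgt; apply/negP => ht; have c0 : (0 : R) <= 97 / 56 by lra.
  have := ltr_pM c0 c0 ht ht; have tt : t * t = 3 by rewrite -s3s expr2.
  rewrite tt; lra.
have x0 : x != 0 by apply: lt0r_neq0; lra.
have p0 : 0 < p by lra.
have pn := lt0r_neq0 p0; have tn := lt0r_neq0 s3.
have -> : p / t * (x * 2) + 5 * p / (2 * t) + 144 / 100 * (x * 2)^-1 =
   p / t * (2 * x + 5 / 2 + (72 / 100 * (t / p)) / x).
  by field; rewrite ?x0 ?tn ?pn.
have tp : t / p <= 128 / 231 by rewrite ler_pdivrMr; [lra|exact: p0].
have tp0 : 0 < t / p by exact: divr_gt0.
have pt0 : 0 < p / t by exact: divr_gt0.
(* At x = 1 the inequality reads 9 u + u ^ 2 <= 15 / 4, which 77 / 193 barely satisfies. *)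
clear p1; set u := 72 / 100 * (t / p); have [u0 u1] : 0 <= u /\ u <= 77 / 193.
  by rewrite /u; split; lra.
clear tp; have xp : 0 < x^-1 by rewrite invr_gt0; lra.
have h1 : u / x <= 77 / 193 / x by rewrite (ler_pM2r xp).
have h0 : 0 <= u / x by apply: mulr_ge0; [exact: u0|exact: ltW].
have b0 : 0 <= 2 * x + 5 / 2 + u / x by lra.
have -> : (p / t * (2 * x + 5 / 2 + u / x)) ^+ 2 =
  p ^+ 2 * ((2 * x + 5 / 2 + u / x) ^+ 2 / 3).
  by rewrite exprMn expr_div_n s3s; ring.
have -> : (2 * p) ^+ 2 * (x * (x + 1) / 3 + (x + 1) ^+ 2 / (2 * x + 1)) =
  p ^+ 2 * (4 * (x * (x + 1) / 3 + (x + 1) ^+ 2 / (2 * x + 1))).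
  by ring.
rewrite (ler_pM2l (exprn_gt0 2 p0)).
have : (2 * x + 5 / 2 + u / x) ^+ 2 <= (2 * x + 5 / 2 + 77 / 193 / x) ^+ 2.
  by rewrite ler_sqr ?nnegrE; [lra|exact: b0|lra].
move=> h2; rewrite ler_pdivrMr; last by [].
apply: (le_trans h2).
rewrite -subr_ge0.
have -> : 4 * (x * (x + 1) / 3 + (x + 1) ^+ 2 / (2 * x + 1)) * 3 - (2 * x + 5 / 2 + 77 / 193 / x) ^+ 2
  = ((11 / 4 - 308 / 193) * x ^+ 2 * (2 * x + 1) + 3 * x ^+ 2 - (385 / 193 * x + (77 / 193) ^+ 2) * (2 * x + 1)) / (x ^+ 2 * (2 * x + 1)).
  by field; rewrite x0 n0.
apply: divr_ge0; last by apply: mulr_ge0; [exact: sqr_ge0|lra].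
have -> : x = (x - 1) + 1 by ring.
set y := x - 1; have y0 : 0 <= y by rewrite /y; lra.
have y2 : 0 <= y ^+ 2 by exact: sqr_ge0.
have y3 : 0 <= y ^+ 3 by exact: exprn_ge0.
lra.
Qed.

Section LowerBound.
Variables (R : realType) (d : nat).
Hypotheses (d_gt0 : (0 < d)%N) (d_even : ~~ odd d).
Variable sigma : probability (borel_rV R d.+1) R.
Hypothesis sigma_unif : uniform_on_sphere sigma.
Variable gamma : R -> 'rV[R]_d.+1.
Hypothesis gamma_design : design_curve sigma 2 gamma.
Local Notation leb := (@lebesgue_measure R).
Local Notation T := (2 * pi : R).
Local Notation cu := (closed_up gamma).

Lemma design_length_spectral (k : nat) :
  T ^+ 2 * (k.+1%:R ^+ 2 - 2 / d.+1%:R * \sum_(m < k) (k.+1%:R ^+ 2 - m.+1%:R ^+ 2))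
    <= curve_length gamma ^+ 2.
Proof.
have [gC len_gt0 des] := gamma_design; have T0 := twopi_gt0 R.
have [v [v0 vi vL [N [mN N0 vN]]]] := curve_speed_repr gC.
have mD : measurable (`[0, T[%classic : set (measurableTypeR R)) by exact: measurable_itv.
(* Passes from [speed gamma] to [v] and from [gamma] to [closed_up gamma]. The exceptional set is
   [N] together with 0, where [derive1] may see values of [gamma] outside [0, 2 pi). *)
have transfer (f g : R -> R) : leb.-integrable `[0, T] (EFin \o (fun t => g t * v t)) ->
    (forall t, 0 < t < T -> f t = g t) ->
    \int[leb]_(t in `[0, T[) (f t * speed gamma t) = \int[leb]_(t in `[0, T]) (g t * v t).
  move=> gi fg; rewrite -Rintegral_itv_bndo_bndc; last first.
    by apply: integrableS gi => // t/=; rewrite !in_itv/=; lra.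
  have m0 : measurable ([set 0] : set (measurableTypeR R)) by exact: measurable_set1.
  have leb0 : leb [set 0] = 0%E by exact: lebesgue_measure_set1.
  rewrite /Rintegral; congr fine.
  apply: (@integral_eq_off_null _ _ _ leb _ (N `|` [set 0])).
  - exact: measurableU.
  - apply/eqP; rewrite -measure_le0.
    by rewrite (le_trans (measureU2 _ mN m0))// [X in (X + _)%E]N0 add0e [leLHS]leb0.
  move=> t; rewrite /= in_itv/= => /andP[t0 tT] /not_orP[Nt /eqP tn0].
  have t0' : 0 < t by rewrite lt_neqAle eq_sym tn0.
  by rewrite fg ?t0'// vN// t0'.
have v1 : \int[leb]_(t in `[0, T]) (1 * v t) = arclen v T.
  by apply: eq_Rintegral => t _; rewrite mul1r.
have LE : curve_length gamma = arclen v T.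
  rewrite -v1 -(transfer (fun=> 1)) //; last first.
    by rewrite (_ : (fun t => 1 * v t) = v)//; apply/funext => t; rewrite mul1r.
  by apply: eq_Rintegral => t _; rewrite mul1r.
have L0 : 0 < arclen v T by rewrite -LE.
have vB x y : 0 <= x -> x <= y -> y <= T ->
    \sum_a (cu y 0 a - cu x 0 a) ^+ 2 <= (arclen v y - arclen v x) ^+ 2.
  move=> x0 xy yT; have := vL x y x0 xy yT; rewrite (arclenB vi)// => h.
  have -> : \sum_a (cu y 0 a - cu x 0 a) ^+ 2 = enorm (cu y - cu x) ^+ 2.
    by rewrite sqr_enorm; apply: eq_bigr => a _; rewrite !mxE.
  have e0 := enorm_ge0 (cu y - cu x).
  by rewrite ler_pXn2r// nnegrE (le_trans e0 h).
have cu1 x : \sum_a cu x 0 a ^+ 2 = 1 by apply/sphereE; exact: closed_up_sphere.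
have cuL a : arclip T v 1 (fun t => cu t 0 a).
  move=> x y x0 xy yT; rewrite mul1r.
  have sxy : 0 <= arclen v y - arclen v x by rewrite subr_ge0; exact: (arclen_nd v0 vi).
  rewrite -(@ler_pXn2r _ 2)// ?nnegrE// real_normK ?num_real//.
  apply: le_trans (vB _ _ x0 xy yT).
  by rewrite (bigD1 a)//= lerDl sumr_ge0// => b _; exact: sqr_ge0.
have cub a x : 0 <= x <= T -> `|cu x 0 a| <= 1.
  by move=> _; apply: sphere_coord_le1; exact: closed_up_sphere.
have := @spectral_bound R T v d.+1 (fun a t => cu t 0 a) T0 v0 vi L0 (ltn0Sn d) vB.
rewrite -LE; apply => //.
- move=> a; have -> : cu 0 = gamma 0 by apply: closed_upE; rewrite lexx.
  by rewrite /closed_up clip_id ?lexx ?ltW// ltxx.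
- move=> a; have /des := poly_space_coord R a.
  rewrite (sphere_integral_coord d_gt0 d_even sigma_unif).
  rewrite (transfer _ (fun t => cu t 0 a)); last 2 first.
  + exact: (arclip_integrable T0 v0 vi L0 (cuL a)).
  + by move=> t /andP[t0 tT]; rewrite closed_upE// ltW.
  by move=> /esym/eqP; rewrite mulf_eq0 invr_eq0 (gt_eqF len_gt0)/= => /eqP.
- move=> a b; have /des := poly_space_coord2 R a b.
  rewrite (transfer _ (fun t => cu t 0 a * cu t 0 b)); last 2 first.
  + exact: (arclip_integrable T0 v0 vi L0 (arclipM (cub a) (cub b) (cuL a) (cuL b))).
  + by move=> t /andP[t0 tT]; rewrite closed_upE// ltW.
  have [<-|ab] := eqVneq a b.
    rewrite (sphere_integral_coord_sqr d_even sigma_unif) mul1r => ->.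
    by rewrite mulVKf// gt_eqF.
  rewrite (sphere_integral_coord_neq d_gt0 d_even sigma_unif ab) mul0r.
  by move=> /esym/eqP; rewrite mulf_eq0 invr_eq0 (gt_eqF len_gt0)/= => /eqP.
Qed.

Lemma sum_square_gap (k : nat) :
  6 * \sum_(m < k) (k.+1%:R ^+ 2 - m.+1%:R ^+ 2) = k%:R * (k%:R + 1) * (4 * k%:R + 5) :> R.
Proof.
have sq j : 6 * \sum_(m < j) m.+1%:R ^+ 2 = j%:R * (j%:R + 1) * (2 * j%:R + 1) :> R.
  elim: j => [|j IH]; first by rewrite big_ord0 mulr0 !mul0r.
  by rewrite big_ord_recr/= mulrDr IH -(natr1 j); ring.
rewrite sumrB sumr_const card_ord -(mulr_natl _ k) mulrBr sq -(natr1 k); ring.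
Qed.

Lemma design_curve_length_lower :
  pi / Num.sqrt 3 * d%:R + 5 * pi / (2 * Num.sqrt 3) + 144 / 100 * d%:R^-1
    <= curve_length gamma.
Proof.
have [_ len_gt0 _] := gamma_design.
have [k dk] : exists k, d = k.*2 by exists d./2; rewrite -[LHS]odd_double_half (negbTE d_even).
have k1 : (1 : R) <= k%:R by rewrite ler1n; move: d_gt0; rewrite dk; lia.
have e1 : d.+1%:R = k%:R * 2 + 1 :> R by rewrite dk -natr1 -muln2 natrM.
have e2 : d%:R = k%:R * 2 :> R by rewrite dk -muln2 natrM.
have := design_length_spectral k; have := sum_square_gap k.
rewrite e1 e2; set S := \sum_(m < k) _; rewrite -(natr1 k).
set x : R := k%:R in k1 *; set L := curve_length gamma in len_gt0 *.
move=> hS hL; have SE : S = x * (x + 1) * (4 * x + 5) / 6 by rewrite -hS; field.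
have n0 : x * 2 + 1 != 0 by apply: lt0r_neq0; lra.
have {}hL : T ^+ 2 * (x * (x + 1) / 3 + (x + 1) ^+ 2 / (2 * x + 1)) <= L ^+ 2.
  apply: le_trans hL; rewrite SE le_eqVlt; apply/orP; left; apply/eqP.
  by field; apply: lt0r_neq0; lra.
have s3 : 0 < Num.sqrt 3 :> R by rewrite sqrtr_gt0.
have s3s : Num.sqrt 3 ^+ 2 = 3 :> R by rewrite sqr_sqrtr.
have := le_trans (length_bound_square k1 (pi_gt_lower R) s3 s3s) hL.
set b := _ + _; have b0 : 0 <= b.
  have x0 : 0 <= x by apply: le_trans k1.
  have pn := ltW (pi_gt0 R); have tn := ltW s3.
  by rewrite /b !addr_ge0// ?mulr_ge0// ?invr_ge0 ?mulr_ge0.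
by rewrite ler_sqr ?nnegrE// ltW.
Qed.
End LowerBound.

(** * Integrals over a period *)

Section PeriodIntegral.
Variable R : realType.
Local Notation leb := (@lebesgue_measure R).
Local Notation T := (2 * pi : R).
Implicit Types (f g F : R -> R).

Definition pint f : R := \int[leb]_(t in `[0, T]) f t.

Lemma continuous_itv_integrable f a b : continuous f ->
  leb.-integrable `[a, b] (EFin \o f).
Proof.
move=> fc; apply: continuous_compact_integrable; first exact: segment_compact.
exact: continuous_subspaceT.
Qed.

Lemma pint_bndo f : continuous f -> \int[leb]_(t in `[0, T[) f t = pint f.
Proof.
move=> fc; rewrite /pint -Rintegral_itv_bndo_bndc//.
by apply: integrableS (continuous_itv_integrable 0 T fc) => // t/=; rewrite !in_itv/=; lra.
Qed.

Lemma eq_pint f g : f =1 g -> pint f = pint g.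
Proof. by move=> fg; apply: eq_Rintegral => t _. Qed.

Lemma pintD f g : continuous f -> continuous g ->
  pint (fun t => f t + g t) = pint f + pint g.
Proof. by move=> fc gc; apply: RintegralD => //; exact: continuous_itv_integrable. Qed.

Lemma pintB f g : continuous f -> continuous g ->
  pint (fun t => f t - g t) = pint f - pint g.
Proof. by move=> fc gc; apply: RintegralB => //; exact: continuous_itv_integrable. Qed.

Lemma pintZ (c : R) f : continuous f -> pint (fun t => c * f t) = c * pint f.
Proof. by move=> fc; apply: RintegralZl => //; exact: continuous_itv_integrable. Qed.

Lemma pint_cst (c : R) : pint (fun=> c) = T * c.
Proof.
rewrite /pint [RHS]mulrC; transitivity (c * fine (leb `[0, T])); first exact: Rintegral_cst.
by rewrite lebesgue_measure_itv/= lte_fin twopi_gt0 oppr0 adde0.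
Qed.

Lemma le_pint f g : continuous f -> continuous g ->
  (forall t, f t <= g t) -> pint f <= pint g.
Proof. by move=> fc gc fg; apply: le_Rintegral => //; exact: continuous_itv_integrable. Qed.

Lemma pint_deriv F f : continuous f -> (forall t : R, is_derive t 1 F (f t)) ->
  F T = F 0 -> pint f = 0.
Proof.
move=> fc Ff FT; rewrite /pint /Rintegral.
have dF (t : R) : derivable F t 1 by case: (Ff t).
have cF : continuous F by move=> t; exact: (der_cont (Ff t)).
rewrite (@continuous_FTC2 _ f F 0 T) ?twopi_gt0//.
- by rewrite FT subee.
- exact: continuous_subspaceT.
- split=> [t _//||].
  + by apply: cvg_at_right_filter; exact: cF.
  + by apply: cvg_at_left_filter; exact: cF.
- by move=> t _; exact: (der_val (Ff t)).
Qed.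

(** Translate the domain to [h, T + h], cut it at T and move the piece beyond T back by one
    period. *)
Lemma pint_shift f (h : R) : continuous f -> (forall t, f (t + T) = f t) ->
  0 <= h <= T -> pint (fun t => f (t + h)) = pint f.
Proof.
move=> fc fT h0.
have fi a b : leb.-integrable `[a, b] (EFin \o f) by exact: continuous_itv_integrable.
have sub c a b : a <= b -> \int[leb]_(t in `[a, b]) f (t + c) = \int[leb]_(t in `[a + c, b + c]) f t.
  move=> ab; rewrite /Rintegral; congr fine.
  have dE : derive1 (fun t : R => t + c) = fun=> 1.
    apply/funext => t; have := derD (der_id t) (der_cst t c).
    by move=> /der_val ->; rewrite addr0.
  have dt (t : R) : derivable (fun t : R => t + c) t 1.
    by case: (derD (der_id t) (der_cst t c)).
  have ct : continuous (fun t : R => t + c).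
    by move=> t; exact: (der_cont (derD (der_id t) (der_cst t c))).
  rewrite (@integration_by_substitution_increasing _ (fun t => t + c) f a b)//.
  - by apply: eq_integral => t _; rewrite dE /= !fctE mulr1.
  - by move=> x y _ _; rewrite ltrD2r.
  - by move=> x _; rewrite dE; exact: cst_continuous.
  - by rewrite dE; exact: is_cvg_cst.
  - by rewrite dE; exact: is_cvg_cst.
  - split=> [t _//||].
    + by apply: cvg_at_right_filter; exact: ct.
    + by apply: cvg_at_left_filter; exact: ct.
  - exact: continuous_subspaceT.
rewrite /pint sub ?ltW ?twopi_gt0// add0r.
rewrite (@Rintegral_itv_split _ f 0 h T) ?(andP h0).1 ?(andP h0).2//; try lra.
rewrite (@Rintegral_itv_split _ f h T (T + h))//; try lra.
rewrite addrC; congr (_ + _).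
rewrite -{1}[T]add0r [T + h]addrC -sub//; last lra.
by apply: eq_Rintegral => t _; rewrite fT.
Qed.

End PeriodIntegral.

(** * Averages of functions of sin (n theta) ^+ 2 *)

Section Cont01.
Variable R : realType.
Implicit Types (f g : R -> R) (c s : R).

(** Continuity is asked only on [0, 1], where sin (n theta) ^ 2 takes its values: the integrands may
    have poles to the right of 1. *)
Definition cont01 f := forall s, 0 <= s <= 1 -> {for s, continuous f}.

Lemma cont01_cst c : cont01 (fun=> c).
Proof. by move=> s _; exact: cst_continuous. Qed.

Lemma cont01_id : cont01 (fun s => s).
Proof. by move=> s _; exact: cvg_id. Qed.

Lemma cont01D f g : cont01 f -> cont01 g -> cont01 (fun s => f s + g s).
Proof. by move=> fc gc s s01; apply: cvgD; [exact: fc|exact: gc]. Qed.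

Lemma cont01B f g : cont01 f -> cont01 g -> cont01 (fun s => f s - g s).
Proof. by move=> fc gc s s01; apply: cvgB; [exact: fc|exact: gc]. Qed.

Lemma cont01M f g : cont01 f -> cont01 g -> cont01 (fun s => f s * g s).
Proof. by move=> fc gc s s01; apply: cvgM; [exact: fc|exact: gc]. Qed.

Lemma cont01X f j : cont01 f -> cont01 (fun s => f s ^+ j).
Proof.
move=> fc; elim: j => [|j IH]; first exact: cont01_cst.
by rewrite (_ : (fun s => _) = fun s => f s * f s ^+ j); [exact: cont01M|apply/funext => s; rewrite exprS].
Qed.

Lemma cont01V f : (forall s, 0 <= s <= 1 -> f s != 0) -> cont01 f -> cont01 (fun s => (f s)^-1).
Proof. by move=> f0 fc s s01; apply: cvgV; [exact: f0|exact: fc]. Qed.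

Lemma cont01_sqrt f : cont01 f -> cont01 (fun s => Num.sqrt (f s)).
Proof.
by move=> fc s s01; apply: continuous_comp; [exact: fc|exact: sqrt_continuous].
Qed.

End Cont01.

Section Average.
Variables (R : realType) (n : nat).
Hypothesis n_gt0 : (0 < n)%N.
Implicit Types (f g h Q r : R -> R) (c s t x : R).
Local Notation T := (2 * pi : R).

Definition sqsin t : R := sin (n%:R * t) ^+ 2.
(** Integration against the arcsine law on [0, 1], whatever the value of n > 0. *)
Definition avg f : R := T^-1 * pint (fun t => f (sqsin t)).

Lemma sqsin01 t : 0 <= sqsin t <= 1.
Proof. by rewrite sqr_ge0/= /sqsin sin2cos2; have := sqr_ge0 (cos (n%:R * t)); lra. Qed.

Lemma der_sinn t : is_derive t 1 (fun t : R => sin (n%:R * t)) (n%:R * cos (n%:R * t)).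
Proof. by have := der_sin (derZ n%:R (der_id t)); rewrite mulr1. Qed.

Lemma der_cosn t : is_derive t 1 (fun t : R => cos (n%:R * t)) (- (n%:R * sin (n%:R * t))).
Proof. by have := der_cos (derZ n%:R (der_id t)); rewrite mulr1. Qed.

Lemma der_sinnX j t : is_derive t 1 (fun t : R => sin (n%:R * t) ^+ j)
  (n%:R * cos (n%:R * t) * (j%:R * sin (n%:R * t) ^+ j.-1)).
Proof.
have d := @is_derive1_comp _ (fun y : R => y ^+ j) _ _ _ _ (der_pow (sin (n%:R * t)) j) (der_sinn t).
by rewrite mulrC; exact: d.
Qed.

Lemma cont01_sqsin f : cont01 f -> continuous (fun t => f (sqsin t)).
Proof.
move=> fc t; apply: continuous_comp; last by apply: fc; exact: sqsin01.
have := der_sinn t => d; apply: (der_cont (derM d d)).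
Qed.

Lemma eq_avg f g : (forall s, 0 <= s <= 1 -> f s = g s) -> avg f = avg g.
Proof. by move=> fg; congr (_ * _); apply: eq_pint => t; apply: fg; exact: sqsin01. Qed.

Lemma le_avg f g : cont01 f -> cont01 g ->
  (forall s, 0 <= s <= 1 -> f s <= g s) -> avg f <= avg g.
Proof.
move=> fc gc fg; rewrite ler_pM2l ?invr_gt0 ?twopi_gt0//.
by apply: le_pint => [||t]; [exact: cont01_sqsin..|apply: fg; exact: sqsin01].
Qed.

Lemma avgD f g : cont01 f -> cont01 g -> avg (fun s => f s + g s) = avg f + avg g.
Proof. by move=> fc gc; rewrite /avg -mulrDr -pintD//; exact: cont01_sqsin. Qed.

Lemma avgB f g : cont01 f -> cont01 g -> avg (fun s => f s - g s) = avg f - avg g.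
Proof. by move=> fc gc; rewrite /avg -mulrBr -pintB//; exact: cont01_sqsin. Qed.

Lemma avgZ c f : cont01 f -> avg (fun s => c * f s) = c * avg f.
Proof. by move=> fc; rewrite /avg pintZ; [exact: mulrCA|exact: cont01_sqsin]. Qed.

Lemma avg_cst c : avg (fun=> c) = c.
Proof. by rewrite /avg pint_cst mulKf// gt_eqF// twopi_gt0. Qed.

Lemma sinnT : sin (n%:R * T) = 0 :> R.
Proof. by rewrite -[n%:R * T]add0r sinD2piMn sin0. Qed.

(** Wallis recursion: up to the factor - n, the difference of the two integrands is the derivative
    of the periodic function sin ^ (2 j + 1) cos. *)
Lemma avg_powS j : (2 * j + 2)%:R * avg (fun s => s ^+ j.+1) =
  (2 * j + 1)%:R * avg (fun s => s ^+ j).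
Proof.
have cX i : cont01 (fun s : R => s ^+ i) by exact/cont01X/cont01_id.
rewrite -!avgZ//; apply/eqP; rewrite -subr_eq0 -avgB; try by apply: cont01M => //; exact: cont01_cst.
rewrite /avg mulf_eq0; apply/orP; right; apply/eqP.
pose F t : R := sin (n%:R * t) ^+ (2 * j).+1 * cos (n%:R * t).
have n0 : n%:R != 0 :> R by rewrite pnatr_eq0 -lt0n.
pose G := fun s : R => (2 * j + 2)%:R * s ^+ j.+1 - (2 * j + 1)%:R * s ^+ j.
have Gc : cont01 G.
  by apply: cont01B; apply: cont01M => //; exact: cont01_cst.
have Gc' : continuous (fun t => G (sqsin t)) by exact: cont01_sqsin.
rewrite -[pint _](mulKf (x := - n%:R)) ?oppr_eq0// -pintZ//.
have dF t : is_derive t 1 F (- n%:R * G (sqsin t)).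
  apply: der_ext (derM (der_sinnX (2 * j).+1 t) (der_cosn t)) => //.
  rewrite /G /sqsin -!exprM mulnS !exprS.
  have := cos2Dsin2 (n%:R * t); set u := cos _; set v := sin _ => h.
  transitivity (n%:R * v ^+ (2 * j) * ((2 * j).+1%:R * u ^+ 2 - v ^+ 2)); first by rewrite !exprS; ring.
  have -> : u ^+ 2 = 1 - v ^+ 2 by rewrite -h; ring.
  by rewrite !natrD -(natr1 (2 * j)); ring.
rewrite (pint_deriv _ dF) ?mulr0//.
- by move=> t; apply: cvgM; [exact: cvg_cst|exact: Gc'].
- by rewrite /F sinnT mulr0 sin0 !expr0n/= !mul0r.
Qed.

Lemma avg_pow0 : avg (fun s => s ^+ 0) = 1.
Proof. by rewrite -[RHS](avg_cst 1); apply: eq_avg => s _; rewrite expr0. Qed.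

Lemma avg_pow1 : avg (fun s => s ^+ 1) = 1 / 2.
Proof. by have := avg_powS 0; rewrite avg_pow0/=; lra. Qed.

Lemma avg_pow2 : avg (fun s => s ^+ 2) = 3 / 8.
Proof. by have := avg_powS 1; rewrite avg_pow1/=; lra. Qed.

Lemma avg_pow3 : avg (fun s => s ^+ 3) = 5 / 16.
Proof. by have := avg_powS 2; rewrite avg_pow2/=; lra. Qed.

Lemma avg_pow4 : avg (fun s => s ^+ 4) = 35 / 128.
Proof. by have := avg_powS 3; rewrite avg_pow3/=; lra. Qed.

Lemma avg_pow5 : avg (fun s => s ^+ 5) = 63 / 256.
Proof. by have := avg_powS 4; rewrite avg_pow4/=; lra. Qed.

Lemma avg_poly5 (c0 c1 c2 c3 c4 c5 : R) :
  avg (fun s => c0 + c1 * s + c2 * s ^+ 2 + c3 * s ^+ 3 + c4 * s ^+ 4 + c5 * s ^+ 5) =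
  c0 + c1 / 2 + c2 * (3 / 8) + c3 * (5 / 16) + c4 * (35 / 128) + c5 * (63 / 256).
Proof.
have cX c j : cont01 (fun s : R => c * s ^+ j).
  by apply: cont01M; [exact: cont01_cst|exact/cont01X/cont01_id].
have h0 : cont01 (fun _ : R => c0) by exact: cont01_cst.
have h1 := cont01D h0 (cX c1 1%N); have h2 := cont01D h1 (cX c2 2%N).
have h3 := cont01D h2 (cX c3 3%N); have h4 := cont01D h3 (cX c4 4%N).
rewrite (avgD h4 (cX c5 5%N)) (avgD h3 (cX c4 4%N)) (avgD h2 (cX c3 3%N)) (avgD h1 (cX c2 2%N)).
rewrite (avgD h0 (cX c1 1%N)).
have cX' i : cont01 (fun s : R => s ^+ i) by exact/cont01X/cont01_id.
rewrite avg_cst !avgZ//.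
by rewrite avg_pow1 avg_pow2 avg_pow3 avg_pow4 avg_pow5; ring.
Qed.

(** Comparing Q with Q0 r ^ 2 compares the square roots in the same direction. In the applications
    the two agree at s0 and their order changes there, as does the sign of s - s0, so both sides of
    s0 contribute with one sign. *)
Lemma avg_weighted_sqrt_ge Q r s0 (Q0 : R) : cont01 Q -> cont01 r -> 0 <= Q0 ->
  (forall s, 0 <= s <= 1 -> 0 <= r s) ->
  (forall s, 0 <= s <= 1 -> 0 <= Q s) ->
  (forall s, 0 <= s <= 1 -> 0 <= (s - s0) * (Q s - Q0 * r s ^+ 2)) ->
  Num.sqrt Q0 * avg (fun s => (s - s0) * r s) <= avg (fun s => (s - s0) * Num.sqrt (Q s)).
Proof.
move=> cQ cr Q00 r0 Qp H.
have cs : cont01 (fun s : R => s - s0) by apply: cont01B; [exact: cont01_id|exact: cont01_cst].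
rewrite -avgZ; last exact: cont01M.
apply: le_avg.
- by apply: cont01M; [exact: cont01_cst|exact: cont01M].
- by apply: cont01M => //; exact: cont01_sqrt.
move=> s s01; have h := H s s01; have rs := r0 s s01; have Qs := Qp s s01; move: h.
rewrite [Num.sqrt _ * (_ * r s)]mulrCA.
have E : Num.sqrt (Q0 * r s ^+ 2) = Num.sqrt Q0 * r s by rewrite sqrtrM// sqrtr_sqr ger0_norm.
rewrite -E; have [s1|s1|->] := ltgtP s s0; last by rewrite subrr !mul0r.
- rewrite nmulr_rge0 ?subr_lt0// subr_le0 => h.
  by rewrite ler_nM2l ?subr_lt0//; exact: ler_wsqrtr.
- rewrite pmulr_rge0 ?subr_gt0// subr_ge0 => h.
  by rewrite ler_pM2l ?subr_gt0//; exact: ler_wsqrtr.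
Qed.

Lemma avg_weighted_sqrt_le Q r s0 (Q0 : R) : cont01 Q -> cont01 r -> 0 <= Q0 ->
  (forall s, 0 <= s <= 1 -> 0 <= r s) ->
  (forall s, 0 <= s <= 1 -> 0 <= Q s) ->
  (forall s, 0 <= s <= 1 -> (s - s0) * (Q s - Q0 * r s ^+ 2) <= 0) ->
  avg (fun s => (s - s0) * Num.sqrt (Q s)) <= Num.sqrt Q0 * avg (fun s => (s - s0) * r s).
Proof.
move=> cQ cr Q00 r0 Qp H.
have cs : cont01 (fun s : R => s - s0) by apply: cont01B; [exact: cont01_id|exact: cont01_cst].
rewrite -avgZ; last exact: cont01M.
apply: le_avg.
- by apply: cont01M => //; exact: cont01_sqrt.
- by apply: cont01M; [exact: cont01_cst|exact: cont01M].
move=> s s01; have h := H s s01; have rs := r0 s s01; have Qs := Qp s s01; move: h.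
rewrite [Num.sqrt _ * (_ * r s)]mulrCA.
have E : Num.sqrt (Q0 * r s ^+ 2) = Num.sqrt Q0 * r s by rewrite sqrtrM// sqrtr_sqr ger0_norm.
rewrite -E; have [s1|s1|->] := ltgtP s s0; last by rewrite subrr !mul0r.
- rewrite nmulr_rle0 ?subr_lt0// subr_ge0 => h.
  by rewrite ler_nM2l ?subr_lt0//; exact: ler_wsqrtr.
- rewrite pmulr_rle0 ?subr_gt0// subr_le0 => h.
  by rewrite ler_pM2l ?subr_gt0//; exact: ler_wsqrtr.
Qed.

End Average.

Section Orthogonality.
Variables (R : realType) (n : nat) (w : R -> R).
Hypotheses (n_gt0 : (0 < n)%N) (w_cont : continuous w).
Hypothesis w_per : forall t, w (t + pi / n%:R) = w t.
Local Notation T := (2 * pi : R).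

Lemma continuous_cosn (m p : R) : continuous (fun t : R => cos (m * t - p)).
Proof. by move=> t; exact: (der_cont (der_cos (derB (derZ m (der_id t)) (der_cst t p)))). Qed.

Lemma continuous_sinn (m p : R) : continuous (fun t : R => sin (m * t - p)).
Proof. by move=> t; exact: (der_cont (der_sin (derB (derZ m (der_id t)) (der_cst t p)))). Qed.

Lemma periodic_twopi t : w (t + T) = w t.
Proof.
have h j : w (t + j%:R * (pi / n%:R)) = w t.
  elim: j => [|j IH]; first by rewrite mul0r addr0.
  by rewrite -IH -[RHS]w_per -(natr1 j); congr w; ring.
rewrite -(h (2 * n)%N) natrM; congr (w (t + _)); field.
by rewrite pnatr_eq0 -lt0n.
Qed.

(* Shifting by pi / n multiplies the pair (int cos w, int sin w) by a rotation
   of angle m pi / n, which has no nonzero fixed vector. *)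
Lemma pint_orthogonal (m : nat) (p : R) : (0 < m < 2 * n)%N ->
  pint (fun t => cos (m%:R * t - p) * w t) = 0.
Proof.
move=> /andP[m0 mn].
have n0 : n%:R != 0 :> R by rewrite pnatr_eq0 -lt0n.
have cc q : continuous (fun t : R => cos (m%:R * t - q) * w t).
  by move=> t; apply: cvgM; [exact: continuous_cosn|exact: w_cont].
have cs q : continuous (fun t : R => sin (m%:R * t - q) * w t).
  by move=> t; apply: cvgM; [exact: continuous_sinn|exact: w_cont].
pose h : R := pi / n%:R; have hb : 0 <= h <= T.
  rewrite divr_ge0 ?pi_ge0//= ler_pdivrMr ?ltr0n//.
  have := pi_gt0 R; have : (1 : R) <= n%:R by rewrite ler1n.
  by nra.
set c0 := pint (fun t => cos (m%:R * t - 0) * w t).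
set s0 := pint (fun t => sin (m%:R * t - 0) * w t).
have rot q : pint (fun t => cos (m%:R * t - q) * w t) = cos q * c0 + sin q * s0.
  rewrite -!pintZ// -pintD.
  - by apply: eq_pint => t; rewrite subr0 cosB; ring.
  - by move=> t; apply: cvgM; [exact: cvg_cst|exact: cc].
  - by move=> t; apply: cvgM; [exact: cvg_cst|exact: cs].
have shift q : cos q * c0 + sin q * s0 = cos (q - m%:R * h) * c0 + sin (q - m%:R * h) * s0.
  rewrite -!rot -[LHS](@pint_shift _ _ h)//; last first.
    move=> t; rewrite periodic_twopi; congr (_ * _).
    by rewrite -[RHS](cosD2piMn _ m); congr cos; ring.
  by apply: eq_pint => t; rewrite w_per; congr (cos _ * _); ring.
rewrite rot.
have := shift 0; have := shift (pi / 2).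
rewrite cos0 sin0 cos_pihalf sin_pihalf sub0r cosN sinN.
rewrite sinB cosB cos_pihalf sin_pihalf.
set C := cos _; set S := sin _ => e1 e2.
have CS : C ^+ 2 + S ^+ 2 = 1 by exact: cos2Dsin2.
(* The angle m pi / n lies strictly between 0 and 2 pi. *)
have C1 : C < 1.
  have -> : C = 1 - sin (m%:R * h / 2) ^+ 2 *+ 2.
    rewrite /C -cosN.
    have -> : - (m%:R * h) = - ((m%:R * h / 2) *+ 2) by rewrite mulr2n; field.
    by rewrite cosN cos_mulr2n cos2sin2 mulrnBl; ring.
  rewrite ltrBlDr ltrDl mulr2n.
  have : 0 < sin (m%:R * h / 2).
    apply: sin_gt0_pi; rewrite /h.
    have -> : m%:R * (pi / n%:R) / 2 = pi * (m%:R / (2 * n)%:R) :> R.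
      by rewrite natrM; field.
    rewrite mulr_gt0 ?pi_gt0 ?divr_gt0 ?ltr0n//=; last by rewrite muln_gt0.
    by rewrite gtr_pMr ?pi_gt0// ltr_pdivrMr ?ltr0n ?muln_gt0// mul1r ltr_nat.
  by move=> sp; rewrite addr_gt0// exprn_gt0.
(* By [CS], 2 - 2 C equals (1 - C) ^ 2 + S ^ 2, the determinant of the linear system [E1], [E2] for
   (c0, s0). *)
have D : (2 - 2 * C) != 0 by rewrite gt_eqF//; lra.
have E1 : (1 - C) * c0 + S * s0 = 0 by lra.
have E2 : (1 - C) * s0 - S * c0 = 0 by lra.
have c00 : c0 = 0.
  apply: (mulfI D); rewrite mulr0.
  transitivity ((1 - C) * ((1 - C) * c0 + S * s0) - S * ((1 - C) * s0 - S * c0)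
    + (1 - (C ^+ 2 + S ^+ 2)) * c0); first ring.
  by rewrite E1 E2 CS; ring.
have s00 : s0 = 0.
  apply: (mulfI D); rewrite mulr0.
  transitivity (S * ((1 - C) * c0 + S * s0) + (1 - C) * ((1 - C) * s0 - S * c0)
    + (1 - (C ^+ 2 + S ^+ 2)) * s0); first ring.
  by rewrite E1 E2 CS; ring.
by rewrite c00 s00; ring.
Qed.

End Orthogonality.

(** * The Poisson kernel and averages of simple poles *)

Section PoissonKernel.
Variables (R : realType) (n : nat) (x : R).
Hypotheses (n_gt0 : (0 < n)%N) (x_gt0 : 0 < x) (x_lt1 : x < 1).
Local Notation T := (2 * pi : R).

(** The squared modulus of 1 + x exp (2 i n t), whose inverse is a Poisson kernel up to a factor.
    The [- 0] matches the form of [continuous_cosn]. *)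
Let ker (t : R) : R := 1 + x ^+ 2 + 2 * x * cos (2 * n%:R * t - 0).

Let ker_ge t : (1 - x) ^+ 2 <= ker t.
Proof.
rewrite /ker; have := cos_geN1 (2 * n%:R * t - 0); set c := cos _ => c1.
have : 0 <= x * (1 + c) by rewrite mulr_ge0 ?(ltW x_gt0)//; lra.
lra.
Qed.

Let ker_gt0 t : 0 < ker t.
Proof. by apply: lt_le_trans (ker_ge t); apply: exprn_gt0; rewrite subr_gt0. Qed.

Let cpow (j : nat) (t : R) : R := cos ((j * (2 * n))%:R * t - 0).

Let cpow_cont j : continuous (cpow j).
Proof. exact: continuous_cosn. Qed.

Let ker_cont : continuous ker.
Proof.
move=> t; apply: cvgD; first exact: cvg_cst.
by apply: cvgM; [exact: cvg_cst|exact: continuous_cosn].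
Qed.

Let I (j : nat) : R := pint (fun t => cpow j t / ker t).

Let term_cont j : continuous (fun t => cpow j t / ker t).
Proof.
move=> t; apply: cvgM; first exact: cpow_cont.
by apply: cvgV; [rewrite gt_eqF|exact: ker_cont].
Qed.

Let pint_cpow j : pint (cpow j.+1) = 0.
Proof.
have N0 : (0 < j.+1 * (2 * n))%N by rewrite !muln_gt0.
have w1 : continuous (fun _ : R => 1 : R) by move=> t; exact: cvg_cst.
have m0 : (0 < j.+1 * (2 * n) < 2 * (j.+1 * (2 * n)))%N by rewrite N0/= ltn_Pmull.
have := @pint_orthogonal R (j.+1 * (2 * n)) (fun _ : R => 1) N0 w1 (fun=> erefl _) _ 0 m0.
by move=> <-; apply: eq_pint => t; rewrite mulr1.
Qed.

(** This recurrence and the next integrate the identity cos (2 n j t) = ker * (cos (2 n j t) / ker),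
    with the products of cosines turned into sums. *)
Let rec0 : (1 + x ^+ 2) * I 0 + 2 * x * I 1 = T.
Proof.
rewrite /I -!pintZ// -pintD.
- rewrite -[RHS]mulr1 -(pint_cst 1); apply: eq_pint => t.
  have := ker_gt0 t; rewrite /cpow /ker mul0n mul0r subrr cos0 mul1n natrM => k0.
  by field; exact: lt0r_neq0.
- by move=> t; apply: cvgM; [exact: cvg_cst|exact: term_cont].
- by move=> t; apply: cvgM; [exact: cvg_cst|exact: term_cont].
Qed.

Let recS j : (1 + x ^+ 2) * I j.+1 + x * (I j.+2 + I j) = 0.
Proof.
have cZ c i : continuous (fun t => c * (cpow i t / ker t)).
  by move=> t; apply: cvgM; [exact: cvg_cst|exact: term_cont].
rewrite mulrDr /I -!pintZ// -pintD// -pintD//; last first.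
  by move=> t; apply: cvgD; exact: cZ.
rewrite -(pint_cpow j); apply: eq_pint => t.
have := ker_gt0 t; rewrite /cpow /ker !subr0 => k0.
have -> : (j.+2 * (2 * n))%:R * t = (j.+1 * (2 * n))%:R * t + 2 * n%:R * t :> R.
  by rewrite !natrM -(natr1 j.+1); ring.
have -> : (j * (2 * n))%:R * t = (j.+1 * (2 * n))%:R * t - 2 * n%:R * t :> R.
  by rewrite !natrM -(natr1 j); ring.
by rewrite cosB cosD; field; exact: lt0r_neq0.
Qed.

Let I_bound j : `|I j| <= T / (1 - x) ^+ 2.
Proof.
have xlt1 := x_lt1.
have x1 : 0 < (1 - x) ^+ 2 by apply: exprn_gt0; lra.
have cB (c : R) : continuous (fun _ : R => c) by move=> t; exact: cvg_cst.
have b t : `|cpow j t / ker t| <= ((1 - x) ^+ 2)^-1.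
  rewrite normrM normfV (ger0_norm (ltW (ker_gt0 t))) -[leRHS]mul1r.
  rewrite ler_pM// ?invr_ge0 ?(ltW (ker_gt0 t))//; last by rewrite lef_pV2 ?posrE// ker_gt0.
  by rewrite ler_norml cos_geN1 cos_le1.
have -> : T / (1 - x) ^+ 2 = pint (fun=> ((1 - x) ^+ 2)^-1) by rewrite pint_cst.
rewrite ler_norml.
have -> : - pint (fun=> ((1 - x) ^+ 2)^-1) = pint (fun=> - ((1 - x) ^+ 2)^-1).
  by rewrite !pint_cst mulrN.
apply/andP; split; apply: le_pint => // t; have := b t; rewrite ler_norml; lra.
Qed.

(* The quantities I (j + 1) + x I j are multiplied by - 1 / x at each step and
   stay bounded, hence vanish. *)
Let I1 : I 1 = - x * I 0.
Proof.
have xlt1 := x_lt1; have xgt0 := x_gt0.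
pose u j := I j.+1 + x * I j.
have uS j : u j = - x * u j.+1 by rewrite /u; have := recS j; lra.
have uE j : u 0%N = (- x) ^+ j * u j.
  by elim: j => [|j IH]; [rewrite expr0 mul1r|rewrite IH (uS j) exprSr mulrA].
pose C := 2 * (T / (1 - x) ^+ 2).
have u0 : u 0%N = 0.
  apply/eqP; rewrite -normr_le0.
  have h j : `|u 0%N| <= C * x ^+ j.
    rewrite (uE j) normrM normrX normrN (@gtr0_norm _ x); last lra.
    rewrite mulrC ler_wpM2r ?exprn_ge0//; first lra.
    rewrite (le_trans (ler_normD _ _))// /C mulr2n mulrDl mul1r lerD ?I_bound//.
    rewrite normrM gtr0_norm; last lra.
    by apply: le_trans (I_bound j); rewrite ler_piMl//; lra.
  have : C * x ^+ j @[j --> \oo] --> C * 0.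
    by apply: cvgM; [exact: cvg_cst|apply: cvg_expr; rewrite gtr0_norm; lra].
  by rewrite mulr0 => /cvgr_to_ge; apply; apply: nearW => j; exact: h.
by move: u0; rewrite /u; lra.
Qed.

(** Since cos (2 n t) = 1 - 2 s, the kernel is 4 x times the distance from s to the pole (1 + x) ^ 2
    / (4 x). *)
Lemma avg_pole : avg n (fun s => ((1 + x) ^+ 2 / (4 * x) - s)^-1) = 4 * x / (1 - x ^+ 2).
Proof.
have xlt1 := x_lt1; have xgt0 := x_gt0.
have x2 : 1 - x ^+ 2 != 0 by rewrite gt_eqF//; nra.
have I0 : I 0 = T / (1 - x ^+ 2).
  by apply: (mulfI x2); rewrite [RHS]mulrCA divff// mulr1 -rec0 I1; ring.
have x0 : x != 0 by rewrite gt_eqF//; lra.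
rewrite /avg; transitivity (T^-1 * (4 * x * I 0)).
  congr (_ * _); rewrite /I -pintZ//; apply: eq_pint => t.
  have := ker_gt0 t; rewrite /cpow /ker /sqsin mul0n mul0r subrr cos0.
  have -> : 2 * n%:R * t - 0 = (n%:R * t) *+ 2 by rewrite mulr2n; ring.
  rewrite cos_mulr2n cos2sin2; set s := sin _ ^+ 2 => k0.
  have k1 : 1 + x ^+ 2 + 2 * x * ((1 - s) *+ 2 - 1) = 4 * x * ((1 + x) ^+ 2 / (4 * x) - s).
    by field.
  rewrite k1 in k0 *; move: k0; rewrite pmulr_rgt0; last lra.
  by move=> k0; set b := _ - s in k0 *; field; rewrite x0 lt0r_neq0.
rewrite I0; have : T != 0 by rewrite gt_eqF// twopi_gt0.
by set u : R := 2 * pi => T0; field; rewrite T0 x2.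
Qed.

End PoissonKernel.

(** * Comparison functions with two poles, for k = 1 *)

Section SignCircleTwo.
Variables (R : realType) (n : nat).
Hypothesis n_gt0 : (0 < n)%N.
Implicit Types (s c e : R).

Let pole1 s : R := (36 - 35 * s)^-1.
Let pole2 s : R := (361 - 312 * s)^-1.

Let pole1E s : 0 <= s <= 1 -> (36 - 35 * s) * pole1 s = 1 /\ 0 < pole1 s <= 1.
Proof.
move=> s01; have p : 0 < 36 - 35 * s by lra.
by rewrite mulfV ?gt_eqF// invr_gt0 p invf_le1//; split=> //; lra.
Qed.

Let pole2E s : 0 <= s <= 1 -> (361 - 312 * s) * pole2 s = 1 /\ 0 < pole2 s <= 1 / 49.
Proof.
move=> s01; have p : 0 < 361 - 312 * s by lra.
by rewrite mulfV ?gt_eqF// invr_gt0 p div1r lef_pV2 ?posrE//; split=> //; lra.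
Qed.

Let pole1_cont : cont01 pole1.
Proof.
apply: cont01V => [s s01|]; first by apply: lt0r_neq0; lra.
apply: cont01B; first exact: cont01_cst.
by apply: cont01M; [exact: cont01_cst|exact: cont01_id].
Qed.

Let pole2_cont : cont01 pole2.
Proof.
apply: cont01V => [s s01|]; first by apply: lt0r_neq0; lra.
apply: cont01B; first exact: cont01_cst.
by apply: cont01M; [exact: cont01_cst|exact: cont01_id].
Qed.

Let avg_pole1 : avg n pole1 = 1 / 6.
Proof.
have h5 : (0 : R) < 5 / 7 by lra.
have h7 : (5 / 7 : R) < 1 by lra.
transitivity (35^-1 * avg n (fun s => ((1 + 5 / 7 : R) ^+ 2 / (4 * (5 / 7)) - s)^-1)).
  rewrite -avgZ//; last first.
    apply: cont01V => [s s01|]; first by apply: lt0r_neq0; lra.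
    by apply: cont01B; [exact: cont01_cst|exact: cont01_id].
  apply: eq_avg => s s01; rewrite -invfM; congr (_^-1); by field.
by rewrite (avg_pole n_gt0 h5 h7); field.
Qed.

Let avg_pole2 : avg n pole2 = 1 / 133.
Proof.
have h5 : (0 : R) < 6 / 13 by lra.
have h7 : (6 / 13 : R) < 1 by lra.
transitivity (312^-1 * avg n (fun s => ((1 + 6 / 13 : R) ^+ 2 / (4 * (6 / 13)) - s)^-1)).
  rewrite -avgZ//; last first.
    apply: cont01V => [s s01|]; first by apply: lt0r_neq0; lra.
    by apply: cont01B; [exact: cont01_cst|exact: cont01_id].
  apply: eq_avg => s s01; rewrite -invfM; congr (_^-1); by field.
by rewrite (avg_pole n_gt0 h5 h7); field.
Qed.

(* The poles 36 / 35 and 361 / 312 are (1 + x) ^+ 2 / (4 x) for x = 5 / 7 and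
   x = 6 / 13, so that avg_pole gives the exact average. *)
Definition two_pole s0 c e1 e2 s : R :=
  1 + (s - s0) * (c + e1 * (36 - 35 * s)^-1 + e2 * (361 - 312 * s)^-1).

Lemma cont01_two_pole s0 c e1 e2 : cont01 (two_pole s0 c e1 e2).
Proof.
apply: cont01D; first exact: cont01_cst.
apply: cont01M; first by apply: cont01B; [exact: cont01_id|exact: cont01_cst].
apply: cont01D; last by apply: cont01M; [exact: cont01_cst|exact: pole2_cont].
apply: cont01D; first exact: cont01_cst.
by apply: cont01M; [exact: cont01_cst|exact: pole1_cont].
Qed.

(** Polynomial division by each denominator reduces the integrand to a quadratic polynomial plus
    multiples of the two poles, all with known averages. *)
Lemma avg_two_pole s0 c e1 e2 :
  avg n (fun s => (s - s0) * two_pole s0 c e1 e2 s) =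
  1 / 2 - s0 + c * (3 / 8 - s0 + s0 ^+ 2)
  + e1 / 35 * (36 / 35 - 1 / 2 - 2 * (36 / 35 - s0) + (36 / 35 - s0) ^+ 2 * (35 / 6))
  + e2 / 312 * (361 / 312 - 1 / 2 - 2 * (361 / 312 - s0) + (361 / 312 - s0) ^+ 2 * (312 / 133)).
Proof.
pose a0 := - s0 + c * s0 ^+ 2 + e1 / 35 * (2 * s0 - 36 / 35) + e2 / 312 * (2 * s0 - 361 / 312).
pose a1 := 1 - 2 * c * s0 - e1 / 35 - e2 / 312.
pose P s := a0 + a1 * s + c * s ^+ 2 + 0 * s ^+ 3 + 0 * s ^+ 4 + 0 * s ^+ 5.
have cX i : cont01 (fun s : R => s ^+ i) by exact/cont01X/cont01_id.
have cP : cont01 P.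
  do ![apply: cont01D; last by apply: cont01M; [exact: cont01_cst|exact: cX]].
  apply: cont01D; first exact: cont01_cst.
  by apply: cont01M; [exact: cont01_cst|exact: cont01_id].
transitivity (avg n (fun s => P s + (e1 * (36 / 35 - s0) ^+ 2) * pole1 s
    + (e2 * (361 / 312 - s0) ^+ 2) * pole2 s)).
  apply: eq_avg => s s01; have [h1 _] := pole1E s01; have [h2 _] := pole2E s01.
  rewrite /two_pole -/(pole1 s) -/(pole2 s) /P /a0 /a1.
  have E1 : (s - s0) ^+ 2 * pole1 s = 1 / 35 * (36 / 35 - s - 2 * (36 / 35 - s0))
      + (36 / 35 - s0) ^+ 2 * pole1 s.
    transitivity ((s - s0) ^+ 2 * pole1 s +
      ((36 / 35 - s) / 35 - 2 / 35 * (36 / 35 - s0)) * (1 - (36 - 35 * s) * pole1 s)).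
      by rewrite h1; ring.
    by field.
  have E2 : (s - s0) ^+ 2 * pole2 s = 1 / 312 * (361 / 312 - s - 2 * (361 / 312 - s0))
      + (361 / 312 - s0) ^+ 2 * pole2 s.
    transitivity ((s - s0) ^+ 2 * pole2 s +
      ((361 / 312 - s) / 312 - 2 / 312 * (361 / 312 - s0)) * (1 - (361 - 312 * s) * pole2 s)).
      by rewrite h2; ring.
    by field.
  transitivity (s - s0 + c * (s - s0) ^+ 2 + e1 * ((s - s0) ^+ 2 * pole1 s)
     + e2 * ((s - s0) ^+ 2 * pole2 s)); first ring.
  by rewrite E1 E2; field.
have cZ1 (a : R) : cont01 (fun s => a * pole1 s) by apply: cont01M => //; exact: cont01_cst.
have cZ2 (a : R) : cont01 (fun s => a * pole2 s) by apply: cont01M => //; exact: cont01_cst.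
rewrite avgD//; last exact: cont01D.
rewrite avgD// !avgZ// avg_pole1 avg_pole2 avg_poly5// /a0 /a1.
by field.
Qed.

Lemma two_pole_ge0 s0 c e1 e2 s : 2 / 5 <= s0 -> -1 / 9 <= c <= 0 -> -2 / 5 <= e1 <= 0 ->
  -44 <= e2 <= 0 -> 0 <= s <= 1 -> 0 <= two_pole s0 c e1 e2 s.
Proof.
move=> hs0 hc he1 he2 s01; have [_ h1] := pole1E s01; have [_ h2] := pole2E s01.
rewrite /two_pole -/(pole1 s) -/(pole2 s).
(* To the right of s0 one has s - s0 <= 3 / 5, and the bracket is at least - (1 / 9 + 2 / 5 + 44 /
   49) > - 5 / 3. To the left, both factors are nonpositive. *)
have k1 : - (2 / 5) <= e1 * pole1 s <= 0 by apply/andP; split; nra.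
have k2 : - (44 / 49) <= e2 * pole2 s <= 0 by apply/andP; split; nra.
by nra.
Qed.

End SignCircleTwo.

(** * Sign of the balance integral *)

(* The squared speed of short_curve at a point with sin ((k + 1) theta) ^+ 2 = s,
   where A = a ^+ 2. *)
Definition speed_sq (R : realType) (k : nat) (A s : R) : R :=
  (k%:R + 1) ^+ 2 * A * (1 - s) / (1 - A * s)
  + (k%:R + 1) * (2 * k%:R + 1) / 6 * (1 - A * s).

Section SpeedSquare.
Variables (R : realType) (k : nat).
Implicit Types (A s : R).

Lemma one_sub_gt0 A s : 0 <= A < 1 -> 0 <= s <= 1 -> 0 < 1 - A * s.
Proof. by move=> hA hs; nra. Qed.

Lemma speed_sq_gt0 A s : 0 <= A < 1 -> 0 <= s <= 1 -> 0 < speed_sq k A s.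
Proof.
move=> hA hs; have h1 := one_sub_gt0 hA hs; have k0 : 0 <= k%:R :> R by [].
rewrite /speed_sq ltr_wpDl//.
  rewrite divr_ge0 ?(ltW h1)// mulr_ge0//; last lra.
  by rewrite mulr_ge0 ?sqr_ge0//; lra.
by rewrite mulr_gt0// divr_gt0// mulr_gt0//; lra.
Qed.

Lemma cont01_speed_sq A : 0 <= A < 1 -> cont01 (speed_sq k A).
Proof.
move=> hA; have c1 : cont01 (fun s => 1 - A * s).
  apply: cont01B; first exact: cont01_cst.
  by apply: cont01M; [exact: cont01_cst|exact: cont01_id].
apply: cont01D; last by apply: cont01M; [exact: cont01_cst|exact: c1].
apply: cont01M; last by apply: cont01V => // s hs; rewrite gt_eqF ?one_sub_gt0.
apply: cont01M; first exact: cont01_cst.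
by apply: cont01B; [exact: cont01_cst|exact: cont01_id].
Qed.

End SpeedSquare.

Section SignCircleTwoEndpoints.
Variables (R : realType) (n : nat).
Hypothesis n_gt0 : (0 < n)%N.
Implicit Types (s c e A : R).

(** The numerator of (speed_sq 1 A s - Q0 r ^ 2) / (s - s0), where s0 = 1 / (3 A), Q0 = 6 A - 4 / 3
    is the squared speed at s0, and r is [two_pole]. The division is exact because r = 1 at s0. *)
Definition sign_poly A c e1 e2 s : R :=
  let D1 := 36 - 35 * s in let D2 := 361 - 312 * s in
  let rD := c * D1 * D2 + e1 * D2 + e2 * D1 in
  A * (A * s + 6 * A - 7) * (D1 * D2) ^+ 2
  - (6 * A - 4 / 3) * (1 - A * s) * rD * (2 * D1 * D2 + (s - (3 * A)^-1) * rD).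

Lemma sign_polyE A c e1 e2 s : 0 < A < 1 -> 0 <= s <= 1 ->
  (s - (3 * A)^-1) * (speed_sq 1 A s
    - (6 * A - 4 / 3) * two_pole (3 * A)^-1 c e1 e2 s ^+ 2) =
  (s - (3 * A)^-1) ^+ 2 * sign_poly A c e1 e2 s
    / ((1 - A * s) * ((36 - 35 * s) * (361 - 312 * s)) ^+ 2).
Proof.
move=> hA hs; have h1 : 0 < 1 - A * s by apply: one_sub_gt0 => //; lra.
have p1 : 36 - 35 * s != 0 by apply: lt0r_neq0; lra.
have p2 : 361 - 312 * s != 0 by apply: lt0r_neq0; lra.
have A0 : A != 0 by apply: lt0r_neq0; lra.
rewrite /sign_poly /two_pole /speed_sq; field.
by rewrite p1 p2 A0 (lt0r_neq0 h1).
Qed.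

Lemma sign_poly_den_gt0 A s : 0 < A < 1 -> 0 <= s <= 1 ->
  0 < (1 - A * s) * ((36 - 35 * s) * (361 - 312 * s)) ^+ 2.
Proof.
move=> hA hs; have h1 : 0 < 1 - A * s by apply: one_sub_gt0 => //; lra.
have p1 : 0 < 36 - 35 * s by lra.
have p2 : 0 < 361 - 312 * s by lra.
exact: (mulr_gt0 h1 (exprn_gt0 2 (mulr_gt0 p1 p2))).
Qed.

Let bernstein (a b s : R) : a <= s <= b ->
  forall i, 0 <= (s - a) ^+ i * (b - s) ^+ (6 - i).
Proof. by move=> h i; rewrite mulr_ge0// exprn_ge0//; lra. Qed.

Lemma sign_poly_le0 s : 0 <= s <= 1 ->
  sign_poly (41 / 50) (-97 / 1000) (-321 / 1000) (-4339 / 100) s <= 0.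
Proof.
move=> /andP[s0 s1]; rewrite /sign_poly; have -> : (3 * (41 / 50))^-1 = 50 / 123 :> R by field.
(* The polynomial has degree at most 6 in s. On each of the two pieces, [lra] certifies the sign
   through the Bernstein products of that piece. *)
have [hs|/ltW hs] := leP s (15 / 16).
  have hb : 0 <= s <= 15 / 16 by rewrite s0.
  have := bernstein hb => B; have := B 0%N; have := B 1%N; have := B 2%N; have := B 3%N.
  have := B 4%N; have := B 5%N; have := B 6%N; clear B; rewrite !subnE/=; lra.
have hb : 15 / 16 <= s <= 1 by rewrite hs.
have := bernstein hb => B; have := B 0%N; have := B 1%N; have := B 2%N; have := B 3%N.
have := B 4%N; have := B 5%N; have := B 6%N; clear B; rewrite !subnE/=; lra.
Qed.

Lemma sign_poly_ge0 s : 0 <= s <= 1 ->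
  0 <= sign_poly (133 / 162) (-101 / 1000) (-33 / 100) (-43) s.
Proof.
move=> /andP[s0 s1]; rewrite /sign_poly; have -> : (3 * (133 / 162))^-1 = 54 / 133 :> R by field.
have [hs|/ltW hs] := leP s (15 / 16).
  have hb : 0 <= s <= 15 / 16 by rewrite s0.
  have := bernstein hb => B; have := B 0%N; have := B 1%N; have := B 2%N; have := B 3%N.
  have := B 4%N; have := B 5%N; have := B 6%N; clear B; rewrite !subnE/=; lra.
have hb : 15 / 16 <= s <= 1 by rewrite hs.
have := bernstein hb => B; have := B 0%N; have := B 1%N; have := B 2%N; have := B 3%N.
have := B 4%N; have := B 5%N; have := B 6%N; clear B; rewrite !subnE/=; lra.
Qed.

(** The window for a_1 ^ 2 has width 1 / 1000, which leaves little room: the coefficients of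
    [two_pole] are chosen separately at its two ends, 41 / 50 here and 133 / 162 < 821 / 1000 in the
    next lemma. *)
Lemma avg_speed_one_lt0 :
  avg n (fun s => (s - (3 * (41 / 50))^-1) * Num.sqrt (speed_sq 1 (41 / 50) s)) < 0 :> R.
Proof.
have hA : 0 < (41 / 50 : R) < 1 by lra.
have hA' : 0 <= (41 / 50 : R) < 1 by lra.
have Q0 : (0 : R) < 6 * (41 / 50) - 4 / 3 by lra.
have cr := @cont01_two_pole R (3 * (41 / 50))^-1 (-97 / 1000) (-321 / 1000) (-4339 / 100 : R).
have := @avg_weighted_sqrt_le R n _ _ (3 * (41 / 50))^-1 _ (@cont01_speed_sq R 1 _ hA') cr (ltW Q0).
move=> H; apply: (le_lt_trans (H _ _ _)) => {H}.
- move=> s hs; have -> : (3 * (41 / 50))^-1 = 50 / 123 :> R by field.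
  apply: two_pole_ge0; [lra|lra|lra|lra|exact: hs].
- by move=> s hs; apply/ltW/speed_sq_gt0.
- move=> s hs; rewrite (sign_polyE _ _ _ hA hs); apply: mulr_le0_ge0.
    by apply: mulr_ge0_le0; [exact: sqr_ge0|exact: sign_poly_le0].
  by rewrite invr_ge0; apply/ltW/sign_poly_den_gt0.
rewrite pmulr_rlt0; last by rewrite sqrtr_gt0; exact: Q0.
rewrite (avg_two_pole n_gt0).
have -> : (3 * (41 / 50))^-1 = 50 / 123 :> R by field.
lra.
Qed.

Lemma avg_speed_one_gt0 :
  0 < avg n (fun s => (s - (3 * (133 / 162))^-1) * Num.sqrt (speed_sq 1 (133 / 162) s)) :> R.
Proof.
have hA : 0 < (133 / 162 : R) < 1 by lra.
have hA' : 0 <= (133 / 162 : R) < 1 by lra.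
have Q0 : (0 : R) < 6 * (133 / 162) - 4 / 3 by lra.
have cr := @cont01_two_pole R (3 * (133 / 162))^-1 (-101 / 1000) (-33 / 100) (-43 : R).
have := @avg_weighted_sqrt_ge R n _ _ (3 * (133 / 162))^-1 _ (@cont01_speed_sq R 1 _ hA') cr (ltW Q0).
move=> H; apply: (lt_le_trans _ (H _ _ _)) => {H}.
- rewrite pmulr_rgt0; last by rewrite sqrtr_gt0; exact: Q0.
  rewrite (avg_two_pole n_gt0).
  have -> : (3 * (133 / 162))^-1 = 54 / 133 :> R by field.
  lra.
- move=> s hs; have -> : (3 * (133 / 162))^-1 = 54 / 133 :> R by field.
  apply: two_pole_ge0; [lra|lra|lra|lra|exact: hs].
- by move=> s hs; apply/ltW/speed_sq_gt0.
- move=> s hs; rewrite (sign_polyE _ _ _ hA hs); apply: divr_ge0.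
    by apply: mulr_ge0; [exact: sqr_ge0|exact: sign_poly_ge0].
  by apply/ltW/sign_poly_den_gt0.
Qed.

End SignCircleTwoEndpoints.

Ltac instances B i j :=
  have := B i j; lazymatch j with S ?j' => instances B i j' | O => idtac end.

Section SignHigherDimension.
Variables (R : realType) (n k : nat).
Hypotheses (n_gt0 : (0 < n)%N) (k_ge2 : (2 <= k)%N).
Local Notation x := (k%:R : R).
Implicit Types (s D A : R).

(** For A near 1 / k the speed has relative slope - 2 / k in s to leading order, which is also the
    slope of this weight when D is close to 2 k ^ 2. The smaller [D], used at the upper end for A,
    makes the weight steeper; the larger one, used at the lower end, makes it flatter. This gives
    the two opposite comparisons. *)
Definition quad_weight s0 D s : R := 1 - (s - s0) * (4 * x + 7 * (s - s0)) / D.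

Lemma cont01_quad_weight s0 D : cont01 (quad_weight s0 D).
Proof.
have ct : cont01 (fun s : R => s - s0).
  by apply: cont01B; [exact: cont01_id|exact: cont01_cst].
apply: cont01B; first exact: cont01_cst.
apply: cont01M; last exact: cont01_cst.
apply: cont01M => //; apply: cont01D; first exact: cont01_cst.
by apply: cont01M => //; exact: cont01_cst.
Qed.

Lemma avg_quad_weight s0 D :
  avg n (fun s => (s - s0) * quad_weight s0 D s) =
  1 / 2 - s0 - (4 * x * (3 / 8 - s0 + s0 ^+ 2)
    + 7 * (5 / 16 - 9 / 8 * s0 + 3 / 2 * s0 ^+ 2 - s0 ^+ 3)) / D.
Proof.
pose i := D^-1.
transitivity (avg n (fun s => (- s0 - 4 * x * s0 ^+ 2 * i + 7 * s0 ^+ 3 * i)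
  + (1 + 8 * x * s0 * i - 21 * s0 ^+ 2 * i) * s + (21 * s0 * i - 4 * x * i) * s ^+ 2
  + (- 7 * i) * s ^+ 3 + 0 * s ^+ 4 + 0 * s ^+ 5)).
  by apply: eq_avg => s _; rewrite /quad_weight -/i; ring.
by rewrite avg_poly5// -/i; field.
Qed.

Lemma quad_weight_ge0 s0 D s : 2 / 5 <= s0 <= 1 / 2 -> 2 * x ^+ 2 + x + 4 <= D ->
  0 <= s <= 1 -> 0 <= quad_weight s0 D s.
Proof.
move=> h0 hD hs; have x2 : 2 <= x by rewrite ler_nat.
have D0 : 0 < D by nra.
rewrite /quad_weight subr_ge0 ler_pdivrMr// mul1r.
set t := s - s0; have ht : - (1 / 2) <= t <= 3 / 5 by rewrite /t; lra.
have [t0|t0] := leP 0 t.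
  have : t * (4 * x + 7 * t) <= 3 / 5 * (4 * x + 21 / 5) by nra.
  by nra.
have : t * (4 * x + 7 * t) <= 0 by nra.
by nra.
Qed.

Let bernstein s : 0 <= s <= 1 ->
  forall i j, 0 <= (x - 2) ^+ j * (s ^+ i * (1 - s) ^+ (4 - i)).
Proof.
move=> h i j; have x2 : 0 <= x - 2 by rewrite subr_ge0 ler_nat.
by rewrite !mulr_ge0// exprn_ge0//; lra.
Qed.

(* Up to a positive factor, the difference between the squared speed and a multiple of
   the square of quad_weight is (s - s0) times the polynomial below. Its sign on [0, 1]
   is that of its Bernstein coefficients, which are polynomials in k - 2. *)
Definition upper_poly s : R :=
  let N := 2 * x + 1 in let D := 2 * x ^+ 2 + x + 4 in
  let u := N * s - x in let v := 4 * x * N + 7 * u in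
  D ^+ 2 * N ^+ 4 * (x * s + 3 - 4 * x ^+ 2)
  + (3 * (x + 1) ^+ 2 + 2 * x ^+ 3) * (x - s) * v * (2 * D * N ^+ 2 - u * v).

Lemma upper_poly_ge0 s : 0 <= s <= 1 -> 0 <= upper_poly s.
Proof.
move=> hs; have B := bernstein hs.
rewrite /upper_poly; move: B; set y := x - 2 => B; have -> : x = y + 2 by rewrite /y; ring.
instances B 0%N 9%N; instances B 1%N 9%N; instances B 2%N 9%N.
instances B 3%N 9%N; instances B 4%N 9%N.
clear B; lra.
Qed.

Definition lower_poly s : R :=
  let N := 2 * x + 1 in let D := 2 * x ^+ 2 + 2 * x + 6 in
  let c := 2 * x ^+ 2 + 1 in let M := 4 * x ^+ 2 * N ^+ 2 * D in
  let u := 2 * x * N * s - c in let v := 8 * x ^+ 2 * N + 7 * u in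
  M ^+ 2 * (2 * x ^+ 2 * s - 8 * x ^+ 3 + 2 * x - 3)
  + (3 * (x + 1) * (2 * x ^+ 2 + 2 * x - 1) + 2 * x ^+ 2 * c) * (c - 2 * x * s)
    * v * (2 * M - u * v).

Lemma lower_poly_le0 s : 0 <= s <= 1 -> lower_poly s <= 0.
Proof.
move=> hs; have B := bernstein hs.
rewrite /lower_poly; move: B; set y := x - 2 => B; have -> : x = y + 2 by rewrite /y; ring.
instances B 0%N 14%N; instances B 1%N 14%N; instances B 2%N 14%N.
instances B 3%N 14%N; instances B 4%N 14%N.
clear B; lra.
Qed.

(** The two ends of the interval for A. Expanding, [A0] is 1 / k - 1 / (2 k ^ 3) plus a positive
    term of order k ^ (-5), so the interval lies inside the window required of a ^ 2. *)
Let A1 : R := x^-1.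
Let A0 : R := 2 * x / (2 * x ^+ 2 + 1).

Let x_ge2 : 2 <= x. Proof. by rewrite ler_nat. Qed.

Lemma avg_speed_upper_gt0 :
  0 < avg n (fun s => (s - (A1 * (2 * x + 1))^-1) * Num.sqrt (speed_sq k A1 s)).
Proof.
have x2 := x_ge2; have x0 : x != 0 by apply: lt0r_neq0; lra.
have N0 : 2 * x + 1 != 0 by apply: lt0r_neq0; lra.
have -> : (A1 * (2 * x + 1))^-1 = x / (2 * x + 1) by rewrite /A1; field; rewrite x0 N0.
set s0 := x / (2 * x + 1); pose D := 2 * x ^+ 2 + x + 4.
have xx : 2 * x <= x ^+ 2 by rewrite expr2 ler_wpM2r//; lra.
have D0 : 0 < D by rewrite /D; lra.
have hA : 0 <= A1 < 1.
  have x0' : 0 < x by lra.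
  by rewrite /A1 invr_ge0 (ltW x0')/= invf_lt1//; lra.
(* The squared speed at s0, so that the two sides of the comparison agree there. *)
pose Q0 := (x + 1) * (3 * (x + 1) ^+ 2 + 2 * x ^+ 3) / (6 * x ^+ 2).
have Q0_gt0 : 0 < Q0.
  have x0' : 0 < x by lra.
  have h1 := sqr_ge0 (x + 1); have h2 := exprn_gt0 2 x0'; have h3 := exprn_gt0 3 x0'.
  by apply: divr_gt0; last (by lra); apply: mulr_gt0; lra.
have := @avg_weighted_sqrt_ge R n _ _ s0 Q0 (@cont01_speed_sq R k _ hA)
  (@cont01_quad_weight s0 D) (ltW Q0_gt0).
move=> H; apply: (lt_le_trans _ (H _ _ _)) => {H}.
- rewrite pmulr_rgt0 ?sqrtr_gt0// avg_quad_weight.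
  have -> : 1 / 2 - s0 - (4 * x * (3 / 8 - s0 + s0 ^+ 2) +
      7 * (5 / 16 - 9 / 8 * s0 + 3 / 2 * s0 ^+ 2 - s0 ^+ 3)) / D =
      (12 * x ^+ 2 + 28 * x - 3) / (16 * (2 * x + 1) ^+ 3 * D).
    have := lt0r_neq0 D0; rewrite /s0 /D => D0n; field; by rewrite N0 D0n.
  by rewrite divr_gt0// ?mulr_gt0// ?exprn_gt0//; lra.
- move=> s hs; apply: quad_weight_ge0 => //.
  have N1 : 0 < 2 * x + 1 by lra.
  by rewrite /s0 ler_pdivlMr// ler_pdivrMr//; lra.
- by move=> s hs; rewrite ltW// speed_sq_gt0.
- move=> s hs; have xs : 0 < x - s by lra.
  have -> : (s - s0) * (speed_sq k A1 s - Q0 * quad_weight s0 D s ^+ 2) =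
      ((2 * x + 1) * s - x) ^+ 2 * (x + 1) * upper_poly s
      / ((2 * x + 1) ^+ 5 * (6 * x ^+ 2) * (x - s) * D ^+ 2).
    rewrite /speed_sq /Q0 /quad_weight /upper_poly /s0 /A1 -/D.
    field; rewrite x0 N0 !lt0r_neq0//.
  rewrite divr_ge0//.
    by rewrite mulr_ge0 ?upper_poly_ge0// mulr_ge0 ?sqr_ge0//; lra.
  by rewrite !mulr_ge0 ?exprn_ge0// ?sqr_ge0 ?(ltW xs)//; lra.
Qed.

Lemma avg_speed_lower_lt0 :
  avg n (fun s => (s - (A0 * (2 * x + 1))^-1) * Num.sqrt (speed_sq k A0 s)) < 0.
Proof.
have x2 := x_ge2; have x0 : x != 0 by apply: lt0r_neq0; lra.
have N0 : 2 * x + 1 != 0 by apply: lt0r_neq0; lra.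
pose c := 2 * x ^+ 2 + 1.
have xx : 2 * x <= x ^+ 2 by rewrite expr2 ler_wpM2r//; lra.
have c_gt0 : 0 < c by rewrite /c; lra.
have c0 : c != 0 by exact: lt0r_neq0.
have -> : (A0 * (2 * x + 1))^-1 = c / (2 * x * (2 * x + 1)).
  by rewrite /A0 -/c; field; rewrite x0 N0 c0.
set s0 := c / (2 * x * (2 * x + 1)); pose D := 2 * x ^+ 2 + 2 * x + 6.
have D0 : 0 < D by rewrite /D; lra.
have hA : 0 <= A0 < 1.
  rewrite /A0 -/c; apply/andP; split; first by apply: divr_ge0; lra.
  by rewrite ltr_pdivrMr// /c; lra.
pose q := 3 * (x + 1) * (2 * x ^+ 2 + 2 * x - 1) + 2 * x ^+ 2 * c.
pose Q0 := (x + 1) * q / (6 * x * c).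
have q0 : 0 < q.
  rewrite /q; apply: addr_gt0; last by apply: mulr_gt0 => //; lra.
  by apply: mulr_gt0; [lra|lra].
have Q0_gt0 : 0 < Q0.
  by rewrite /Q0; apply: divr_gt0; apply: mulr_gt0 => //; lra.
have := @avg_weighted_sqrt_le R n _ _ s0 Q0 (@cont01_speed_sq R k _ hA)
  (@cont01_quad_weight s0 D) (ltW Q0_gt0).
move=> H; apply: (le_lt_trans (H _ _ _)) => {H}.
- move=> s hs; apply: quad_weight_ge0 => //; last by rewrite /D; lra.
  have P1 : 0 < 2 * x * (2 * x + 1) by apply: mulr_gt0; lra.
  by rewrite /s0 ler_pdivlMr// ler_pdivrMr// /c; lra.
- by move=> s hs; rewrite ltW// speed_sq_gt0.
- move=> s hs; have xs : 0 < c - 2 * x * s.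
    have : x * s <= x * 1 by rewrite ler_wpM2l//; lra.
    by rewrite /c; lra.
  have -> : (s - s0) * (speed_sq k A0 s - Q0 * quad_weight s0 D s ^+ 2) =
      (2 * x * (2 * x + 1) * s - c) ^+ 2 * (x + 1) * lower_poly s
      / (2 * x * (2 * x + 1) * (6 * x) * (c - 2 * x * s) * c
         * (4 * x ^+ 2 * (2 * x + 1) ^+ 2 * D) ^+ 2).
    have cn := c0; have xn := lt0r_neq0 xs; have Dn := lt0r_neq0 D0.
    rewrite /speed_sq /Q0 /quad_weight /lower_poly /s0 /A0 /q -/D; rewrite /c in cn xn *.
    by field; rewrite x0 N0 cn xn Dn.
  rewrite mulr_le0_ge0//.
    by rewrite mulr_ge0_le0 ?lower_poly_le0// mulr_ge0 ?sqr_ge0//; lra.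
  by rewrite invr_ge0 !mulr_ge0 ?sqr_ge0 ?(ltW xs) ?(ltW c_gt0)//; lra.
rewrite pmulr_rlt0 ?sqrtr_gt0// avg_quad_weight.
pose P := 2 * x * (2 * x + 1).
have P0 : 0 < P by rewrite /P !mulr_gt0//; lra.
have -> : 1 / 2 - s0 - (4 * x * (3 / 8 - s0 + s0 ^+ 2) +
    7 * (5 / 16 - 9 / 8 * s0 + 3 / 2 * s0 ^+ 2 - s0 ^+ 3)) / D =
  (8 * P ^+ 2 * D * (P - 2 * c) - 8 * x * P * (3 * P ^+ 2 - 8 * c * P + 8 * c ^+ 2)
   - 7 * (5 * P ^+ 3 - 18 * c * P ^+ 2 + 24 * c ^+ 2 * P - 16 * c ^+ 3)) / (16 * P ^+ 3 * D).
  by rewrite /s0 -/P; field; rewrite !lt0r_neq0.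
have den_gt0 : 0 < 16 * P ^+ 3 * D.
  by apply: mulr_gt0 => //; apply: mulr_gt0 => //; exact: exprn_gt0.
rewrite pmulr_llt0 ?invr_gt0//.
have y0 : 0 <= x - 2 by lra.
rewrite /P /D /c; move: y0; set y := x - 2; have -> : x = y + 2 by rewrite /y; ring.
move=> y0; have := (exprn_ge0 2 y0); have := (exprn_ge0 3 y0); have := (exprn_ge0 4 y0).
have := (exprn_ge0 5 y0); have := (exprn_ge0 6 y0); have := (exprn_ge0 7 y0); lra.
Qed.

End SignHigherDimension.

Section BalanceRoot.
Variables (R : realType) (k : nat).
Hypothesis k_gt0 : (0 < k)%N.
Local Notation x := (k%:R : R).
Local Notation leb := (@lebesgue_measure R).
Local Notation T := (2 * pi : R).
Implicit Types (A s v : R).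

(** Up to the factor - 1 / k this is the integrand of the balance integral: x ^ 2 - 2 / (2 k + 1) =
    - (z ^ 2 - 1 / (2 k + 1)) / k, with z ^ 2 = A s. *)
Definition balance_term A s : R := (A * s - (2 * x + 1)^-1) * Num.sqrt (speed_sq k A s).

Definition balance_avg A : R := avg k.+1 (balance_term A).

Lemma cont01_affine (a b : R) : cont01 (fun s => a * s - b).
Proof.
apply: cont01B; last exact: cont01_cst.
by apply: cont01M; [exact: cont01_cst|exact: cont01_id].
Qed.

Lemma cont01_balance_term A : 0 <= A < 1 -> cont01 (balance_term A).
Proof.
by move=> hA; apply: cont01M; [exact: cont01_affine|apply/cont01_sqrt/cont01_speed_sq].
Qed.

Lemma balance_avgE A : 0 < A < 1 ->
  balance_avg A =
  A * avg k.+1 (fun s => (s - (A * (2 * x + 1))^-1) * Num.sqrt (speed_sq k A s)).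
Proof.
move=> hA; have x0 : 0 <= x by [].
rewrite -avgZ.
  by apply: eq_avg => s _; rewrite /balance_term; field; rewrite !lt0r_neq0//; lra.
apply: cont01M; last by apply/cont01_sqrt/cont01_speed_sq; lra.
by apply: cont01B; [exact: cont01_id|exact: cont01_cst].
Qed.

Lemma speed_sq_le A s v : 0 <= A <= v -> v < 1 -> 0 <= s <= 1 ->
  speed_sq k A s <= (x + 1) ^+ 2 / (1 - v) + (x + 1) * (2 * x + 1) / 6.
Proof.
move=> hA v1 hs; have x0 : 0 <= x by [].
have p : 0 < 1 - A * s by apply: one_sub_gt0; lra.
have pv : 1 - v <= 1 - A * s by nra.
rewrite /speed_sq lerD//.
  have -> : (x + 1) ^+ 2 * A * (1 - s) / (1 - A * s) = A * (1 - s) / (1 - A * s) * (x + 1) ^+ 2.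
    by ring.
  rewrite [leRHS]mulrC ler_wpM2r ?sqr_ge0// ler_pdivrMr// [leRHS]mulrC ler_pdivlMr; last lra.
  have : A * (1 - s) * (1 - v) <= 1 * (1 - v) by rewrite ler_wpM2r//; [lra|nra].
  lra.
rewrite ler_piMr; [by []|apply: divr_ge0 => //; apply: mulr_ge0; lra|nra].
Qed.

Lemma continuous_speed_sq_param A s : 0 < A < 1 -> 0 <= s <= 1 ->
  {for A, continuous (fun A => speed_sq k A s)}.
Proof.
move=> hA hs.
have c1 : {for A, continuous (fun A : R => 1 - A * s)}.
  by apply: cvgB; [exact: cvg_cst|apply: cvgM; [exact: cvg_id|exact: cvg_cst]].
apply: cvgD; last by apply: cvgM; [exact: cvg_cst|exact: c1].
apply: cvgM; last by apply: cvgV => //; rewrite gt_eqF// one_sub_gt0//; lra.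
by apply: cvgM; [apply: cvgM; [exact: cvg_cst|exact: cvg_id]|exact: cvg_cst].
Qed.

Lemma balance_avg_continuous v : v < 1 -> {in `]0, v[, continuous balance_avg}.
Proof.
move=> v1 A hA; have x0 : 0 <= x by [].
(* A bound uniform over 0 < A < v, for dominated convergence; the factor 2 covers |A s - 1 / (2 k +
   1)|. *)
pose C : R := 2 * Num.sqrt ((x + 1) ^+ 2 / (1 - v) + (x + 1) * (2 * x + 1) / 6).
pose f (A t : R) := balance_term A (sqsin k.+1 t).
have H := @continuity_under_integral R _ _ leb f (`[0, T]%classic) _ 0 v _ _ (fun=> C) _ _.
apply: cvgM; first exact: cvg_cst.
apply: H => //; last by rewrite inE.
- move=> B; rewrite /= in_itv/= => hB; apply: continuous_itv_integrable.
  by apply: cont01_sqsin; apply: cont01_balance_term; lra.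
- apply: aeW => t _ B; rewrite inE/= in_itv/= => hB.
  have := sqsin01 k.+1 t; rewrite /f; set s := sqsin _ t => hs.
  apply: cvgM.
    by apply: cvgB; [apply: cvgM; [exact: cvg_id|exact: cvg_cst]|exact: cvg_cst].
  apply: continuous_comp; last exact: sqrt_continuous.
  by apply: continuous_speed_sq_param => //; lra.
- by apply: continuous_itv_integrable => t; exact: cvg_cst.
- move=> B; rewrite /= in_itv/= => hB; apply: aeW => t _.
  have := sqsin01 k.+1 t; rewrite /f; set s := sqsin _ t => hs.
  rewrite normrM /C ler_pM// ?ler_norml.
    have i1 : 0 < (2 * x + 1)^-1 <= 1 by rewrite invr_gt0 invf_le1; lra.
    by apply/andP; split; nra.
  have := sqrtr_ge0 (speed_sq k B s); have : Num.sqrt (speed_sq k B s) <= Num.sqrt ((x + 1) ^+ 2 / (1 - v) + (x + 1) * (2 * x + 1) / 6).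
    by apply: ler_wsqrtr; apply: speed_sq_le; lra.
  lra.
Qed.

Lemma balance_avg_root A0 A1 : 0 < A0 -> A0 < A1 -> A1 < 1 ->
  balance_avg A0 < 0 -> 0 < balance_avg A1 ->
  exists A, [/\ A0 < A, A < A1 & balance_avg A = 0].
Proof.
move=> h0 h01 h1 n0 p1.
have cb : {within `[A0, A1], continuous balance_avg}.
  apply: continuous_in_subspaceT => A; rewrite inE/= in_itv/= => hA.
  by apply: (@balance_avg_continuous ((A1 + 1) / 2)); rewrite ?in_itv/=; lra.
have [|A] := IVT (ltW h01) cb (v := 0).
  by rewrite ge_min le_max (ltW n0) (ltW p1) orbT.
rewrite in_itv/= => /andP[hA0 hA1] bA; exists A; split => //.
  by rewrite lt_neqAle hA0 andbT; apply: contraTneq n0 => ->; rewrite bA ltxx.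
by rewrite lt_neqAle hA1 andbT; apply: contraTneq p1 => <-; rewrite bA ltxx.
Qed.

Lemma balance_root : exists A, [/\ 0 < A < 1, balance_avg A = 0,
  k = 1%N -> 820 / 1000 < A < 821 / 1000
  & (2 <= k)%N -> 2 * x / (2 * x ^+ 2 + 1) < A < x^-1].
Proof.
have [k1|k2] := leqP k 1.
  have {k1}kE : k = 1%N by apply/eqP; rewrite eqn_leq k1 k_gt0.
  have xE : 2 * x + 1 = 3 by rewrite kE; ring.
  have [|||||A [hA0 hA1 bA]] := @balance_avg_root (41 / 50) (133 / 162); [lra|lra|lra| | |].
  - rewrite balance_avgE; last lra.
    rewrite pmulr_rlt0; last lra.
    by rewrite xE mulrC kE; exact: (@avg_speed_one_lt0 R 2).
  - rewrite balance_avgE; last lra.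
    rewrite pmulr_rgt0; last lra.
    by rewrite xE mulrC kE; exact: (@avg_speed_one_gt0 R 2).
  by exists A; split; [lra|exact: bA|move=> _; lra|rewrite kE].
have x2 : 2 <= x by rewrite ler_nat.
have d : 0 < 2 * x ^+ 2 + 1 by nra.
have x0 : 0 < x by lra.
have [|||||A [hA0 hA1 bA]] := @balance_avg_root (2 * x / (2 * x ^+ 2 + 1)) x^-1.
- by rewrite divr_gt0//; lra.
- by rewrite ltr_pdivrMr// -ltr_pdivrMl ?invr_gt0// invrK; lra.
- by rewrite invf_lt1//; lra.
- rewrite balance_avgE; last first.
    by rewrite divr_gt0//=; [rewrite ltr_pdivrMr//; nra|lra].
  rewrite pmulr_rlt0; last by rewrite divr_gt0//; lra.
  exact: avg_speed_lower_lt0.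
- rewrite balance_avgE; last by rewrite invr_gt0 x0 invf_lt1//; lra.
  rewrite pmulr_rgt0 ?invr_gt0//.
  exact: avg_speed_upper_gt0.
exists A; split => // [|k1|_]; [|by rewrite k1 in k2|by rewrite hA0 hA1].
have : x^-1 < 1 by rewrite invf_lt1//; lra.
have : 0 < 2 * x / (2 * x ^+ 2 + 1) by rewrite divr_gt0//; lra.
lra.
Qed.

End BalanceRoot.

(** * The short curve *)

Lemma sum_coord_pairs (R : realType) (d k : nat) (F G : nat -> R) (Z : R) : d = (2 * k)%N ->
  \sum_(i < d.+1) (if i == d :> nat then Z
    else if odd i then G i./2.+1 else F i./2.+1) =
  \sum_(1 <= l < k.+1) (F l + G l) + Z.
Proof.
move=> ->; rewrite big_ord_recr/= eqxx; congr (_ + _).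
rewrite big_add1/= big_mkord mul2n.
transitivity (\sum_(i < k.*2) (if odd i then G i./2.+1 else F i./2.+1)).
  by apply: eq_bigr => i _; rewrite ltn_eqF.
elim: k => [|k IH]; first by rewrite !big_ord0.
by rewrite doubleS !big_ord_recr/= IH odd_double/= doubleK uphalf_double addrA.
Qed.

Lemma sum_sqr_index (R : realType) (k : nat) :
  6 * \sum_(1 <= l < k.+1) l%:R ^+ 2 = k%:R * (k%:R + 1) * (2 * k%:R + 1) :> R.
Proof.
elim: k => [|k IH]; first by rewrite big_nil mulr0 !mul0r.
by rewrite big_nat_recr//= mulrDr IH -(natr1 k); ring.
Qed.

Section ShortCurve.
Variables (R : realType) (d k : nat) (a : R).
Hypotheses (k_gt0 : (0 < k)%N) (dk : d = (2 * k)%N) (a_gt0 : 0 < a) (a_lt1 : a < 1).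
Local Notation T := (2 * pi : R).
Local Notation n := (k.+1%:R : R).
Local Notation x := (xfun k a).
Local Notation z := (zfun k a).
Local Notation gamma := (short_curve d k a).
Local Notation A := (a ^+ 2).
Local Notation s := (sqsin k.+1).
Implicit Types t : R.

Let kR : 0 < k%:R :> R. Proof. by rewrite ltr0n. Qed.

Lemma sqr_zfun t : z t ^+ 2 = A * s t.
Proof. by rewrite exprMn. Qed.

Lemma sqr_lt1 : 0 <= A < 1.
Proof.
have h0 := a_gt0; have h1 := a_lt1.
by rewrite sqr_ge0/= expr2; nra.
Qed.

Lemma xfun_arg_gt0 t : 0 < 1 - z t ^+ 2.
Proof. by rewrite sqr_zfun; apply: one_sub_gt0; [exact: sqr_lt1|exact: sqsin01]. Qed.

Lemma sqr_xfun t : x t ^+ 2 = (1 - z t ^+ 2) / k%:R.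
Proof. by rewrite /xfun sqr_sqrtr// divr_ge0// ltW// xfun_arg_gt0. Qed.

Lemma xfun_gt0 t : 0 < x t.
Proof. by rewrite /xfun sqrtr_gt0 divr_gt0// xfun_arg_gt0. Qed.

Definition zder t : R := a * (n * cos (n * t)).
Definition xder t : R := - (z t * zder t) / (k%:R * x t).

Lemma der_zfun t : is_derive t 1 z (zder t).
Proof. exact: (derZ a (der_sinn k.+1 t)). Qed.

Lemma der_xfun t : is_derive t 1 x (xder t).
Proof.
have dz := der_zfun t; have c := der_cst t 1.
have dd := derZ k%:R^-1 (derB c (derM dz dz)).
have h := xfun_gt0 t; have k0 := lt0r_neq0 kR.
have e y : k%:R^-1 * (1 - z y * z y) = (1 - z y ^+ 2) / k%:R by rewrite expr2 mulrC.
have p : 0 < k%:R^-1 * (1 - z t * z t) by rewrite e divr_gt0// xfun_arg_gt0.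
apply: (der_ext _ _ (@der_sqrt R t (fun y => k%:R^-1 * (1 - z y * z y)) _ p dd)) => [y|].
  by rewrite e.
by rewrite e -/(xfun k a t) /xder; field; rewrite k0 lt0r_neq0.
Qed.

(** From k x ^ 2 = 1 - z ^ 2 follows k x' ^ 2 = z ^ 2 z' ^ 2 / (1 - z ^ 2), so k x' ^ 2 + z' ^ 2 =
    z' ^ 2 / (1 - z ^ 2), the first term of [speed_sq]. The sum of the l ^ 2 gives the second. *)
Lemma xfun_speed t :
  \sum_(1 <= l < k.+1) (derive1 x t ^+ 2 + l%:R ^+ 2 * x t ^+ 2) + derive1 z t ^+ 2 =
  speed_sq k A (s t).
Proof.
rewrite (der_val (der_xfun t)) (der_val (der_zfun t)) big_split/=.
rewrite big_const_nat subSS subn0 iter_addr_0 -(mulr_natl _ k).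
have -> : \sum_(1 <= l < k.+1) l%:R ^+ 2 * x t ^+ 2 =
    (\sum_(1 <= l < k.+1) l%:R ^+ 2) * x t ^+ 2 by rewrite mulr_suml.
have -> : \sum_(1 <= l < k.+1) l%:R ^+ 2 = k%:R * (k%:R + 1) * (2 * k%:R + 1) / 6 :> R.
  by rewrite -sum_sqr_index; field.
have x0 := xfun_gt0 t; have z0 := xfun_arg_gt0 t; have k0 := lt0r_neq0 kR.
rewrite /xder expr_div_n exprMn [(- _) ^+ 2]sqrrN exprMn sqr_xfun sqr_zfun.
rewrite sqr_zfun in z0.
have -> : zder t ^+ 2 = n ^+ 2 * A * (1 - s t).
  by rewrite /zder /sqsin sin2cos2; ring.
rewrite /speed_sq -(natr1 k); field; rewrite k0/= lt0r_neq0//.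
Qed.

Definition coord_der t (i : nat) : R :=
  if i == d then zder t
  else if odd i then xder t * sin (i./2.+1%:R * t) + x t * (i./2.+1%:R * cos (i./2.+1%:R * t))
  else xder t * cos (i./2.+1%:R * t) + x t * - (i./2.+1%:R * sin (i./2.+1%:R * t)).

Lemma der_short_curve t (i : 'I_d.+1) :
  is_derive t 1 (fun t => gamma t 0 i) (coord_der t i).
Proof.
have dx := der_xfun t; have dz := der_zfun t.
rewrite /coord_der; case: ifP => [id|id].
  by apply: der_ext dz => // y; rewrite mxE id.
case: ifP => io.
  by apply: der_ext (derM dx (der_sinn i./2.+1 t)) => // y; rewrite mxE id io.
by apply: der_ext (derM dx (der_cosn i./2.+1 t)) => // y; rewrite mxE id io.
Qed.

Lemma speed_short_curve t : speed gamma t = Num.sqrt (speed_sq k A (s t)).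
Proof.
have dg : derivable gamma t 1.
  by apply/derivable_mxP => i j; rewrite ord1; case: (der_short_curve t j).
rewrite /speed /enorm -xfun_speed; congr Num.sqrt.
rewrite (der_val (der_xfun t)) (der_val (der_zfun t)).
pose F (l : nat) : R := (xder t * cos (l%:R * t) + x t * - (l%:R * sin (l%:R * t))) ^+ 2.
pose G (l : nat) : R := (xder t * sin (l%:R * t) + x t * (l%:R * cos (l%:R * t))) ^+ 2.
transitivity (\sum_(1 <= l < k.+1) (F l + G l) + zder t ^+ 2); last first.
  (* Within a cosine-sine pair the cross terms in x x' cancel. *)
  congr (_ + _); apply: eq_bigr => l _; rewrite /F /G.
  have := cos2Dsin2 (l%:R * t); set u := cos _; set v := sin _ => h.
  transitivity ((xder t ^+ 2 + l%:R ^+ 2 * x t ^+ 2) * (u ^+ 2 + v ^+ 2)); first ring.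
  by rewrite h mulr1.
rewrite -(sum_coord_pairs _ _ _ dk); apply: eq_bigr => i _.
rewrite derive1E derive_mx// mxE -derive1E (der_val (der_short_curve t i)) /coord_der.
by case: ifP => _ //; case: ifP.
Qed.

Lemma short_curve_sphere t : sphere R d (gamma t).
Proof.
apply/sphereE.
pose F (l : nat) : R := (x t * cos (l%:R * t)) ^+ 2.
pose G (l : nat) : R := (x t * sin (l%:R * t)) ^+ 2.
transitivity (\sum_(1 <= l < k.+1) (F l + G l) + z t ^+ 2).
  rewrite -(sum_coord_pairs _ _ _ dk); apply: eq_bigr => i _; rewrite mxE.
  by case: ifP => _ //; case: ifP.
transitivity (\sum_(1 <= l < k.+1) x t ^+ 2 + z t ^+ 2).
  congr (_ + _); apply: eq_bigr => l _.
  by rewrite /F /G !exprMn -mulrDr cos2Dsin2 mulr1.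
rewrite big_const_nat subSS subn0 iter_addr_0 -(mulr_natl _ k) sqr_xfun.
by field; exact: lt0r_neq0.
Qed.

Let speed_max : R := Num.sqrt ((k%:R + 1) ^+ 2 / (1 - A) + (k%:R + 1) * (2 * k%:R + 1) / 6).

Lemma coord_der_le t (i : 'I_d.+1) : `|coord_der t i| <= speed_max.
Proof.
have dg : derivable gamma t 1.
  by apply/derivable_mxP => l j; rewrite ord1; case: (der_short_curve t j).
have -> : coord_der t i = (derive1 gamma t) 0 i.
  by rewrite derive1E derive_mx// mxE -derive1E (der_val (der_short_curve t i)).
apply: le_trans (coord_le_enorm _ _) _; rewrite -/(speed gamma t) speed_short_curve.
by apply: ler_wsqrtr; apply: speed_sq_le; have := sqr_lt1; have := sqsin01 k.+1 t; lra.
Qed.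

Lemma short_curve_coord_lipschitz (i : 'I_d.+1) u v :
  `|gamma u 0 i - gamma v 0 i| <= speed_max * `|u - v|.
Proof.
wlog uv : u v / v <= u => [hw|].
  have [|/ltW h] := leP v u; first exact: hw.
  by rewrite distrC [`|u - v|]distrC; exact: hw.
have d' t := der_short_curve t i.
have [c _ ->] := MVT_segment uv (fun t _ => d' t)
  (continuous_subspaceT (fun t => der_cont (d' t))).
by rewrite normrM ler_wpM2r// coord_der_le.
Qed.

Lemma short_curve_continuous : continuous gamma.
Proof.
by apply: continuous_mx => i j t; rewrite ord1; exact: (der_cont (der_short_curve t j)).
Qed.

Lemma zfunT : z T = z 0.
Proof. by rewrite /zfun sinnT !mulr0 sin0 mulr0. Qed.

Lemma short_curve_closed : gamma T = gamma 0.
Proof.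
have e : x T = x 0 by rewrite /xfun zfunT.
apply/rowP => i; rewrite !mxE zfunT e; case: ifP => // _.
case: ifP => _; first by rewrite sinnT !mulr0 sin0 mulr0.
by congr (_ * _); rewrite -[_ * T]add0r cosD2piMn mulr0.
Qed.

Lemma short_curve_lipschitz_closed : closed_lipschitz_curve gamma.
Proof.
split.
- by move=> t _; exact: short_curve_sphere.
- exists (d.+1%:R * speed_max) => u v _ _.
  apply: le_trans (enorm_le_sum _) _.
  rewrite -mulrA mulr_natl -[X in _ *+ X]card_ord -sumr_const; apply: ler_sum => i _.
  by rewrite !mxE; have := short_curve_coord_lipschitz i u v; rewrite !mxE.
- rewrite -short_curve_closed; apply: cvg_at_left_filter; exact: short_curve_continuous.
Qed.

End ShortCurve.

(** * Upper bounds for the average speed and the length *)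

Section AverageSpeedBound.
Variables (R : realType) (n : nat).
Hypothesis n_gt0 : (0 < n)%N.

Lemma sqr_avg_le (f : R -> R) : cont01 f -> avg n f ^+ 2 <= avg n (fun s => f s ^+ 2).
Proof.
move=> cf; set m := avg n f.
have c0 : cont01 (fun _ : R => 0 : R) by exact: cont01_cst.
have cf2 : cont01 (fun s => f s ^+ 2) by exact: cont01X.
have cm : cont01 (fun s => (2 * m) * f s) by apply: cont01M => //; exact: cont01_cst.
have : 0 <= avg n (fun s => f s ^+ 2 - (2 * m) * f s + m ^+ 2).
  rewrite -[leLHS](avg_cst n (0 : R)); apply: le_avg => //.
    by apply: cont01D; [exact: cont01B|exact: cont01_cst].
  move=> s _; have -> : f s ^+ 2 - 2 * m * f s + m ^+ 2 = (f s - m) ^+ 2 by ring.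
  exact: sqr_ge0.
rewrite avgD; [|exact: cont01B|exact: cont01_cst].
by rewrite avgB// avgZ// avg_cst -/m; lra.
Qed.

Variable k : nat.
Local Notation x := (k%:R : R).

(* Inserting the factor 1 + (A s - 1 / (2 k + 1)), which does not change the
   integral of the speed when the balance condition holds, makes the
   Cauchy-Schwarz inequality almost sharp. *)
Lemma sqr_avg_speed_le (A : R) (k_ge2 : (2 <= k)%N) : 0 < A -> A * x <= 1 ->
  avg n (balance_term k A) = 0 ->
  12 * avg n (fun s => Num.sqrt (speed_sq k A s)) ^+ 2
    <= (2 * x + 5 / 2 + 317 / 200 / x) ^+ 2.
Proof.
move=> A0 Ax bal; have x2 : 2 <= x by rewrite ler_nat.
have A1 : A < 1 by nra.
have hA : 0 <= A < 1 by lra.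
pose w s := Num.sqrt (speed_sq k A s).
have cw : cont01 w by apply/cont01_sqrt/cont01_speed_sq.
have N0 : 0 < 2 * x + 1 by lra.
pose g0 := 1 - (2 * x + 1)^-1; pose g s := g0 + A * s.
have cg : cont01 g.
  apply: cont01D; first exact: cont01_cst.
  by apply: cont01M; [exact: cont01_cst|exact: cont01_id].
have -> : avg n w = avg n (fun s => g s * w s).
  rewrite -[LHS]addr0 -bal -avgD//; last exact: cont01_balance_term.
  by apply: eq_avg => s _; rewrite /balance_term /g /g0 -/(w s); ring.
(* The remainder A ^ 2 s ^ 2 / (1 - A s) of the geometric series is at most B s ^ 2, because A s <=
   1 / x. This makes the majorant [U] a polynomial of degree 5 in s. *)
pose B := A ^+ 2 * x / (x - 1).
pose y2 := (x + 1) ^+ 2 * A; pose t6 := (x + 1) * (2 * x + 1) / 6.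
pose U s := g s ^+ 2 * (y2 * (1 - s) * (1 + A * s + B * s ^+ 2) + t6 * (1 - A * s)).
have cU : cont01 U.
  apply: cont01M; first exact: cont01X.
  have cA : cont01 (fun s : R => A * s) by apply: cont01M; [exact: cont01_cst|exact: cont01_id].
  apply: cont01D; apply: cont01M; try exact: cont01_cst.
  - apply: cont01M; first exact: cont01_cst.
    by apply: cont01B; [exact: cont01_cst|exact: cont01_id].
  - apply: cont01D; first by apply: cont01D => //; exact: cont01_cst.
    by apply: cont01M; [exact: cont01_cst|exact/cont01X/cont01_id].
  - by apply: cont01B => //; exact: cont01_cst.
have h1 : avg n (fun s => g s * w s) ^+ 2 <= avg n U.
  apply: le_trans (sqr_avg_le (cont01M cg cw)) _.
  apply: le_avg => //; first by apply/cont01X/cont01M.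
  move=> s hs; have p : 0 < 1 - A * s by exact: one_sub_gt0.
  rewrite /U exprMn /w sqr_sqrtr ?ler_wpM2l ?sqr_ge0//; last exact/ltW/speed_sq_gt0.
  rewrite /speed_sq -/y2 -/t6 lerD2r ler_pdivrMr//.
  have ys : 0 <= y2 * (1 - s).
    by rewrite mulr_ge0//; [rewrite mulr_ge0 ?sqr_ge0// ltW|lra].
  rewrite -[leLHS]mulr1 -[leRHS]mulrA ler_wpM2l//.
  have -> : (1 + A * s + B * s ^+ 2) * (1 - A * s) =
    1 + s ^+ 2 * (A ^+ 2 * (x * (1 - A * s) - (x - 1)) / (x - 1)).
    by rewrite /B; field; apply: lt0r_neq0; lra.
  rewrite lerDl mulr_ge0 ?sqr_ge0// divr_ge0//; last lra.
  by rewrite mulr_ge0 ?sqr_ge0//; nra.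
have -> : (2 * x + 5 / 2 + 317 / 200 / x) ^+ 2 =
    12 * ((2 * x + 5 / 2 + 317 / 200 / x) ^+ 2 / 12) by field; apply: lt0r_neq0; lra.
rewrite ler_pM2l//; apply: (le_trans h1).
have -> : avg n U = avg n (fun s => g0 ^+ 2 * (y2 + t6)
   + (g0 ^+ 2 * (y2 * A - y2 - t6 * A) + 2 * g0 * A * (y2 + t6)) * s
   + (g0 ^+ 2 * (y2 * (B - A)) + 2 * g0 * A * (y2 * A - y2 - t6 * A) + A ^+ 2 * (y2 + t6)) * s ^+ 2
   + (- g0 ^+ 2 * (y2 * B) + 2 * g0 * A * (y2 * (B - A)) + A ^+ 2 * (y2 * A - y2 - t6 * A)) * s ^+ 3
   + (- (2 * g0 * A) * (y2 * B) + A ^+ 2 * (y2 * (B - A))) * s ^+ 4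
   + (- A ^+ 2 * (y2 * B)) * s ^+ 5).
  by apply: eq_avg => s _; rewrite /U /g; ring.
rewrite avg_poly5//.
(* With th = A k in [0, 1] in place of A, the claim becomes polynomial in th and k; it is certified
   by Bernstein products of degree 5 in th times powers of k - 2. *)
pose th := A * x; have th1 : 0 <= th <= 1 by rewrite Ax mulr_ge0// ltW.
have AE : A = th / x by rewrite /th mulfK// lt0r_neq0//; lra.
have Bn i j : 0 <= (x - 2) ^+ j * (th ^+ i * (1 - th) ^+ (5 - i)).
  by rewrite !mulr_ge0// exprn_ge0//; lra.
rewrite -subr_ge0 /g0 /y2 /t6 /B AE; move: th th1 Bn {AE} => th th1 Bn.
have xx : 0 <= x by [].
have x4 : 0 <= x - 1 by lra.
have x1 : x != 0 by apply: lt0r_neq0; lra.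
have x3 : x - 1 != 0 by apply: lt0r_neq0; lra.
pose Q0 := 6 * (x + 1) ^+ 2 * th + (x + 1) * (2 * x + 1) * x.
pose Q1 := 6 * (x + 1) ^+ 2 * th ^+ 2 - 6 * (x + 1) ^+ 2 * th * x - (x + 1) * (2 * x + 1) * th * x.
pose Q2 := 6 * (x + 1) ^+ 2 * th ^+ 2 * (th - x + 1).
pose Q3 := - 6 * (x + 1) ^+ 2 * th ^+ 3.
pose D := (2 * x ^+ 2 + 5 / 2 * x + 317 / 200) ^+ 2 * x ^+ 3 * (x - 1) * (2 * x + 1) ^+ 2
  - 2 * (x ^+ 2 * (x - 1) * Q0
           * (4 * x ^+ 4 + 2 * x ^+ 2 * th * (2 * x + 1) + 3 / 8 * th ^+ 2 * (2 * x + 1) ^+ 2)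
       + x * (x - 1) * Q1
           * (2 * x ^+ 4 + 3 / 2 * x ^+ 2 * th * (2 * x + 1) + 5 / 16 * th ^+ 2 * (2 * x + 1) ^+ 2)
       + x * Q2
           * (3 / 2 * x ^+ 4 + 5 / 4 * x ^+ 2 * th * (2 * x + 1)
              + 35 / 128 * th ^+ 2 * (2 * x + 1) ^+ 2)
       + x * Q3
           * (5 / 4 * x ^+ 4 + 35 / 32 * x ^+ 2 * th * (2 * x + 1)
              + 63 / 256 * th ^+ 2 * (2 * x + 1) ^+ 2)).
set Z := (X in 0 <= X).
have -> : Z = D / (12 * x ^+ 5 * (x - 1) * (2 * x + 1) ^+ 2).
  by rewrite /Z /D /Q0 /Q1 /Q2 /Q3; field; rewrite x1 x3 (lt0r_neq0 N0).
apply: divr_ge0; last by rewrite mulr_ge0 ?sqr_ge0// mulr_ge0// mulr_ge0// exprn_ge0.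
rewrite /D /Q0 /Q1 /Q2 /Q3 {Z D Q0 Q1 Q2 Q3}; move: Bn.
set y := x - 2 => Bn.
have -> : x = y + 2 by rewrite /y; ring.
instances Bn 0%N 9%N; instances Bn 1%N 9%N; instances Bn 2%N 9%N.
instances Bn 3%N 9%N; instances Bn 4%N 9%N; instances Bn 5%N 9%N.
clear Bn; lra.
Qed.

End AverageSpeedBound.

Section LengthBound.
Variable R : realType.
Local Notation T := (2 * pi : R).

(** For k = 1 the squared speed is 5 - A s - 4 (1 - A) / (1 - A s). The last term, with its sign, is
    nondecreasing in A, so [V] takes it at A = 21 / 25, where sqrt (1 - A) = 2 / 5 is rational and
    [avg_pole] applies with x = 3 / 7. *)
Lemma sqr_avg_speed_one_le (n : nat) (A : R) : (0 < n)%N -> 41 / 50 < A < 21 / 25 ->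
  12 * avg n (fun s => Num.sqrt (speed_sq 1 A s)) ^+ 2 <= (2 + 5 / 2 + 317 / 200) ^+ 2.
Proof.
move=> n_gt0 hA; have hA' : 0 <= A < 1 by lra.
pose V s : R := 5 - A * s - 16 / 21 * ((1 + 3 / 7) ^+ 2 / (4 * (3 / 7)) - s)^-1.
have p s : 0 <= s <= 1 -> 0 < (1 + 3 / 7 : R) ^+ 2 / (4 * (3 / 7)) - s.
  have -> : (1 + 3 / 7 : R) ^+ 2 / (4 * (3 / 7)) = 25 / 21 by field.
  lra.
have cA : cont01 (fun s : R => 5 - A * s).
  apply: cont01B; first exact: cont01_cst.
  by apply: cont01M; [exact: cont01_cst|exact: cont01_id].
have cp : cont01 (fun s : R => ((1 + 3 / 7) ^+ 2 / (4 * (3 / 7)) - s)^-1).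
  apply: cont01V => [s hs|]; first by rewrite gt_eqF// p.
  by apply: cont01B; [exact: cont01_cst|exact: cont01_id].
have cp' : cont01 (fun s : R => 16 / 21 * ((1 + 3 / 7) ^+ 2 / (4 * (3 / 7)) - s)^-1).
  by apply: cont01M => //; exact: cont01_cst.
have cQ : cont01 (fun s => Num.sqrt (speed_sq 1 A s)) by apply/cont01_sqrt/cont01_speed_sq.
have h : avg n (fun s => Num.sqrt (speed_sq 1 A s)) ^+ 2 <= avg n V.
  apply: (le_trans (sqr_avg_le n cQ)); apply: le_avg.
  - exact: cont01X.
  - exact: cont01B.
  move=> s hs; rewrite sqr_sqrtr; last exact/ltW/speed_sq_gt0.
  have ps := p s hs; have q : 0 < 1 - A * s by exact: one_sub_gt0.
  have E : (1 + 3 / 7 : R) ^+ 2 / (4 * (3 / 7)) = 25 / 21 by field.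
  rewrite /V /speed_sq; rewrite E in ps *.
  have -> : (1 + 1) ^+ 2 * A * (1 - s) / (1 - A * s) + (1 + 1) * (2 * 1 + 1) / 6 * (1 - A * s) =
    5 - A * s - 4 * (1 - A) / (1 - A * s) by field; apply: lt0r_neq0.
  rewrite lerD2l lerN2 ler_pdivlMr// mulrAC ler_pdivrMr//.
  by nra.
have h1 : avg n V = 299 / 100 + (41 / 50 - A) / 2.
  rewrite /V avgB// avgZ// (@avg_pole R n (3 / 7)) ?ltr_pdivrMr//; try lra.
  have -> : avg n (fun s => 5 - A * s) = avg n (fun s => 5 + (- A) * s + 0 * s ^+ 2
      + 0 * s ^+ 3 + 0 * s ^+ 4 + 0 * s ^+ 5) by apply: eq_avg => s _; ring.
  by rewrite avg_poly5//; field.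
rewrite h1 in h; lra.
Qed.

Variables (d k : nat) (a : R).
Hypotheses (k_gt0 : (0 < k)%N) (dk : d = (2 * k)%N) (a_gt0 : 0 < a) (a_lt1 : a < 1).
Local Notation gamma := (short_curve d k a).
Local Notation A := (a ^+ 2).
Local Notation w := (fun s => Num.sqrt (speed_sq k A s)).

Lemma cont01_sqrt_speed : cont01 w.
Proof. by apply/cont01_sqrt/cont01_speed_sq; exact: sqr_lt1. Qed.

Lemma twopi_neq0 : T != 0.
Proof. by rewrite gt_eqF// twopi_gt0. Qed.

Lemma short_curve_length : curve_length gamma = T * avg k.+1 w.
Proof.
rewrite /avg mulrA divff ?twopi_neq0// mul1r -pint_bndo; last exact: cont01_sqsin cont01_sqrt_speed.
by apply: eq_Rintegral => t _; exact: speed_short_curve.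
Qed.

Lemma balance_integralE : balance_integral k a = - (T / k%:R) * balance_avg k A.
Proof.
have k0 : k%:R != 0 :> R by rewrite pnatr_eq0 -lt0n.
have N0 : 2 * k%:R + 1 != 0 :> R by apply: lt0r_neq0; have : 0 <= k%:R :> R by []; lra.
have cb : cont01 (balance_term k A) by apply: cont01_balance_term; exact: sqr_lt1.
have cs : continuous (fun t : R => balance_term k A (sqsin k.+1 t)) by exact: cont01_sqsin.
rewrite /balance_avg /avg [RHS]mulrA.
have -> : - (T / k%:R) * T^-1 = - k%:R^-1 by rewrite mulNr mulrAC divff ?twopi_neq0// mul1r.
rewrite -pintZ// -pint_bndo; last by move=> t; apply: cvgM; [exact: cvg_cst|exact: cs].
apply: eq_Rintegral => t _.
rewrite xfun_speed// sqr_xfun// sqr_zfun /balance_term natrD natrM mulrA; congr (_ * _).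
by field; rewrite k0 N0.
Qed.

Lemma short_curve_length_le : balance_avg k A = 0 ->
  ((k = 1)%N -> 82 / 100 < A < 84 / 100) -> ((2 <= k)%N -> A < k%:R^-1) ->
  curve_length gamma <=
    pi / Num.sqrt 3 * d%:R + 5 * pi / (2 * Num.sqrt 3) + 586 / 100 * d%:R^-1.
Proof.
move=> bal h1 h2; rewrite short_curve_length.
have dE : d%:R = 2 * k%:R :> R by rewrite dk natrM.
have kp : 1 <= k%:R :> R by rewrite ler1n.
have {h1 h2} : 12 * avg k.+1 w ^+ 2 <= (2 * k%:R + 5 / 2 + 317 / 200 / k%:R) ^+ 2.
  have [k1|k2] := leqP k 1; last first.
    apply: sqr_avg_speed_le => //; first exact: exprn_gt0.
    by rewrite -ler_pdivlMr ?div1r ?ltr0n//; exact/ltW/h2.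
  have {k1}kE : k = 1%N by apply/eqP; rewrite eqn_leq k1 k_gt0.
  have := h1 kE; rewrite kE => hA; rewrite mulr1 divr1.
  by apply: sqr_avg_speed_one_le => //; lra.
rewrite dE; set x : R := k%:R in kp *; set m := avg _ _.
have m0 : 0 <= m.
  rewrite -(avg_cst k.+1 (0 : R)); apply: le_avg.
  - exact: cont01_cst.
  - exact: cont01_sqrt_speed.
  - by move=> s _; exact: sqrtr_ge0.
have x0 : 0 < x by lra.
have r0 : 0 < 317 / 200 / x by apply: divr_gt0; lra.
have s3 : 0 < Num.sqrt 3 :> R by rewrite sqrtr_gt0.
have s3s : Num.sqrt 3 ^+ 2 = 3 :> R by rewrite sqr_sqrtr.
set t : R := Num.sqrt 3 in s3 s3s *.
have t1 : 433 / 250 <= t by rewrite leNgt; apply/negP => ht; nra.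
have p1 := pi_lt_upper R; have p0 := pi_gt0 R; set p : R := pi in p0 p1 *.
set b := 2 * x + 5 / 2 + _ => hm.
have {}hm : 2 * t * m <= b.
  have b0 : 0 <= b by rewrite /b; lra.
  have tm0 : 0 <= 2 * t * m by rewrite mulr_ge0// mulr_ge0// ltW.
  rewrite -ler_sqr ?nnegrE; [|exact: tm0|exact: b0].
  by apply: le_trans hm; rewrite !exprMn s3s; lra.
have -> : 2 * p * m = p / t * (2 * t * m) by field; exact: lt0r_neq0.
have pt : 0 < p / t by exact: divr_gt0.
apply: (le_trans (y := p / t * b)); first by rewrite ler_pM2l.
have -> : p / t * (2 * x) + 5 * p / (2 * t) + 586 / 100 * (2 * x)^-1 =
  p / t * (2 * x + 5 / 2) + 293 / 100 / x by field; rewrite !lt0r_neq0.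
rewrite /b mulrDr lerD2l.
(* Here 317 / 200 meets the constant 5.86: pi < 3.2 and sqrt 3 >= 433 / 250 give pi / sqrt 3 * 317 /
   200 <= 293 / 100. *)
have -> : p / t * (317 / 200 / x) = (p / t * (317 / 200)) / x by ring.
rewrite ler_pM2r ?invr_gt0// mulrAC ler_pdivrMr//; lra.
Qed.

End LengthBound.

(** * The short curve is a 2-design *)

Section ShortCurveDesign.
Variables (R : realType) (d k : nat) (a : R).
Hypotheses (k_gt0 : (0 < k)%N) (dk : d = (2 * k)%N) (a_gt0 : 0 < a) (a_lt1 : a < 1).
Local Notation T := (2 * pi : R).
Local Notation gamma := (short_curve d k a).
Local Notation A := (a ^+ 2).
Implicit Types (i j : 'I_d.+1) (t p : R).
Hypothesis balanced : balance_avg k A = 0.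

Let w t : R := Num.sqrt (speed_sq k A (sqsin k.+1 t)).

Let w_cont : continuous w.
Proof. exact: (cont01_sqsin (@cont01_sqrt_speed R k a a_gt0 a_lt1)). Qed.

(* Coordinate i of the curve is amp i * cos (freq i * theta - phase i), where amp i
   has period pi / (k + 1). *)
Let amp i t : R := if i == d :> nat then a else xfun k a t.
Let freq (i : nat) : nat := if i == d then k.+1 else i./2.+1.
Let phase i : R := if (i == d :> nat) || odd i then pi / 2 else 0.

Let short_curveE i t : gamma t 0 i = amp i t * cos ((freq i)%:R * t - phase i).
Proof.
rewrite mxE /amp /freq /phase; case: ifP => _ /=.
  by rewrite cosB cos_pihalf sin_pihalf mulr0 add0r mulr1.
case: ifP => _; last by rewrite subr0.
by rewrite cosB cos_pihalf sin_pihalf mulr0 add0r mulr1.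
Qed.

Let freq_ltn i : (i != d :> nat) -> (freq i <= k)%N.
Proof.
move=> id; rewrite /freq (negbTE id).
have : (i < 2 * k)%N by rewrite -dk ltn_neqAle id -ltnS ltn_ord.
by rewrite mul2n ltn_half_double.
Qed.

Let freq_gt0 i : (0 < freq i)%N.
Proof. by rewrite /freq; case: ifP. Qed.

Let freq_le i : (freq i <= k.+1)%N.
Proof. by have [id|/freq_ltn /leqW//] := eqVneq (i : nat) d; rewrite /freq id eqxx. Qed.

(** Only the last coordinate has frequency k + 1; the others have at most k. *)
Let freqD i j : i != j -> (freq i + freq j < 2 * k.+1)%N.
Proof.
move=> ij; have [id|/freq_ltn] := eqVneq (i : nat) d; last by have := freq_le j; lia.
have jd : j != d :> nat by apply: contra ij => /eqP jd; apply/eqP/val_inj; rewrite /= id jd.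
by have := freq_ltn jd; have := freq_le i; lia.
Qed.

(** Distinct coordinates of equal frequency form a cosine-sine pair, a quarter turn apart. *)
Let cos_phaseB i j : i != j -> freq i = freq j -> cos (phase i - phase j) = 0.
Proof.
move=> ij; wlog jd : i j ij / j != d :> nat => [hw|].
  have [jd|] := eqVneq (j : nat) d; last exact: hw.
  have id : i != d :> nat by apply: contra ij => /eqP id; apply/eqP/val_inj; rewrite /= id jd.
  by move=> e; rewrite -cosN opprB; apply: hw => //; rewrite eq_sym.
have [id|id] := eqVneq (i : nat) d.
  by move=> e; have := freq_ltn jd; rewrite -e /freq id eqxx ltnn.
rewrite /freq /phase (negbTE id) (negbTE jd)/= => -[e].
have : odd i != odd j.
  by apply: contra ij => /eqP o; apply/eqP/val_inj; rewrite /= -[LHS]odd_double_half o e odd_double_half.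
case: (odd i); case: (odd j) => // _; first by rewrite subr0 cos_pihalf.
by rewrite sub0r cosN cos_pihalf.
Qed.

Let sqsin_per t : sqsin k.+1 (t + pi / k.+1%:R) = sqsin k.+1 t.
Proof.
rewrite /sqsin mulrDr [k.+1%:R * (pi / _)]mulrC divfK ?pnatr_eq0//.
by rewrite sinDpi sqrrN.
Qed.

Let w_per t : w (t + pi / k.+1%:R) = w t.
Proof. by rewrite /w sqsin_per. Qed.

Let xfun_per t : xfun k a (t + pi / k.+1%:R) = xfun k a t.
Proof. by rewrite /xfun !sqr_zfun sqsin_per. Qed.

Let amp_per i t : amp i (t + pi / k.+1%:R) = amp i t.
Proof. by rewrite /amp xfun_per. Qed.

Let amp_cont i : continuous (amp i).
Proof.
have -> : amp i = if i == d :> nat then fun=> a else xfun k a.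
  by apply/funext => t; rewrite /amp; case: ifP.
move=> t; case: ifP => _; first exact: cst_continuous.
by have := der_xfun k_gt0 a_gt0 a_lt1 t => dx; exact: (der_cont dx).
Qed.

Let coord_cont i : continuous (fun t => gamma t 0 i).
Proof. by move=> t; exact: (der_cont (der_short_curve k_gt0 a_gt0 a_lt1 t i)). Qed.

Let contM (f g : R -> R) : continuous f -> continuous g -> continuous (fun t => f t * g t).
Proof. by move=> fc gc t; apply: cvgM; [exact: fc|exact: gc]. Qed.

Let pint_coord i : pint (fun t => gamma t 0 i * w t) = 0.
Proof.
pose W t := amp i t * w t.
have Wc : continuous W by exact: contM.
have Wp t : W (t + pi / k.+1%:R) = W t by rewrite /W amp_per w_per.
have hm : (0 < freq i < 2 * k.+1)%N by rewrite freq_gt0/=; have := freq_le i; lia.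
rewrite -(pint_orthogonal (ltn0Sn k) Wc Wp (phase i) hm).
by apply: eq_pint => t; rewrite short_curveE /W; ring.
Qed.

(** Product to sum leaves the sum and the difference of the two frequencies, both below 2 (k + 1),
    so [pint_orthogonal] applies. If the difference is 0, the phases are a quarter turn apart and
    the term vanishes identically. *)
Let pint_coord_neq i j : i != j -> pint (fun t => gamma t 0 i * gamma t 0 j * w t) = 0.
Proof.
wlog fij : i j / (freq j <= freq i)%N => [hw ij|].
  have [|/ltnW h] := leqP (freq j) (freq i); first by move=> h; exact: hw.
  rewrite -(hw j i h); last by rewrite eq_sym.
  by apply: eq_pint => t; congr (_ * _); exact: mulrC.
move=> ij; pose W t := 2^-1 * (amp i t * amp j t * w t).
have Wc : continuous W.
  by apply: contM; [move=> t; exact: cst_continuous|apply: contM => //; exact: contM].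
have Wp t : W (t + pi / k.+1%:R) = W t by rewrite /W !amp_per w_per.
have hp : (0 < freq i + freq j < 2 * k.+1)%N by rewrite freqD// addn_gt0 freq_gt0.
have cW (m p : R) : continuous (fun t => cos (m * t - p) * W t).
  by apply: contM => //; exact: continuous_cosn.
have E : forall t, gamma t 0 i * gamma t 0 j * w t =
    cos ((freq i + freq j)%:R * t - (phase i + phase j)) * W t +
    cos ((freq i - freq j)%:R * t - (phase i - phase j)) * W t.
  move=> t; rewrite !short_curveE /W natrB// natrD.
  set u := (freq i)%:R * t; set v := (freq j)%:R * t.
  have -> : ((freq i)%:R + (freq j)%:R) * t - (phase i + phase j) =
    (u - phase i) + (v - phase j) by rewrite /u /v; ring.
  have -> : ((freq i)%:R - (freq j)%:R) * t - (phase i - phase j) =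
    (u - phase i) - (v - phase j) by rewrite /u /v; ring.
  set b := u - phase i; set c := v - phase j.
  by rewrite (cosD b c) (cosB b c); field.
rewrite (eq_pint E) pintD//.
rewrite (pint_orthogonal (ltn0Sn k) Wc Wp _ hp) add0r.
have [e|ne] := eqVneq (freq i) (freq j).
  have h t : cos ((freq i - freq j)%:R * t - (phase i - phase j)) * W t = 0.
    by rewrite e subnn mul0r sub0r cosN cos_phaseB// mul0r.
  by rewrite (eq_pint h) pint_cst mulr0.
apply: (pint_orthogonal (ltn0Sn k) Wc Wp).
by have := freq_le i; move: ne fij; lia.
Qed.

Let L : R := pint w.

(** This is the balance condition, since d + 1 = 2 k + 1. *)
Let pint_sqr_zfun : pint (fun t => zfun k a t ^+ 2 * w t) = L / d.+1%:R.
Proof.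
have dR : d.+1%:R = 2 * k%:R + 1 :> R by rewrite -natr1 dk natrM.
have cs : continuous (fun t => zfun k a t ^+ 2 * w t).
  apply: contM => // t; have := der_zfun k a t => dz.
  by apply: (der_cont (derM dz dz)).
apply/eqP; rewrite -subr_eq0 mulrC -pintZ//; rewrite -pintB//; last first.
  by apply: contM => // t; exact: cst_continuous.
have := balanced; rewrite /balance_avg /avg => /eqP.
rewrite mulf_eq0 invr_eq0 (negbTE (twopi_neq0 R))/= => /eqP <-; apply/eqP.
by apply: eq_pint => t; rewrite sqr_zfun /balance_term -/(w t) dR; ring.
Qed.

(** For the paired coordinates, cos ^ 2 splits into 1 / 2 and an oscillation that drops out by
    orthogonality; half of x ^ 2 has mean (1 - 1 / (2 k + 1)) / (2 k) = 1 / (2 k + 1). *)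
Let pint_coord_sqr i : pint (fun t => gamma t 0 i * gamma t 0 i * w t) = L / d.+1%:R.
Proof.
have cz : continuous (fun t => zfun k a t ^+ 2 * w t).
  apply: contM => // t; have := der_zfun k a t => dz.
  by apply: (der_cont (derM dz dz)).
have [id|id] := eqVneq (i : nat) d.
  by rewrite -pint_sqr_zfun; apply: eq_pint => t; rewrite mxE id eqxx expr2.
pose W t := 2^-1 * (xfun k a t ^+ 2 * w t).
have Wc : continuous W.
  apply: contM; first by move=> t; exact: cst_continuous.
  apply: contM => // t; have := der_xfun k_gt0 a_gt0 a_lt1 t => dx.
  by apply: (der_cont (derM dx dx)).
have Wp t : W (t + pi / k.+1%:R) = W t by rewrite /W xfun_per w_per.
have hf : (0 < 2 * freq i < 2 * k.+1)%N.
  by have := freq_ltn id; have := freq_gt0 i; lia.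
have E t : gamma t 0 i * gamma t 0 i * w t =
    W t + cos ((2 * freq i)%:R * t - 2 * phase i) * W t.
  rewrite short_curveE /W /amp (negbTE id) natrM.
  set b := (freq i)%:R * t - phase i.
  have -> : 2 * (freq i)%:R * t - 2 * phase i = b *+ 2 by rewrite mulr2n /b; ring.
  by rewrite cos_mulr2n mulr2n; field.
rewrite (eq_pint E) pintD//; last by apply: contM => //; exact: continuous_cosn.
rewrite (pint_orthogonal (ltn0Sn k) Wc Wp _ hf) addr0.
have k0 : k%:R != 0 :> R by rewrite pnatr_eq0 -lt0n.
have E2 t : W t = (2 * k%:R)^-1 * w t - (2 * k%:R)^-1 * (zfun k a t ^+ 2 * w t).
  by rewrite /W sqr_xfun//; field.
rewrite (eq_pint E2) pintB; try by apply: contM => // t; exact: cst_continuous.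
rewrite !pintZ// pint_sqr_zfun -/L.
have dR : d.+1%:R = 2 * k%:R + 1 :> R by rewrite -natr1 dk natrM.
by rewrite dR; field; rewrite k0 lt0r_neq0.
Qed.

Variable sigma : probability (borel_rV R d.+1) R.
Hypotheses (d_gt0 : (0 < d)%N) (d_even : ~~ odd d) (sigma_unif : uniform_on_sphere sigma).
Local Notation S := (sphere R d : set (borel_rV R d.+1)).

Let L_gt0 : 0 < L.
Proof.
have w0 t : 0 < w t.
  by rewrite /w sqrtr_gt0 speed_sq_gt0 ?sqsin01//; exact: sqr_lt1.
(* The second term of [speed_sq] at s = 1, a positive lower bound for the squared speed. *)
pose c : R := Num.sqrt ((k%:R + 1) * (2 * k%:R + 1) / 6 * (1 - A)).
have hA := sqr_lt1 a_gt0 a_lt1; have kR : 0 <= k%:R :> R by [].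
have c0 : 0 < c.
  by rewrite sqrtr_gt0 !mulr_gt0//; lra.
suff : T * c <= L by apply: lt_le_trans; rewrite mulr_gt0// twopi_gt0.
rewrite -pint_cst; apply: le_pint => // [t|t]; first exact: cst_continuous.
apply: ler_wsqrtr; have hs := sqsin01 k.+1 t; set s := sqsin _ t in hs *.
have p := one_sub_gt0 hA hs.
rewrite /speed_sq ler_wpDl//.
  have hn : 0 <= (k%:R + 1) ^+ 2 * A by apply: mulr_ge0; exact: sqr_ge0.
  by apply: divr_ge0; [apply: mulr_ge0 => //; lra|exact: ltW].
have q : 0 <= (k%:R + 1) * (2 * k%:R + 1) / 6 :> R by rewrite divr_ge0// mulr_ge0//; lra.
apply: (ler_wpM2l q); have : A * s <= A * 1 by apply: ler_wpM2l; lra.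
lra.
Qed.

(** The design identity for one function, bundled with the integrability and continuity that make it
    stable under linear combinations; it then only has to be checked on monomials. *)
Let quadrature (g : 'rV[R]_d.+1 -> R) :=
  [/\ sigma.-integrable S (EFin \o (g : borel_rV R d.+1 -> R)),
      continuous (fun t => g (gamma t))
    & \int[sigma]_(v in S) g v = L^-1 * pint (fun t => g (gamma t) * w t)].

Let quad_cst (c : R) : quadrature (fun=> c).
Proof.
split.
- apply: (@sphere_integrable _ _ _ (fun=> c) `|c|) => //; exact: measurable_cst.
- by move=> t; exact: cst_continuous.
- rewrite (sphere_integral_cst sigma_unif) pintZ// mulrCA mulVf ?mulr1//.
  exact: lt0r_neq0.
Qed.

Let quadM (c : R) g : quadrature g -> quadrature (fun v => c * g v).
Proof.
move=> [gi gc ge]; split.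
- by apply: RintegrableZ => //; exact: measurable_sphere.
- by apply: contM => // t; exact: cst_continuous.
- rewrite RintegralZl//; last exact: measurable_sphere.
  rewrite ge mulrCA -pintZ; last exact: contM.
  by congr (_ * _); apply: eq_pint => t; rewrite mulrA.
Qed.

Let quadD g h : quadrature g -> quadrature h -> quadrature (fun v => g v + h v).
Proof.
move=> [gi gc ge] [hi hc he]; split.
- by apply: RintegrableD => //; exact: measurable_sphere.
- by move=> t; apply: cvgD; [exact: gc|exact: hc].
- rewrite RintegralD//; last exact: measurable_sphere.
  rewrite ge he -mulrDr -pintD; try exact: contM.
  by congr (_ * _); apply: eq_pint => t; rewrite mulrDl.
Qed.

Let quad_coord i : quadrature (fun v => v 0 i).
Proof.
split; [exact: sphere_integrable_coord|exact: coord_cont|].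
by rewrite (sphere_integral_coord d_gt0 d_even sigma_unif) pint_coord mulr0.
Qed.

Let quad_coord2 i j : quadrature (fun v => v 0 i * v 0 j).
Proof.
split; [exact: sphere_integrable_coord2|exact: contM|].
have [<-|ij] := eqVneq i j.
  rewrite (sphere_integral_coord_sqr d_even sigma_unif) pint_coord_sqr mulrA mulVf ?mul1r//.
  exact: lt0r_neq0.
by rewrite (sphere_integral_coord_neq d_gt0 d_even sigma_unif ij) pint_coord_neq// mulr0.
Qed.

Let quad_meval (p : mpoly d.+1 R) : (msize p <= 3)%N ->
  quadrature (fun v => meval (fun i => v 0 i) p).
Proof.
move=> hp; have : {in msupp p, forall m, (mdeg m <= 2)%N}.
  by move=> m /msize_mdeg_lt hm; rewrite -ltnS (leq_trans hm).
have -> : (fun v : 'rV[R]_d.+1 => meval (fun i => v 0 i) p) =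
    (fun v => \sum_(m <- msupp p) mcoeff m p * \prod_i v 0 i ^+ m i).
  by apply/funext => v; rewrite mevalE.
elim: (msupp p) => [|m r IH] hr.
  have -> : (fun v : 'rV[R]_d.+1 => \sum_(m <- [::]) mcoeff m p * \prod_i v 0 i ^+ m i) = fun=> 0.
    by apply/funext => v; rewrite big_nil.
  exact: quad_cst.
have -> : (fun v : 'rV[R]_d.+1 => \sum_(m <- m :: r) mcoeff m p * \prod_i v 0 i ^+ m i) =
    (fun v => mcoeff m p * \prod_i v 0 i ^+ m i + \sum_(m <- r) mcoeff m p * \prod_i v 0 i ^+ m i).
  by apply/funext => v; rewrite big_cons.
apply: quadD; last by apply: IH => q qr; apply: hr; rewrite inE qr orbT.
apply: quadM; have := @quadratic_monomial R _ _ (hr m (mem_head _ _)).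
case=> [e|[i e]|[i [j e]]].
- by have -> : (fun v : 'rV[R]_d.+1 => \prod_i v 0 i ^+ m i) = (fun=> 1)
    by apply/funext => v; rewrite (e (fun i => v 0 i)).
- by have -> : (fun v : 'rV[R]_d.+1 => \prod_i v 0 i ^+ m i) = (fun v => v 0 i)
    by apply/funext => v; rewrite (e (fun i => v 0 i)).
- by have -> : (fun v : 'rV[R]_d.+1 => \prod_i v 0 i ^+ m i) = (fun v => v 0 i * v 0 j)
    by apply/funext => v; rewrite (e (fun i => v 0 i)).
Qed.

Lemma short_curve_design : design_curve sigma 2 gamma.
Proof.
have LE : curve_length gamma = L.
  rewrite /L -pint_bndo//; apply: eq_Rintegral => t _.
  exact: (speed_short_curve k_gt0 dk a_gt0 a_lt1).
split; [exact: (short_curve_lipschitz_closed k_gt0 dk a_gt0 a_lt1)|by rewrite LE|].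
move=> f [p /quad_meval[pi pc pe] fp].
transitivity (\int[sigma]_(v in S) meval (fun i => (v : 'rV[R]_d.+1) 0 i) p).
  by apply: eq_Rintegral => v /set_mem; exact: fp.
rewrite pe LE -pint_bndo; last by apply: contM.
congr (_ * _); apply: eq_Rintegral => t _.
by rewrite fp ?(speed_short_curve k_gt0 dk a_gt0 a_lt1)//; exact: (short_curve_sphere k_gt0 dk a_gt0 a_lt1).
Qed.

End ShortCurveDesign.

Theorem theorem10 (R : realType) (d : nat) (d_gt0 : (0 < d)%N)
    (d_even : ~~ odd d) (sigma : probability (borel_rV R d.+1) R)
    (sigma_unif : uniform_on_sphere sigma) :
  (forall gamma : R -> 'rV[R]_d.+1, design_curve sigma 2 gamma ->
     pi / Num.sqrt 3 * d%:R + 5 * pi / (2 * Num.sqrt 3)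
       + 144 / 100 * d%:R^-1 <= curve_length gamma)
  /\
  (forall k : nat, d = (2 * k)%N ->
     exists a : R,
       [/\ 0 < a < 1,
           balance_integral k a = 0,
           (k = 1%N -> 820 / 1000 < a ^+ 2 < 821 / 1000)
           /\ ((2 <= k)%N ->
                 k%:R^-1 - (2 * k%:R ^+ 3)^-1 < a ^+ 2
                   < k%:R^-1 + (4 * k%:R ^+ 3)^-1),
           design_curve sigma 2 (short_curve d k a)
         & curve_length (short_curve d k a) <=
             pi / Num.sqrt 3 * d%:R + 5 * pi / (2 * Num.sqrt 3)
               + 586 / 100 * d%:R^-1]).
Proof.
split; first by move=> gamma; exact: design_curve_length_lower.
move=> k dk; have k_gt0 : (0 < k)%N by move: d_gt0; rewrite dk muln_gt0.
have [A [/andP[A0 A1] bal win1 win2]] := balance_root R k_gt0.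
have aE : Num.sqrt A ^+ 2 = A by rewrite sqr_sqrtr// ltW.
have a0 : 0 < Num.sqrt A by rewrite sqrtr_gt0.
have a1 : Num.sqrt A < 1 by rewrite -ltr_sqr ?nnegrE ?(ltW a0)// aE expr1n.
have bal' : balance_avg k (Num.sqrt A ^+ 2) = 0 by rewrite aE.
exists (Num.sqrt A); split.
- by rewrite a0.
- by rewrite (balance_integralE k_gt0 a0 a1) bal' mulr0.
- rewrite aE; split=> [|k2]; first exact: win1.
  have /andP[h1 h2] := win2 k2.
  have x2 : 2 <= k%:R :> R by rewrite ler_nat.
  have x0 : 0 < k%:R :> R by lra.
  apply/andP; split.
    apply: lt_trans h1; rewrite -subr_gt0; move: x0 x2; set x : R := k%:R => x0 x2.
    have q : 0 < 2 * x ^+ 2 + 1 by have := sqr_ge0 x; lra.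
    have -> : 2 * x / (2 * x ^+ 2 + 1) - (x^-1 - (2 * x ^+ 3)^-1) =
      (2 * x ^+ 3 * (2 * x ^+ 2 + 1))^-1.
      by field; rewrite !lt0r_neq0.
    by rewrite invr_gt0 mulr_gt0// mulr_gt0// exprn_gt0.
  by apply: (lt_trans h2); rewrite ltrDl invr_gt0 mulr_gt0// exprn_gt0.
- exact: (short_curve_design k_gt0 dk a0 a1 bal' d_gt0 d_even sigma_unif).
- apply: (short_curve_length_le k_gt0 dk a0 a1 bal'); rewrite aE.
    by move=> k1; have := win1 k1; lra.
  by move=> k2; have /andP[] := win2 k2.
Qed.
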